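(* 1. For every $t\in[\varepsilon_\omega,\infty)$: $G(t)\subseteq\mathrm{Lim}\,\mathbb{E}$. 2. For every $t\in[\varepsilon_\omega,\infty)$: $G(t)=A(t)$.
   Context: Notation. $\mathbb{P}=\{\omega^\xi\}$; $\mathbb{E}$ = epsilon numbers, $\varepsilon_\omega$ its $\omega$-th element; $x^+:=\min\{e\in\mathbb{E}:e>x\}$; Cantor normal form $x=_{\mathrm{CNF}}L_1l_1+\dots+L_nl_n$ ($L_1>\dots>L_n$ in $\mathbb{P}$, $0<l_i<\omega$). $\mathrm{Lim}(X)$: class of ordinals $\alpha>0$ with $\sup(X\cap\alpha)=\alpha$. For a successor ordinal $Q$, $Q-1$ is its predecessor. $\mathrm{Ep}(x)$: $\{x\}$ if $x\in\mathbb{E}$; $\mathrm{Ep}(L_1)\cup\dots\cup\mathrm{Ep}(L_n)$ if $x\notin\mathbb{E}$, $x=_{\mathrm{CNF}}L_1l_1+\dots+L_nl_n$, $n\ge2$ or $l_1\ge2$; $\mathrm{Ep}(L)$ if $x\notin\mathbb{E}$, $x=_{\mathrm{CNF}}\omega^L$; $\mathrm{Ep}(0)=\emptyset$. Substitution, for $\alpha\in\mathbb{E}$ and an ordinal $e$, by recursion on $x$: $x[\alpha:=e]=x$ if $x\in\mathbb{E}\setminus\{\alpha\}$; $=e$ if $x=\alpha$; $=L_1[\alpha:=e]l_1+\dots+L_n[\alpha:=e]l_n$ if $x\notin\mathbb{E}$, $x=_{\mathrm{CNF}}L_1l_1+\dots+L_nl_n$, $n\ge2$ or $l_1\ge2$;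 $=\omega^{L[\alpha:=e]}$ if $x\notin\mathbb{E}$, $x=_{\mathrm{CNF}}\omega^L$. $\pi,d,\eta$: for $t=_{\mathrm{CNF}}\omega^{T_1}t_1+\dots$, $\pi t:=\omega^{T_1}$; $dq:=0$ if $q\notin\mathbb{P}$, $dq:=Q_m$ if $q=\omega^Q$, $Q=_{\mathrm{CNF}}\omega^{Q_1}q_1+\dots+\omega^{Q_m}q_m$; $\eta t:=\max\{t,\pi t+d\pi t\}$. Relations. For finite $Z,\tilde Z$, a bijection $h:Z\to\tilde Z$ is an $(<,<_1,+)$-isomorphism if for $x,y,z\in Z$: $x<y\iff h(x)<h(y)$, $x<_1y\iff h(x)<_1h(y)$, $x+y=z\iff h(x)+h(y)=h(z)$; an $(<,<_1,+,\lambda x.\omega^x)$-isomorphism if also $\omega^x=y\iff\omega^{h(x)}=h(y)$. Carlson's $<_1$ (recursion on $\beta$): $\alpha<_1\beta$ iff $\alpha<\beta$ and every finite $B\subseteq\beta$ admits an $(<,<_1,+)$-isomorphism $h:B\to h[B]\subseteq\alpha$ fixing $B\cap\alpha$ pointwise. $\alpha<^1\beta$: $\alpha<\beta$ and for every finite $Z\subseteq\beta$ there are a finite $\tilde Z\subseteq\alpha$ and an $(<,<_1,+,\lambda x.\omega^x)$-isomorphism $h:Z\to\tilde Z$ fixing $Z\cap\alpha$ pointwise; $\alpha\le^1\beta$ iff $\alpha<^1\beta$ or $\alpha=\beta$. Approximating sequences. For $\alpha\in\mathbb{E}$ and limit $t\in(\alpha,\alpha^+)$, define $\sigma(t,\alpha)=(l_j)_{j\in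 I}$ by recursion on $t$. Write $t=_{\mathrm{CNF}}\omega^{T_1}t_1+\dots+\omega^{T_n}t_n$, $T_1=_{\mathrm{CNF}}\omega^{Q_1}q_1+\dots+\omega^{Q_m}q_m$, and $P:=\omega^{Q_1}q_1+\dots+\omega^{Q_{m-1}}q_{m-1}$. (i) $n=1,t_1=1$: if $Q_m=0$: $l_j:=\omega^{P+(q_m-1)}\cdot j$, $I=\omega\setminus\{0\}$; if $0<Q_m<\alpha$, $Q_m$ successor: $l_j:=\omega^{P+\omega^{Q_m}(q_m-1)+\omega^{Q_m-1}j}$, $I=\omega\setminus\{0\}$; if $Q_m<\alpha$ limit: $l_j:=\omega^{P+\omega^{Q_m}(q_m-1)+\omega^j}$, $I=Q_m\setminus\{0\}$; if $Q_m=\alpha$ (then $m=1$): $l_j:=\omega^{\omega^\alpha(q_1-1)+\omega^j}$, $I=\alpha\setminus\{0\}$; if $Q_m>\alpha$: with $(\xi_j)_{j\in I}:=\sigma(\omega^{Q_m},\alpha)$, $l_j:=\omega^{P+\omega^{Q_m}(q_m-1)+\xi_j}$. (ii) $n=1,t_1\ge2$: if $T_1=\alpha$: $l_j:=\omega^{T_1}(t_1-1)+j$, $I=\alpha\setminus\{0\}$; if $T_1>\alpha$: with $(\xi_j)_{j\in I}:=\sigma(\omega^{T_1},\alpha)$, $l_j:=\omega^{T_1}(t_1-1)+\xi_j$. (iii) $n\ge2$, with $R:=\omega^{T_1}t_1+\dots+\omega^{T_{n-1}}t_{n-1}+\omega^{T_n}(t_n-1)$: if $T_n<\alpha$: $l_j:=R+j$,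 $I=\omega^{T_n}\setminus\{0\}$; if $T_n=\alpha$: $l_j:=R+j$, $I=\alpha\setminus\{0\}$; if $T_n>\alpha$: with $(\xi_j)_{j\in I}:=\sigma(\omega^{T_n},\alpha)$, $l_j:=R+\xi_j$. Hierarchy $A$. For $t\in[\varepsilon_\omega,\infty)$ let $\alpha\in\mathbb{E}$ with $t\in[\alpha,\alpha^+)$ and $M:=\max(\mathrm{Ep}(t)\cap\alpha)$ if nonempty, else $M:=0$. Define by recursion: $A(l+1):=A(l)$ if $l<\pi l+d\pi l$, and $A(l+1):=\mathrm{Lim}\,A(l)$ otherwise. For limit $t$: $A(t):=(\mathrm{Lim}\,\mathbb{E})\cap(M,\alpha+1)$ if $t\in[\alpha,\alpha\cdot2]$; $A(t):=\mathrm{Lim}\{r\le\alpha: M<r\in\bigcap_{j\in I\cap r}A(l_j)\}$ if $t>\pi t+d\pi t$ and $t\in(\alpha\cdot2,\alpha^+)$, where $(l_j)_{j\in I}=\sigma(t,\alpha)$; $A(t):=\mathrm{Lim}\{r\le\alpha: M<r\in\bigcap_{j\in S\cap r}A(e_j)\}$ if $t\le\pi t+d\pi t$ and $t\in(\alpha\cdot2,\alpha^+)$, where $(e_j)_{j\in S}=\sigma(\pi t,\alpha)$. $G(t):=\{\beta\in\mathrm{OR}: \mathrm{Ep}(t)\cap\alpha\subseteq\beta\le\alpha \text{ and } \beta\le^1(\eta t)[\alpha:=\beta]+1\}$, with $\alpha\in\mathbb{E}$ such that $t\in[\alpha,\alpha^+)$.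
   Formalization: In σ case (i) with Q_m=α, ''then m=1'' fails (e.g. t=ω^{ω^{α+1}+ω^α}); the formula is taken as l_j=ω^{P+ω^{Q_m}(q_m−1)+ω^j}, equal to the stated one when m=1. The missing value 0[α:=e]=0 is added to substitution. *)

(* Defs.v *)
(* Ordinals are represented as the elements of an arbitrary
   well-ordered type (O, lt); every notion below is defined *relationally*
   and only refers to initial segments, so it agrees with the usual notion
   on the ordinal (order type) of each element. *)
From Stdlib Require Import List Arith.
Import ListNotations.

Section Ordinals.
Variable O : Type.
Variable lt : O -> O -> Prop.

Definition le (x y : O) : Prop := lt x y \/ x = y.
Definition zero (z : O) : Prop := forall x, ~ lt x z.
Definition pos (x : O) : Prop := exists w, lt w x.
Definition succ (x y : O) : Prop := lt x y /\ forall z, lt x z -> le y z.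
Definition islim (x : O) : Prop :=
  pos x /\ forall z, lt z x -> exists w, lt z w /\ lt w x.

Definition iso_pred (P Q : O -> Prop) : Prop :=
  exists f : O -> O,
    (forall x, P x -> Q (f x)) /\
    (forall x y, P x -> P y -> (lt x y <-> lt (f x) (f y))) /\
    (forall z, Q z -> exists x, P x /\ f x = z).

Definition add (x y z : O) : Prop :=
  le x z /\ iso_pred (fun w => le x w /\ lt w z) (fun w => lt w y).

(* additively principal ordinals  P = { omega^xi } *)
Definition addPrin (y : O) : Prop :=
  pos y /\ forall a b, lt a y -> lt b y -> exists c, lt c y /\ add a b c.

(* omega^x = y : y is the x-th additively principal ordinal *)
Definition omexp (x y : O) : Prop :=
  addPrin y /\ iso_pred (fun p => addPrin p /\ lt p y) (fun w => lt w x).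

Definition Eps (e : O) : Prop := omexp e e.

Fixpoint ofnat (n : nat) (x : O) : Prop :=
  match n with
  | 0 => zero x
  | S n' => exists y, ofnat n' y /\ succ y x
  end.

Fixpoint nmul (y : O) (n : nat) (a : O) : Prop :=
  match n with
  | 0 => zero a
  | S n' => exists b, nmul y n' b /\ add b y a
  end.

Fixpoint lsum (s : list (O * nat)) (z : O) : Prop :=
  match s with
  | [] => zero z
  | (y, l) :: s' => exists a b, nmul y l a /\ lsum s' b /\ add a b z
  end.

Fixpoint decr (s : list (O * nat)) : Prop :=
  match s with
  | a :: ((b :: _) as s') => lt (fst b) (fst a) /\ decr s'
  | _ => True
  end.

Definition cnf (x : O) (s : list (O * nat)) : Prop :=
  (forall p, In p s -> addPrin (fst p) /\ 0 < snd p) /\ decr s /\ lsum s x.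

Definition nontriv (s : list (O * nat)) : Prop :=
  2 <= length s \/ exists L l, s = [(L, l)] /\ 2 <= l.

Definition omega_ord (om : O) : Prop :=
  islim om /\ forall x, lt x om -> ~ islim x.

Definition eps_omega (e : O) : Prop :=
  Eps e /\ exists om, omega_ord om /\
    iso_pred (fun x => Eps x /\ lt x e) (fun w => lt w om).

Definition geEw (t : O) : Prop := exists e0, eps_omega e0 /\ le e0 t.

Definition largestEps (a t : O) : Prop :=
  Eps a /\ le a t /\ forall e, Eps e -> le e t -> le e a.

Definition LimP (X : O -> Prop) (r : O) : Prop :=
  pos r /\ forall g, lt g r -> exists x, X x /\ lt g x /\ lt x r.

Inductive InEp (e : O) : O -> Prop :=
| ep_self : Eps e -> InEp e e
| ep_sum : forall x s L l, ~ Eps x -> cnf x s -> nontriv s -> In (L, l) s ->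
    InEp e L -> InEp e x
| ep_pow : forall x L, ~ Eps x -> omexp L x -> InEp e L -> InEp e x.

Inductive subst (a e : O) : O -> O -> Prop :=
| sb_zero : forall x, zero x -> subst a e x x
| sb_eps : forall x, Eps x -> x <> a -> subst a e x x
| sb_self : subst a e a e
| sb_sum : forall x s ys y, ~ Eps x -> cnf x s -> nontriv s ->
    length ys = length s ->
    (forall i, i < length s -> subst a e (fst (nth i s (x, 0))) (nth i ys x)) ->
    lsum (combine ys (map snd s)) y -> subst a e x y
| sb_pow : forall x L L' y, ~ Eps x -> omexp L x -> subst a e L L' ->
    omexp L' y -> subst a e x y.

Definition pi (t p : O) : Prop := exists s l, cnf t s /\ hd_error s = Some (p, l).

Definition dd (q D : O) : Prop :=
  (~ addPrin q /\ zero D) \/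
  (exists Q s Lm qm Dm, omexp Q q /\ cnf Q (s ++ [(Lm, qm)]) /\ omexp Dm Lm /\ D = Dm).

Definition pd (t v : O) : Prop := exists p D, pi t p /\ dd p D /\ add p D v.

Definition eta (t y : O) : Prop :=
  exists v, pd t v /\ ((le v t /\ y = t) \/ (lt t v /\ y = v)).

(* approximating sequences: sigma(t, alpha) = (f j)_{j in I}, I = gamma \ {0} *)
Inductive sigma (a : O) : O -> O -> (O -> O) -> Prop :=
| sg_i_zero : forall t T1 sq Mm qm Qm Pv om f,
    largestEps a t -> lt a t -> islim t ->
    cnf t [(t, 1)] -> omexp T1 t -> cnf T1 (sq ++ [(Mm, qm)]) -> omexp Qm Mm ->
    lsum sq Pv -> zero Qm -> omega_ord om ->
    (forall j k, ofnat (S k) j -> exists qo E u,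
        ofnat (qm - 1) qo /\ add Pv qo E /\ omexp E u /\ nmul u (S k) (f j)) ->
    sigma a t om f
| sg_i_succ : forall t T1 sq Mm qm Qm Qp Pv om f,
    largestEps a t -> lt a t -> islim t ->
    cnf t [(t, 1)] -> omexp T1 t -> cnf T1 (sq ++ [(Mm, qm)]) -> omexp Qm Mm ->
    lsum sq Pv -> pos Qm -> lt Qm a -> succ Qp Qm -> omega_ord om ->
    (forall j k, ofnat (S k) j -> exists x E1 w y E,
        nmul Mm (qm - 1) x /\ add Pv x E1 /\ omexp Qp w /\ nmul w (S k) y /\
        add E1 y E /\ omexp E (f j)) ->
    sigma a t om f
| sg_i_lim : forall t T1 sq Mm qm Qm Pv f,
    largestEps a t -> lt a t -> islim t ->
    cnf t [(t, 1)] -> omexp T1 t -> cnf T1 (sq ++ [(Mm, qm)]) -> omexp Qm Mm ->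
    lsum sq Pv -> islim Qm -> le Qm a ->
    (forall j, pos j -> lt j Qm -> exists x E1 w E,
        nmul Mm (qm - 1) x /\ add Pv x E1 /\ omexp j w /\ add E1 w E /\ omexp E (f j)) ->
    sigma a t Qm f
| sg_i_big : forall t T1 sq Mm qm Qm Pv gam g f,
    largestEps a t -> lt a t -> islim t ->
    cnf t [(t, 1)] -> omexp T1 t -> cnf T1 (sq ++ [(Mm, qm)]) -> omexp Qm Mm ->
    lsum sq Pv -> lt a Qm -> sigma a Mm gam g ->
    (forall j, pos j -> lt j gam -> exists x E1 E,
        nmul Mm (qm - 1) x /\ add Pv x E1 /\ add E1 (g j) E /\ omexp E (f j)) ->
    sigma a t gam f
| sg_ii_eq : forall t L1 t1 T1 f,
    largestEps a t -> lt a t -> islim t ->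
    cnf t [(L1, t1)] -> 2 <= t1 -> omexp T1 L1 -> T1 = a ->
    (forall j, pos j -> lt j a -> exists x, nmul L1 (t1 - 1) x /\ add x j (f j)) ->
    sigma a t a f
| sg_ii_big : forall t L1 t1 T1 gam g f,
    largestEps a t -> lt a t -> islim t ->
    cnf t [(L1, t1)] -> 2 <= t1 -> omexp T1 L1 -> lt a T1 -> sigma a L1 gam g ->
    (forall j, pos j -> lt j gam -> exists x, nmul L1 (t1 - 1) x /\ add x (g j) (f j)) ->
    sigma a t gam f
| sg_iii_small : forall t s' Ln tn Tn R f,
    largestEps a t -> lt a t -> islim t ->
    cnf t (s' ++ [(Ln, tn)]) -> s' <> [] -> omexp Tn Ln ->
    lsum (s' ++ [(Ln, tn - 1)]) R -> lt Tn a ->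
    (forall j, pos j -> lt j Ln -> add R j (f j)) ->
    sigma a t Ln f
| sg_iii_eq : forall t s' Ln tn Tn R f,
    largestEps a t -> lt a t -> islim t ->
    cnf t (s' ++ [(Ln, tn)]) -> s' <> [] -> omexp Tn Ln ->
    lsum (s' ++ [(Ln, tn - 1)]) R -> Tn = a ->
    (forall j, pos j -> lt j a -> add R j (f j)) ->
    sigma a t a f
| sg_iii_big : forall t s' Ln tn Tn R gam g f,
    largestEps a t -> lt a t -> islim t ->
    cnf t (s' ++ [(Ln, tn)]) -> s' <> [] -> omexp Tn Ln ->
    lsum (s' ++ [(Ln, tn - 1)]) R -> lt a Tn -> sigma a Ln gam g ->
    (forall j, pos j -> lt j gam -> add R (g j) (f j)) ->
    sigma a t gam f.

Definition isM (t a m : O) : Prop :=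
  ((exists e, InEp e t /\ lt e a) ->
     InEp m t /\ lt m a /\ forall e, InEp e t -> lt e a -> le e m) /\
  (~ (exists e, InEp e t /\ lt e a) -> zero m).

Definition LimEps (r : O) : Prop := LimP Eps r.

Inductive InA : O -> O -> Prop :=
| A_succ_same : forall l t v r, geEw t -> succ l t -> pd l v -> lt l v ->
    InA l r -> InA t r
| A_succ_lim : forall l t v r, geEw t -> succ l t -> pd l v -> ~ lt l v ->
    pos r -> (forall g, lt g r -> exists x, InA l x /\ lt g x /\ lt x r) ->
    InA t r
| A_lim_low : forall t a m a2 r, geEw t -> islim t -> largestEps a t -> isM t a m ->
    add a a a2 -> le t a2 ->
    LimEps r -> lt m r -> le r a -> InA t r
| A_lim_high : forall t a m a2 v gam f r, geEw t -> islim t -> largestEps a t ->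
    isM t a m -> add a a a2 -> lt a2 t -> pd t v -> lt v t -> sigma a t gam f ->
    pos r ->
    (forall g, lt g r -> exists x,
        (le x a /\ lt m x /\
         forall j, pos j -> lt j gam -> lt j x -> InA (f j) x) /\
        lt g x /\ lt x r) ->
    InA t r
| A_lim_pi : forall t a m a2 v p gam f r, geEw t -> islim t -> largestEps a t ->
    isM t a m -> add a a a2 -> lt a2 t -> pd t v -> le t v -> pi t p ->
    sigma a p gam f ->
    pos r ->
    (forall g, lt g r -> exists x,
        (le x a /\ lt m x /\
         forall j, pos j -> lt j gam -> lt j x -> InA (f j) x) /\
        lt g x /\ lt x r) ->
    InA t r.

Variable wf : well_founded lt.

(* Carlson's <_1, by well-founded recursion on the right argument b;
   rec y _ x stands for x <_1 y (y < b). *)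
Definition carlson_F (b : O) (rec : forall y, lt y b -> O -> Prop) (a : O) : Prop :=
  lt a b /\
  forall B : list O, (forall x, In x B -> lt x b) ->
    exists h : O -> O,
      (forall x, In x B -> lt (h x) a) /\
      (forall x, In x B -> lt x a -> h x = x) /\
      (forall x y z, In x B -> In y B -> In z B ->
         (lt x y <-> lt (h x) (h y)) /\
         (forall (Hy : lt y b) (Hhy : lt (h y) b), rec y Hy x <-> rec (h y) Hhy (h x)) /\
         (add x y z <-> add (h x) (h y) (h z))).

Definition lt1 (a b : O) : Prop := Fix wf (fun _ => O -> Prop) carlson_F b a.

Definition lt1up (a b : O) : Prop :=
  lt a b /\
  forall Z : list O, (forall x, In x Z -> lt x b) ->
    exists h : O -> O,
      (forall x, In x Z -> lt (h x) a) /\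
      (forall x, In x Z -> lt x a -> h x = x) /\
      (forall x y z, In x Z -> In y Z -> In z Z ->
         (lt x y <-> lt (h x) (h y)) /\
         (lt1 x y <-> lt1 (h x) (h y)) /\
         (add x y z <-> add (h x) (h y) (h z)) /\
         (omexp x y <-> omexp (h x) (h y))).

Definition le1up (a b : O) : Prop := a = b \/ lt1up a b.

Definition G (t b : O) : Prop :=
  exists a, largestEps a t /\
    (forall e, InEp e t -> lt e a -> lt e b) /\ le b a /\
    exists y y' y1, eta t y /\ subst a b y y' /\ succ y' y1 /\ le1up b y1.

End Ordinals.

(* Main.v *)
(* For an additively principal [g = omega^(l + omega^q)] one has [g <_1 g + xi] for [0 < xi <= q], and
   if g is not an epsilon number then for no larger xi. So between an epsilon number b and the next one
   [<_1] is determined by Cantor normal forms, and the substitution of e for b (for epsilon numbers e < b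
   above the relevant parameters) preserves <, +, the exponential and, on [[b, s]] with [b <=_1 s] and
   [e <=_1 s[b := e]], also [<_1]. Hence [b <^1 s + 1] iff b is a limit of epsilon numbers e with
   [e <=_1 s[b := e]]. If s is at least [pi s + d pi s], the same follows from [b <_1 s + 1] alone: an
   embedding for <, [<_1], + sends each subterm of s to something at least as large as its substitution
   instance. With these two facts [G] satisfies the recursion that defines [A]; at limit t the
   approximating sequence of t is carried by substitution to a sequence cofinal in [t[a := x]]. *)
From Stdlib Require Import List Arith Lia Classical ClassicalEpsilon FunctionalExtensionality ProofIrrelevance.
Require Import Defs.
Import ListNotations.

(** Embeddings for [<_1] know nothing of exponentiation, so powers must be recovered from [<], [<_1]
    and [+] alone. Two handles exist: [e <_1 e + e] with [1 < e] forces [e] to be an epsilon number,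
    and [g <_1 g + q] bounds from below by [q] the last exponent in the exponent of a principal [g]
    that is not an epsilon number. An embedding sees the second handle only if the points [g + q]
    belong to its domain. This is the role of eta: it raises t to at least [pi t + d pi t], which
    makes room for these points at all subterms. The origin of [Lim] in the recursion is a shift by
    one: [G(t)] is the set of limit points of the set [Gd] of all e with [e <=_1 (eta t)[a := e]],
    and when [eta l = l] the set [Gd] at [l + 1] already equals [G(l)]. Substitution is partial,
    since parameters of x may lie above e. It is therefore treated as a relation between two normal
    forms, symmetric in the two epsilon numbers, so that preservation and reflection of every notion
    have one proof. *)

Lemma fun_choice (A B : Type) (R : A -> B -> Prop) :
  (forall x, exists y, R x y) -> exists f, forall x, R x (f x).
Proof.
  intros H. exists (fun x => proj1_sig (constructive_indefinite_description _ (H x))).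
  intros x. apply (proj2_sig (constructive_indefinite_description _ (H x))).
Qed.

Section Ordinals.
Variables (O : Type) (lt : O -> O -> Prop).
Hypothesis wf : well_founded lt.
Hypothesis lt_trans : forall x y z, lt x y -> lt y z -> lt x z.
Hypothesis lt_total : forall x y, lt x y \/ x = y \/ lt y x.

Notation iso := (iso_pred O lt).

(** * Isomorphisms of initial segments *)

Lemma lt_irrefl x : ~ lt x x.
Proof.
  induction (wf x) as [x _ IH]. intros H. exact (IH x H H).
Qed.

(** From [f x < x], monotonicity produces the infinite descending chain of the iterates of [f] at
    [x]. *)
Lemma no_descent (P : O -> Prop) (f : O -> O) :
  (forall x, P x -> P (f x)) ->
  (forall x y, P x -> P y -> lt x y -> lt (f x) (f y)) ->
  forall x, P x -> ~ lt (f x) x.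
Proof.
  intros Hf Hm x. induction (wf x) as [x _ IH]. intros Px Hlt.
  exact (IH (f x) Hlt (Hf x Px) (Hm _ _ (Hf x Px) Px Hlt)).
Qed.

Lemma iso_sym P Q : iso P Q -> iso Q P.
Proof.
  intros (f & f1 & f2 & f3).
  destruct (fun_choice _ _ (fun z x => Q z -> P x /\ f x = z)) as [g Hg].
  { intros z. destruct (classic (Q z)) as [q | q].
    - destruct (f3 z q) as [x Hx]. exists x; auto.
    - exists z; tauto. }
  exists g. split; [| split].
  - intros z q. apply (Hg z q).
  - intros x y qx qy. destruct (Hg x qx) as [a b], (Hg y qy) as [c d].
    rewrite (f2 _ _ a c), b, d. tauto.
  - intros z p. exists (f z). split; [auto |].
    destruct (Hg (f z) (f1 z p)) as [a b].
    destruct (lt_total (g (f z)) z) as [h | [h | h]]; auto;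
      apply f2 in h; auto; rewrite b in h; elim (lt_irrefl _ h).
Qed.

Lemma iso_trans P Q S : iso P Q -> iso Q S -> iso P S.
Proof.
  intros (f & f1 & f2 & f3) (g & g1 & g2 & g3). exists (fun x => g (f x)).
  split; [| split].
  - auto.
  - intros x y px py. rewrite (f2 x y px py). apply g2; auto.
  - intros z s. destruct (g3 z s) as (y & qy & <-). destruct (f3 y qy) as (x & px & <-). eauto.
Qed.

(** Read as a self-map of [P], such an isomorphism would send [z] strictly below itself. Uniqueness
    of sums, of powers and of order types all reduces to this. *)
Lemma no_iso_below (P Q : O -> Prop) z :
  iso P Q -> (forall x, Q x -> P x) -> P z -> (forall x, Q x -> lt x z) -> False.
Proof.
  intros (f & f1 & f2 & _) QP pz Hz.
  apply (no_descent P f) with (x := z); auto.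
  intros x y px py. apply f2; auto.
Qed.

Lemma iso_segments z z' : iso (fun w => lt w z) (fun w => lt w z') -> z = z'.
Proof.
  intros H. destruct (lt_total z z') as [h | [h | h]]; auto; exfalso.
  - apply iso_sym in H. apply (no_iso_below _ _ z H); eauto.
  - apply (no_iso_below _ _ z' H); eauto.
Qed.

Lemma add_fun x y z z' : add O lt x y z -> add O lt x y z' -> z = z'.
Proof.
  assert (A : forall z z', add O lt x y z -> add O lt x y z' -> ~ lt z z').
  { clear z z'. intros z z' (a & b) (c & d) h.
    assert (E : iso (fun w => le O lt x w /\ lt w z') (fun w => le O lt x w /\ lt w z))
      by (eapply iso_trans; [exact d | apply iso_sym; exact b]).
    apply (no_iso_below _ _ z E); [| tauto | tauto].
    intros w (? & ?); eauto. }
  intros H H'. destruct (lt_total z z') as [h | [h | h]]; auto; exfalso; [exact (A z z' H H' h) | exact (A z' z H' H h)].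
Qed.

(** The isomorphism behind [add x y z] restricts to each point [v] from [x] up to [z] and shows that
    [v] is [x] plus [f v]. This turns the order-theoretic definition into the usual recursion for
    addition. *)
Lemma add_below x y z w : add O lt x y z ->
  (lt w z <-> lt w x \/ exists y', lt y' y /\ add O lt x y' w).
Proof.
  intros (Hle & f & f1 & f2 & f3).
  assert (A : forall v, le O lt x v -> lt v z -> add O lt x (f v) v).
  { intros v xv vz. split; auto. exists f. split; [| split].
    - intros u (h1 & h2). apply -> f2; eauto.
    - intros u u' (h1 & h2) (h3 & h4). apply f2; eauto.
    - intros u hu. destruct (f3 u) as (u' & (h1 & h2) & h3).
      { apply lt_trans with (f v); auto. }
      subst u. exists u'. repeat split; auto. apply (f2 u' v); auto. }
  split.
  - intros wz. destruct (lt_total w x) as [h | h]; auto. right.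
    assert (le O lt x w) by (unfold le; destruct h; auto).
    exists (f w). split; auto.
  - intros [h | (y' & h & h')].
    + destruct Hle as [h' | <-]; eauto.
    + destruct (f3 y' h) as (w0 & (h1 & h2) & h3).
      assert (w = w0) by (eapply add_fun; [exact h' |]; rewrite <- h3; auto).
      subst; auto.
Qed.

Lemma omexp_fun w p p' : omexp O lt w p -> omexp O lt w p' -> p = p'.
Proof.
  assert (A : forall p p', omexp O lt w p -> omexp O lt w p' -> ~ lt p p').
  { clear p p'. intros p p' (a & b) (c & d) h.
    assert (E := iso_trans _ _ _ d (iso_sym _ _ b)).
    apply (no_iso_below _ _ p E); [| auto | tauto].
    intros v (? & ?); eauto. }
  intros H H'. destruct (lt_total p p') as [h | [h | h]]; auto; exfalso; [exact (A p p' H H' h) | exact (A p' p H' H h)].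
Qed.

Lemma omexp_inj w w' p : omexp O lt w p -> omexp O lt w' p -> w = w'.
Proof.
  intros (_ & H) (_ & H'). apply iso_segments.
  eapply iso_trans; [apply iso_sym; exact H | exact H'].
Qed.

(** * The ordinals below a fixed epsilon number *)

Variable E0 : O.
Hypothesis E0_eps : Eps O lt E0.

(** [Eps E0] provides an isomorphism from the principal numbers below [E0] onto the ordinals below
    [E0]; cut off at [p], it witnesses [omexp (f p) p]. So [f] is the logarithm below [E0], and
    totality and monotonicity of the exponential come from it. *)
Lemma omexp_below_eps : exists f : O -> O,
  (forall p, addPrin O lt p -> lt p E0 -> lt (f p) E0 /\ omexp O lt (f p) p) /\
  (forall w, lt w E0 -> exists p, addPrin O lt p /\ lt p E0 /\ f p = w) /\
  (forall p p', addPrin O lt p -> lt p E0 -> addPrin O lt p' -> lt p' E0 ->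
     (lt p p' <-> lt (f p) (f p'))).
Proof.
  destruct E0_eps as (_ & f & f1 & f2 & f3). exists f. split; [| split].
  - intros p pp pE. split; [auto |]. split; auto.
    exists f. split; [| split].
    + intros x (h1 & h2). apply -> f2; eauto.
    + intros x y (h1 & h2) (h3 & h4). apply f2; eauto.
    + intros z hz. destruct (f3 z) as (x & (h1 & h2) & h3).
      { apply lt_trans with (f p); auto. }
      subst z. exists x. split; [split; [auto | apply (f2 x p); auto] | auto].
  - intros w h. destruct (f3 w h) as (x & (h1 & h2) & h3). eauto.
  - intros. apply f2; auto.
Qed.

(* E0 bounds the given t. Below it addition and the exponential are total. *)
Definition U := {x : O | lt x E0}.
Definition val (x : U) : O := proj1_sig x.
Coercion val : U >-> O.

Definition ult (x y : U) : Prop := lt x y.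
Definition ule (x y : U) : Prop := ult x y \/ x = y.

Lemma val_lt (x : U) : lt x E0.
Proof. apply (proj2_sig x). Qed.

Lemma val_inj (x y : U) : val x = val y -> x = y.
Proof.
  destruct x as [x hx], y as [y hy]; simpl; intros; subst. f_equal. apply proof_irrelevance.
Qed.

Lemma lift (x : O) : lt x E0 -> exists u : U, x = u.
Proof. intros h. exists (exist _ x h). reflexivity. Qed.

Lemma ult_wf : well_founded ult.
Proof.
  intros [x hx]. revert hx. induction (wf x) as [x _ IH]. intros hx.
  constructor. intros [y hy] h. apply IH. exact h.
Qed.

Lemma ult_trans x y z : ult x y -> ult y z -> ult x z.
Proof. unfold ult; eauto. Qed.

Lemma ult_irrefl x : ~ ult x x.
Proof. apply lt_irrefl. Qed.

Lemma ult_total x y : ult x y \/ x = y \/ ult y x.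
Proof.
  unfold ult. destruct (lt_total x y) as [h | [h | h]]; auto. right; left; apply val_inj; auto.
Qed.

Lemma uadd_ex (x y : U) : exists z : U, add O lt x y z.
Proof.
  destruct E0_eps as ((_ & H) & _).
  destruct (H x y (val_lt x) (val_lt y)) as (c & h & h').
  destruct (lift c h) as [u ->]. eauto.
Qed.

Definition uadd (x y : U) : U := proj1_sig (constructive_indefinite_description _ (uadd_ex x y)).

Lemma uadd_val (x y : U) z : add O lt x y z <-> z = val (uadd x y).
Proof.
  assert (A : add O lt x y (uadd x y))
    by apply (proj2_sig (constructive_indefinite_description _ (uadd_ex x y))).
  split; [| intros ->; auto]. intros H. eapply add_fun; eauto.
Qed.

Lemma uexp_ex (x : U) : exists y : U, omexp O lt x y.
Proof.
  destruct omexp_below_eps as (f & f1 & f2 & f3).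
  destruct (f2 x (val_lt x)) as (p & h1 & h2 & h3).
  destruct (lift p h2) as [u ->]. exists u. rewrite <- h3. apply f1; auto.
Qed.

Definition uexp (x : U) : U := proj1_sig (constructive_indefinite_description _ (uexp_ex x)).

Lemma uexp_val (x : U) y : omexp O lt x y <-> y = val (uexp x).
Proof.
  assert (A : omexp O lt x (uexp x))
    by apply (proj2_sig (constructive_indefinite_description _ (uexp_ex x))).
  split; [| intros ->; auto]. intros H. eapply omexp_fun; eauto.
Qed.

Lemma omexp_val a (y : U) : omexp O lt a y -> exists x : U, a = x /\ y = uexp x.
Proof.
  intros H. destruct omexp_below_eps as (f & f1 & _).
  destruct (f1 y) as (h1 & h2); [apply H | apply val_lt |].
  assert (a = f y) by (eapply omexp_inj; eauto). subst a.
  destruct (lift _ h1) as [u e]. exists u. split; auto.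
  rewrite e in h2. apply val_inj. apply uexp_val; auto.
Qed.

(** If [b] exceeded [z], the interval from [a] to [z] would be isomorphic to a segment containing
    [z]. Hence the relational definitions, applied to elements of [U], never leave [U]. *)
Lemma add_val a b (z : U) : add O lt a b z -> exists x y : U, a = x /\ b = y /\ z = uadd x y.
Proof.
  intros H. assert (A : lt a E0).
  { destruct H as ([h | h] & _); [| subst; apply val_lt]. eapply lt_trans; [exact h | apply val_lt]. }
  assert (B : lt b E0).
  { destruct (lt_total b z) as [h | [h | h]].
    - eapply lt_trans; [exact h | apply val_lt].
    - subst; apply val_lt.
    - exfalso. destruct H as (Hle & H). apply iso_sym in H.
      apply (no_iso_below _ _ z H); auto; [| tauto]. intros x (_ & hx); eauto. }
  destruct (lift a A) as [x ->], (lift b B) as [y ->].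
  exists x, y. repeat split; auto. apply val_inj. apply uadd_val; auto.
Qed.

Declare Scope ord_scope.
Notation "x < y" := (ult x y) : ord_scope.
Notation "x <= y" := (ule x y) : ord_scope.
Notation "x + y" := (uadd x y) : ord_scope.
Notation exp := uexp.
Open Scope ord_scope.

(** The laws of addition proved below rest on this recursion. *)
Lemma lt_add (z x y : U) : z < x + y <-> z < x \/ exists y', y' < y /\ z = x + y'.
Proof.
  unfold ult. rewrite (add_below x y (x + y) z) by (apply uadd_val; auto).
  split; (intros [h | (y' & h & h')]; [left; auto | right]).
  - destruct (lift y') as [v ->]. { eapply lt_trans; [exact h | apply val_lt]. }
    exists v. split; auto. apply val_inj. apply uadd_val; auto.
  - exists y'. split; auto. apply uadd_val. subst; auto.
Qed.

Definition prin (y : U) : Prop := (exists w, w < y) /\ forall a b, a < y -> b < y -> a + b < y.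

Lemma prin_val (y : U) : addPrin O lt y <-> prin y.
Proof.
  split.
  - intros ((w & hw) & H). split.
    + destruct (lift w) as [v ->]. { eapply lt_trans; [exact hw | apply val_lt]. } exists v; auto.
    + intros a b ha hb. destruct (H a b ha hb) as (c & h & h'). apply uadd_val in h'. subst; auto.
  - intros ((w & hw) & H). split. { exists w; auto. }
    intros a b ha hb.
    destruct (lift a) as [x ->]. { eapply lt_trans; [exact ha | apply val_lt]. }
    destruct (lift b) as [z ->]. { eapply lt_trans; [exact hb | apply val_lt]. }
    exists (x + z). split. { apply (H x z ha hb). } apply uadd_val; auto.
Qed.

Lemma prin_exp x : prin (exp x).
Proof. apply prin_val. apply (proj2 (uexp_val x _) eq_refl). Qed.

Lemma prin_is_exp y : prin y -> exists x, y = exp x.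
Proof.
  intros H. apply prin_val in H. destruct omexp_below_eps as (f & f1 & _).
  destruct (f1 y H (val_lt y)) as (_ & h). destruct (omexp_val _ _ h) as (x & _ & e). eauto.
Qed.

Lemma exp_lt x y : x < y -> exp x < exp y.
Proof.
  intros h. destruct omexp_below_eps as (f & f1 & f2 & f3).
  assert (A : forall u, f (exp u) = u).
  { intros u. eapply omexp_inj; [| apply uexp_val; reflexivity]. apply f1; [| apply val_lt].
    apply prin_val, prin_exp. }
  unfold ult. apply f3; try apply val_lt; try apply prin_val, prin_exp. rewrite !A. exact h.
Qed.

(** * Ordinal arithmetic below [E0] *)

Lemma ule_refl x : x <= x.
Proof. right; auto. Qed.
Lemma ult_ule x y : x < y -> x <= y.
Proof. left; auto. Qed.
Lemma ult_ule_trans x y z : x < y -> y <= z -> x < z.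
Proof. intros h [h' | <-]; auto. eapply ult_trans; eauto. Qed.
Lemma ule_ult_trans x y z : x <= y -> y < z -> x < z.
Proof. intros [h | <-] h'; auto. eapply ult_trans; eauto. Qed.
Lemma ule_trans x y z : x <= y -> y <= z -> x <= z.
Proof. intros [h | <-] h'; auto. left. eapply ult_ule_trans; eauto. Qed.
Lemma not_ult x y : ~ x < y -> y <= x.
Proof. destruct (ult_total x y) as [h | [h | h]]; [tauto | right; auto | left; auto]. Qed.
Lemma not_ule x y : ~ x <= y -> y < x.
Proof.
  intros n. destruct (ult_total x y) as [h | [h | h]]; auto; elim n; [left | right]; auto.
Qed.
Lemma ule_antisym x y : x <= y -> y <= x -> x = y.
Proof. intros [h | h] [h' | h']; auto. elim (ult_irrefl x). eapply ult_trans; eauto. Qed.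

Ltac learn T p :=
  lazymatch goal with
  | _ : T |- _ => fail
  | _ => assert T by exact p
  end.

(* Decision procedure for strict total orders: refutes the negated goal by saturating under transitivity. *)
Ltac ord_saturate :=
  repeat match goal with
  | H : ~ (_ < _) |- _ => apply not_ult in H
  | H : ~ (_ <= _) |- _ => apply not_ule in H
  | H : ?x = ?y :> U |- _ => first [subst x | subst y
      | assert (x <= y) by (right; exact H); assert (y <= x) by (right; symmetry; exact H); clear H]
  end;
  repeat match goal with
  | H : ?x < ?x |- _ => elim (ult_irrefl x H)
  | H1 : ?x < ?y, H2 : ?y < ?z |- _ => learn (x < z) (ult_trans _ _ _ H1 H2)
  | H1 : ?x < ?y, H2 : ?y <= ?z |- _ => learn (x < z) (ult_ule_trans _ _ _ H1 H2)
  | H1 : ?x <= ?y, H2 : ?y < ?z |- _ => learn (x < z) (ule_ult_trans _ _ _ H1 H2)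
  | H1 : ?x <= ?y, H2 : ?y <= ?z |- _ => learn (x <= z) (ule_trans _ _ _ H1 H2)
  end.
Ltac ord :=
  intros;
  lazymatch goal with
  | |- _ < _ => apply NNPP; intro
  | |- _ <= _ => apply NNPP; intro
  | |- _ = _ => apply ule_antisym; apply NNPP; intro
  | |- ~ _ => intro
  | |- _ => idtac
  end; exfalso; ord_saturate; fail.

Lemma ule_case x y : x < y \/ y <= x.
Proof. destruct (classic (x < y)); auto. right; ord. Qed.

Lemma least (P : U -> Prop) : (exists x, P x) -> exists x, P x /\ forall y, P y -> x <= y.
Proof.
  intros [x Px]. revert Px. induction (ult_wf x) as [x _ IH]. intros Px.
  destruct (classic (exists y, y < x /\ P y)) as [(y & h & Py) | n]; [eauto |].
  exists x. split; auto. intros y Py. apply not_ult. intros h. apply n; eauto.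
Qed.

Lemma eq_by_lt x y : (forall z, z < x <-> z < y) -> x = y.
Proof.
  intros H. destruct (ult_total x y) as [h | [h | h]]; auto;
    apply H in h; elim (ult_irrefl _ h).
Qed.

Lemma zero_ex : exists z : U, forall x, ~ x < z.
Proof.
  destruct E0_eps as (((w & hw) & _) & _). destruct (lift w hw) as [u _].
  destruct (least (fun _ => True)) as (z & _ & h); [eauto |].
  exists z. intros x hx. specialize (h x I). ord.
Qed.
Definition uzero : U := proj1_sig (constructive_indefinite_description _ zero_ex).
Notation "0" := uzero : ord_scope.
Lemma not_lt_zero x : ~ x < 0.
Proof. apply (proj2_sig (constructive_indefinite_description _ zero_ex)). Qed.
Lemma zero_le x : 0 <= x.
Proof. apply not_ult, not_lt_zero. Qed.
Lemma zero_or_pos x : x = 0 \/ 0 < x.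
Proof. destruct (zero_le x); auto. Qed.
Lemma le_zero x : x <= 0 -> x = 0.
Proof. intros [h | h]; auto. elim (not_lt_zero _ h). Qed.

Lemma add_0_r x : x + 0 = x.
Proof.
  apply eq_by_lt. intros z. rewrite lt_add. split; auto.
  intros [h | (y & h & _)]; auto. elim (not_lt_zero _ h).
Qed.
Lemma add_lt_r x y y' : y < y' -> x + y < x + y'.
Proof. intros h. apply lt_add. right. eauto. Qed.
Lemma le_add_l x y : x <= x + y.
Proof. apply not_ult. intros h. apply (ult_irrefl (x + y)). apply lt_add. auto. Qed.
Lemma add_le_r x y y' : y <= y' -> x + y <= x + y'.
Proof. intros [h | ->]; [left; apply add_lt_r; auto | apply ule_refl]. Qed.
Lemma add_cancel x y y' : x + y = x + y' -> y = y'.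
Proof.
  intros e. destruct (ult_total y y') as [h | [h | h]]; auto;
    apply (add_lt_r x) in h; rewrite e in h; elim (ult_irrefl _ h).
Qed.
Lemma add_lt_cancel x y y' : x + y < x + y' -> y < y'.
Proof.
  intros e. apply NNPP. intros h. apply not_ult in h. apply (add_le_r x) in h. ord.
Qed.
Lemma add_le_cancel x y y' : x + y <= x + y' -> y <= y'.
Proof.
  intros e. apply NNPP. intros h. apply not_ule in h. apply (add_lt_r x) in h. ord.
Qed.
Lemma add_0_l y : 0 + y = y.
Proof.
  induction (ult_wf y) as [y _ IH]. apply eq_by_lt. intros z. rewrite lt_add. split.
  - intros [h | (y' & h & ->)]; [elim (not_lt_zero _ h) |]. rewrite IH; auto.
  - intros h. right. exists z. rewrite IH; auto.
Qed.
Lemma add_assoc x y z : (x + y) + z = x + (y + z).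
Proof.
  induction (ult_wf z) as [z _ IH]. apply eq_by_lt. intros w. rewrite !lt_add. split.
  - intros [[h | (u & h & ->)] | (u & h & ->)]; auto; right.
    + exists u. split; auto. apply lt_add; auto.
    + exists (y + u). split; [apply add_lt_r; auto | apply IH; auto].
  - intros [h | (u & h & ->)]; auto. apply lt_add in h. destruct h as [h | (v & h & ->)]; eauto.
    right. exists v. split; auto. rewrite IH; auto.
Qed.
Lemma le_add_r x y : y <= x + y.
Proof.
  induction (ult_wf y) as [y _ IH]. apply not_ult. intros h.
  pose proof (IH _ h) as h1. apply (add_lt_r x) in h. ord.
Qed.
Lemma sub_ex x y : x <= y -> exists d, y = x + d.
Proof.
  intros h. destruct (le_add_r x y) as [h' | h']; [| eauto].
  apply lt_add in h'. destruct h' as [h' | (d & _ & h')]; [| eauto].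
  elim (ult_irrefl x). ord.
Qed.
Lemma sub_pos_ex x y : x < y -> exists d, 0 < d /\ y = x + d.
Proof.
  intros h. destruct (sub_ex x y) as [d ->]; [left; auto |]. exists d. split; auto.
  destruct (zero_or_pos d) as [-> |]; auto. rewrite add_0_r in h. ord.
Qed.
Lemma add_le_l x x' y : x <= x' -> x + y <= x' + y.
Proof.
  intros hx. induction (ult_wf y) as [y _ IH]. apply not_ult. intros h.
  apply lt_add in h. destruct h as [h | (y' & h & e)].
  - pose proof (le_add_l x' y). ord.
  - pose proof (IH _ h). apply (add_lt_r x') in h. ord.
Qed.
Lemma add_le_mono x x' y y' : x <= x' -> y <= y' -> x + y <= x' + y'.
Proof. intros h h'. eapply ule_trans; [apply add_le_l; exact h | apply add_le_r; auto]. Qed.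
Lemma lt_add_pos x y : 0 < y -> x < x + y.
Proof. intros h. apply (add_lt_r x) in h. rewrite add_0_r in h. auto. Qed.
Lemma add_zero_inv x y : x + y = 0 -> x = 0 /\ y = 0.
Proof.
  intros e. pose proof (le_add_l x y) as h. pose proof (le_add_r x y) as h'. rewrite e in *.
  split; apply le_zero; auto.
Qed.

Lemma exp_le x y : x <= y -> exp x <= exp y.
Proof. intros [h | ->]; [left; apply exp_lt; auto | apply ule_refl]. Qed.
Lemma exp_lt_cancel x y : exp x < exp y -> x < y.
Proof. intros h. apply NNPP. intros n. apply not_ult, exp_le in n. ord. Qed.
Lemma exp_le_cancel x y : exp x <= exp y -> x <= y.
Proof. intros h. apply NNPP. intros n. apply not_ule, exp_lt in n. ord. Qed.
Lemma exp_inj x y : exp x = exp y -> x = y.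
Proof.
  intros e. destruct (ult_total x y) as [h | [h | h]]; auto; apply exp_lt in h; ord.
Qed.
Lemma exp_ge x : x <= exp x.
Proof.
  induction (ult_wf x) as [x _ IH]. apply not_ult. intros h.
  pose proof (IH _ h) as h1. apply exp_lt in h. ord.
Qed.
Lemma prin_pos y : prin y -> 0 < y.
Proof. intros ((w & h) & _). pose proof (zero_le w). ord. Qed.
Lemma exp_pos x : 0 < exp x.
Proof. apply prin_pos, prin_exp. Qed.
Lemma exp_closed L a b : a < exp L -> b < exp L -> a + b < exp L.
Proof. apply prin_exp. Qed.
Lemma prin_absorb y a : prin y -> a < y -> a + y = y.
Proof.
  intros (_ & H) h. destruct (le_add_r a y) as [h' | h']; auto.
  apply lt_add in h'. destruct h' as [h' | (b & hb & e)]; [ord |].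
  pose proof (H a b h hb). ord.
Qed.
Lemma exp_absorb L a : a < exp L -> a + exp L = exp L.
Proof. apply prin_absorb, prin_exp. Qed.

Notation one := (exp 0).
Notation "1" := one : ord_scope.
(** The least positive ordinal is additively principal, hence some [exp y], and [exp 0] is at most
    [exp y]. *)
Lemma lt_one x : x < 1 -> x = 0.
Proof.
  intros h. destruct (least (fun x => 0 < x)) as (o & ho & Ho). { exists 1. apply exp_pos. }
  assert (Po : prin o).
  { split; [eauto |]. intros a b ha hb.
    assert (A : forall c, c < o -> c = 0).
    { intros c hc. destruct (zero_or_pos c) as [| hc']; auto. apply Ho in hc'. ord. }
    rewrite (A a ha), (A b hb), add_0_r. auto. }
  destruct (prin_is_exp _ Po) as [y ->]. pose proof (exp_le _ _ (zero_le y)).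
  destruct (zero_or_pos x) as [| hx]; auto. apply Ho in hx. ord.
Qed.
Lemma lt_succ x y : x < y + 1 <-> x <= y.
Proof.
  rewrite lt_add. split.
  - intros [h | (z & h & ->)]; [left; auto |]. apply lt_one in h. subst. rewrite add_0_r. right; auto.
  - intros [h | ->]; auto. right. exists 0. rewrite add_0_r. split; auto. apply exp_pos.
Qed.
Lemma le_succ x y : x < y <-> x + 1 <= y.
Proof.
  split; intros h.
  - apply not_ult. intros n. apply lt_succ in n. ord.
  - assert (x < x + 1) by (apply lt_add_pos, exp_pos). ord.
Qed.
Lemma succ_lt x : x < x + 1.
Proof. apply lt_add_pos, exp_pos. Qed.

Definition lim (x : U) : Prop := 0 < x /\ forall z, z < x -> z + 1 < x.

Lemma zero_succ_lim x : x = 0 \/ (exists y, x = y + 1) \/ lim x.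
Proof.
  destruct (zero_or_pos x) as [| h]; auto. right.
  destruct (classic (exists y, x = y + 1)) as [| n]; auto. right. split; auto.
  intros z hz. apply le_succ in hz. destruct hz as [| <-]; auto. elim n; eauto.
Qed.

(** The supremum [y] of the earlier powers is itself principal, hence [exp w]. If [w] were below
    [L], then [exp (w + 1)] would be among the powers bounded by [y]; so [w] is at least [L]. *)
Lemma exp_cont L z : lim L -> z < exp L -> exists K, K < L /\ z < exp K.
Proof.
  intros (hL & HL) hz.
  destruct (least (fun y => forall K, K < L -> exp K <= y)) as (y & Hy & Ly).
  { exists (exp L). intros K h. left. apply exp_lt; auto. }
  assert (below : forall a, a < y -> exists K, K < L /\ a < exp K).
  { intros a ha. apply NNPP. intros n. specialize (Ly a). apply (ult_irrefl y).
    eapply ule_ult_trans; [apply Ly | exact ha].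
    intros K hK. apply not_ult. intros h. apply n; eauto. }
  assert (py : prin y).
  { split. { exists 0. pose proof (Hy 0 hL). pose proof (exp_pos 0). ord. }
    intros a b ha hb. destruct (below a ha) as (K & h1 & h2), (below b hb) as (K' & h3 & h4).
    destruct (ule_case K K') as [h | h].
    - apply exp_lt in h. assert (a + b < exp K') by (apply exp_closed; ord).
      pose proof (Hy K' h3). ord.
    - apply exp_le in h. assert (a + b < exp K) by (apply exp_closed; ord).
      pose proof (Hy K h1). ord. }
  destruct (prin_is_exp y py) as [w ->]. apply below.
  destruct (ule_case w L) as [h | h].
  - pose proof (Hy _ (HL w h)). pose proof (exp_lt _ _ (succ_lt w)). ord.
  - apply exp_le in h. ord.
Qed.

Fixpoint mul (y : U) (n : nat) : U :=
  match n with 0%nat => 0 | S n => mul y n + y end.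

Lemma mul_S_l y n : mul y (S n) = y + mul y n.
Proof.
  induction n; simpl. { rewrite add_0_l, add_0_r; auto. }
  simpl in IHn. rewrite IHn at 1. rewrite add_assoc. auto.
Qed.

Lemma mul_1 y : mul y 1%nat = y.
Proof. apply add_0_l. Qed.

Lemma mul_lt_exp L n : mul (exp L) n < exp (L + 1).
Proof.
  induction n; simpl; [apply exp_pos |]. apply exp_closed; auto. apply exp_lt, succ_lt.
Qed.

Lemma mul_le y m n : (m <= n)%nat -> mul y m <= mul y n.
Proof.
  induction 1; [apply ule_refl |]. simpl. pose proof (le_add_l (mul y m0) y). ord.
Qed.

(** As in [exp_cont], with finite multiples in place of earlier powers: their supremum is principal
    and exceeds [exp L], hence is at least [exp (L + 1)]. *)
Lemma exp_succ_cont L z : z < exp (L + 1) -> exists n, z < mul (exp L) n.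
Proof.
  intros hz.
  destruct (least (fun y => forall n, mul (exp L) n <= y)) as (y & Hy & Ly).
  { exists (exp (L + 1)). intros n. left. apply mul_lt_exp. }
  assert (below : forall a, a < y -> exists n, a < mul (exp L) n).
  { intros a ha. apply NNPP. intros n. specialize (Ly a). apply (ult_irrefl y).
    eapply ule_ult_trans; [apply Ly | exact ha].
    intros K. apply not_ult. intros h. apply n; eauto. }
  assert (mul_add : forall m n, mul (exp L) (m + n)%nat = mul (exp L) m + mul (exp L) n).
  { intros m n; induction n; simpl.
    - rewrite Nat.add_0_r, add_0_r. auto.
    - rewrite Nat.add_succ_r. simpl. rewrite IHn, add_assoc. auto. }
  assert (py : prin y).
  { split. { exists 0. pose proof (Hy 1%nat) as h. rewrite mul_1 in h. pose proof (exp_pos L). ord. }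
    intros a b ha hb. destruct (below a ha) as (m & h2), (below b hb) as (n & h4).
    assert (a + b < mul (exp L) (m + n)%nat).
    { rewrite mul_add. eapply ule_ult_trans; [apply add_le_l; left; exact h2 | apply add_lt_r; auto]. }
    pose proof (Hy (m + n)%nat). ord. }
  destruct (prin_is_exp y py) as [w ->]. apply below.
  destruct (ule_case L w) as [h | h].
  - apply le_succ, exp_le in h. ord.
  - pose proof (Hy 2%nat) as h'. rewrite mul_S_l, mul_1 in h'. apply exp_le in h.
    pose proof (lt_add_pos (exp L) (exp L) (exp_pos L)). ord.
Qed.

(** * Leading and last terms *)

Lemma exp_absorb_ge K x : exp K + x = x -> exp (K + 1) <= x.
Proof.
  intros e. apply not_ult. intros h. destruct (exp_succ_cont _ _ h) as [n hn].
  assert (A : forall n, mul (exp K) n <= x).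
  { intros m. induction m; [apply zero_le |]. rewrite mul_S_l, <- e. apply add_le_r; auto. }
  specialize (A n). ord.
Qed.

Lemma tail_lt K r : r < exp (K + 1) -> r < exp K + r.
Proof.
  intros h. destruct (le_add_r (exp K) r) as [| e]; auto.
  symmetry in e. apply exp_absorb_ge in e. ord.
Qed.

(** The remainder is bounded by [exp (K + 1)] rather than [exp K]: further copies of the leading
    power stay in [r]. Peeling off one copy at a time spares later inductions the coefficients of
    Cantor normal form. By continuity the least exponent whose power exceeds [x] is a successor,
    which yields [K]. *)
Lemma lead_ex x : 0 < x -> exists K r, x = exp K + r /\ r < exp (K + 1) /\ r < x /\ K <= x.
Proof.
  intros hx.
  destruct (least (fun K => x < exp K)) as (K1 & h1 & H1).
  { exists (x + 1). pose proof (exp_ge (x + 1)). pose proof (succ_lt x). ord. }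
  destruct (zero_succ_lim K1) as [-> | [(K & ->) | l]].
  - apply lt_one in h1. subst. ord.
  - assert (hK : exp K <= x).
    { apply not_ult. intros h. apply H1 in h. pose proof (succ_lt K). ord. }
    destruct (sub_ex _ _ hK) as [r ->]. exists K, r.
    assert (r < exp (K + 1)). { pose proof (le_add_r (exp K) r). ord. }
    pose proof (tail_lt K r H). pose proof (exp_ge K). repeat split; auto. ord.
  - destruct (exp_cont K1 x l h1) as (K & h2 & h3). apply H1 in h3. ord.
Qed.

Lemma lead_below K r L : r < exp (K + 1) -> K < L -> exp K + r < exp L.
Proof.
  intros h h'. apply le_succ, exp_le in h'. apply exp_closed; [| ord].
  pose proof (exp_lt _ _ (succ_lt K)). ord.
Qed.

Lemma lead_lt K r L s : r < exp (K + 1) -> K < L -> exp K + r < exp L + s.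
Proof. intros h h'. pose proof (lead_below K r L h h'). pose proof (le_add_l (exp L) s). ord. Qed.

Lemma lead_uniq K r L s : r < exp (K + 1) -> s < exp (L + 1) -> exp K + r = exp L + s ->
  K = L /\ r = s.
Proof.
  intros h h' e. assert (K = L).
  { destruct (ult_total K L) as [l | [l | l]]; auto.
    - pose proof (lead_lt K r L s h l). ord.
    - pose proof (lead_lt L s K r h' l). ord. }
  subst. apply add_cancel in e. auto.
Qed.

Lemma last_ex x : 0 < x -> exists l q, x = l + exp q.
Proof.
  induction (ult_wf x) as [x _ IH]. intros h. destruct (lead_ex x h) as (K & r & e & _ & h2 & _).
  destruct (zero_or_pos r) as [-> | hr].
  - exists 0, K. rewrite e, add_0_l, add_0_r. auto.
  - destruct (IH r h2 hr) as (l & q & ->). exists (exp K + l), q. rewrite add_assoc. auto.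
Qed.

(** Cancelling the shorter prefix leaves [exp q = d + exp q'], and a principal number is not the sum
    of two smaller ones. *)
Lemma last_uniq l q l' q' : l + exp q = l' + exp q' -> q = q'.
Proof.
  assert (A : forall l d q q', l + exp q = l + d + exp q' -> q = q').
  { clear l q l' q'. intros l d q q' e. rewrite add_assoc in e. apply add_cancel in e.
    destruct (ult_total q q') as [h | [h | h]]; auto.
    - apply exp_lt in h. pose proof (le_add_r d (exp q')). ord.
    - apply exp_lt in h. destruct (ule_case d (exp q)) as [h' | h'].
      + pose proof (exp_closed _ _ _ h' h). ord.
      + pose proof (lt_add_pos d (exp q') (exp_pos q')). ord. }
  intros e. destruct (ule_case l l') as [h | h].
  - destruct (sub_ex l l') as [d ->]; [left; auto |]. eauto.
  - destruct (sub_ex l' l h) as [d ->]. symmetry. eauto.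
Qed.

Lemma last_le l q : q <= l + exp q.
Proof. pose proof (exp_ge q). pose proof (le_add_r l (exp q)). ord. Qed.

Lemma lim_exp L : 0 < L -> lim (exp L).
Proof.
  intros h. split; [apply exp_pos |]. intros z hz. apply exp_closed; auto. apply exp_lt; auto.
Qed.

Lemma lim_add x y : lim y -> lim (x + y).
Proof.
  intros (h & H). split. { pose proof (le_add_r x y). ord. }
  intros z hz. apply lt_add in hz. destruct hz as [hz | (u & hu & ->)].
  - pose proof (lt_add_pos x y h). apply le_succ in hz. ord.
  - rewrite add_assoc. apply add_lt_r; auto.
Qed.

(** * Epsilon numbers and limit points *)

Definition E (e : U) : Prop := exp e = e.

Lemma E_exp e x : E e -> x < e -> exp x < e.
Proof. intros h h'. apply exp_lt in h'. unfold E in h. rewrite h in h'. auto. Qed.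
Lemma E_prin e : E e -> prin e.
Proof. intros h. rewrite <- h. apply prin_exp. Qed.
Lemma E_add e x y : E e -> x < e -> y < e -> x + y < e.
Proof. intros h. apply (E_prin e h). Qed.
Lemma E_pos e : E e -> 0 < e.
Proof. intros h. apply prin_pos, E_prin, h. Qed.
Lemma E_one e : E e -> 1 < e.
Proof. intros h. apply E_exp; auto. apply E_pos; auto. Qed.
Lemma E_lim e : E e -> lim e.
Proof. intros h. split; [apply E_pos; auto |]. intros. apply E_add; auto. apply E_one; auto. Qed.
Lemma E_absorb e x : E e -> x < e -> x + e = e.
Proof. intros h. apply prin_absorb, E_prin, h. Qed.
Lemma not_E_lt x : ~ E x -> x < exp x.
Proof. intros h. destruct (exp_ge x) as [| e]; auto. elim h. symmetry. auto. Qed.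
Lemma E_of_exp x : E (exp x) -> E x.
Proof. unfold E. intros h. apply exp_inj. auto. Qed.

Definition Lim (X : U -> Prop) (r : U) : Prop :=
  0 < r /\ forall g, g < r -> exists x, X x /\ g < x /\ x < r.

(** By continuity a point below [exp b] lies below [exp K] for some [K < b], and an epsilon number
    between [K] and [b] keeps that power below [b]. *)
Lemma Lim_E b : Lim E b -> E b.
Proof.
  intros (hb & H). apply ule_antisym; [| apply exp_ge]. apply not_ult. intros h.
  assert (l : lim b).
  { split; auto. intros z hz. destruct (H z hz) as (e & _ & h1 & h2). apply le_succ in h1. ord. }
  destruct (exp_cont b b l h) as (K & h1 & h2). destruct (H K h1) as (e & he & h3 & h4).
  apply E_exp in h3; auto. ord.
Qed.

(** * The relations [<_1] and [<^1] *)

Definition R1 (a b : U) : Prop := lt1 O lt wf a b.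
Definition Rup (a b : U) : Prop := lt1up O lt wf a b.

Definition emb (B : list U) (a : U) (h : U -> U) : Prop :=
  (forall x, In x B -> h x < a) /\
  (forall x, In x B -> x < a -> h x = x) /\
  (forall x y z, In x B -> In y B -> In z B ->
     (x < y <-> h x < h y) /\ (R1 x y <-> R1 (h x) (h y)) /\ (x + y = z <-> h x + h y = h z)).

Definition emb_exp (B : list U) (h : U -> U) : Prop :=
  forall x y, In x B -> In y B -> (exp x = y <-> exp (h x) = h y).

Lemma list_lift (B : list O) : (forall x, In x B -> lt x E0) -> exists B' : list U, B = map val B'.
Proof.
  induction B as [| x B IH]; intros H. { exists nil; auto. }
  destruct (lift x) as [u ->]; [apply H; simpl; auto |].
  destruct IH as [B' ->]; [intros; apply H; simpl; auto |]. exists (u :: B'); auto.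
Qed.

Lemma fun_down (h : O -> O) (B : list U) : (forall x, In x B -> lt (h (val x)) E0) ->
  exists h' : U -> U, forall x, In x B -> h (val x) = val (h' x).
Proof.
  intros H. apply (fun_choice _ _ (fun (x : U) y => In x B -> h (val x) = val y)).
  intros x. destruct (classic (In x B)) as [i | n].
  - destruct (lift _ (H x i)) as [u hu]. eauto.
  - exists x. tauto.
Qed.

Lemma fun_up (h : U -> U) : exists h' : O -> O, forall x, h' (val x) = val (h x).
Proof.
  destruct (fun_choice _ _ (fun (w v : O) => forall u : U, w = val u -> v = val (h u))) as [h' Hh].
  - intros w. destruct (classic (lt w E0)) as [l | n].
    + destruct (lift w l) as [u ->]. exists (val (h u)). intros v hv. apply val_inj in hv. subst; auto.
    + exists w. intros u ->. elim n. apply val_lt.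
  - exists h'. intros x. apply Hh; auto.
Qed.

Lemma add_iff (x y z : U) : add O lt x y z <-> x + y = z.
Proof.
  rewrite uadd_val. split; [intros e; apply val_inj; auto | intros <-; auto].
Qed.
Lemma omexp_iff (x y : U) : omexp O lt x y <-> exp x = y.
Proof.
  rewrite uexp_val. split; [intros e; apply val_inj; auto | intros <-; auto].
Qed.
Lemma in_val (x : U) B : In (val x) (map val B) <-> In x B.
Proof.
  rewrite in_map_iff. split; [| eauto]. intros (y & e & i). apply val_inj in e. subst; auto.
Qed.

Lemma lt1_unfold b a : lt1 O lt wf a b <->
  carlson_F O lt b (fun y _ x => lt1 O lt wf x y) a.
Proof.
  unfold lt1 at 1. rewrite Fix_eq. { reflexivity. }
  intros x f g Hfg. replace g with f; auto.
  extensionality y. extensionality p. apply Hfg.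
Qed.

(** Test sets and their images lie below [b], hence below [E0], so maps on [O] and on [U] can be
    exchanged by restriction and by arbitrary extension. *)
Lemma R1_unfold a b : R1 a b <->
  a < b /\ forall B, (forall x, In x B -> x < b) -> exists h, emb B a h.
Proof.
  unfold R1. rewrite lt1_unfold. unfold carlson_F. split; intros (hab & H); split; auto; intros B HB.
  - destruct (H (map val B)) as (h & h1 & h2 & h3).
    { intros x hx. apply in_map_iff in hx. destruct hx as (u & <- & hu). apply HB; auto. }
    destruct (fun_down h B) as [k Hk].
    { intros x hx. apply in_val in hx. eapply lt_trans; [apply h1; auto | apply val_lt]. }
    exists k. split; [| split].
    + intros x hx. unfold ult. rewrite <- Hk; auto. apply h1, in_val; auto.
    + intros x hx hxa. apply val_inj. rewrite <- Hk; auto. apply h2; [apply in_val |]; auto.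
    + intros x y z hx hy hz. destruct (h3 x y z) as (k1 & k2 & k3); try (apply in_val; auto).
      rewrite (Hk x hx), (Hk y hy) in k1, k2, k3. rewrite (Hk z hz) in k3. split; [exact k1 |]. split.
      * apply k2; [apply HB; auto |]. rewrite <- Hk; auto.
        eapply lt_trans; [apply h1, in_val; auto | auto].
      * rewrite !add_iff in k3. exact k3.
  - destruct (list_lift B) as [B' ->].
    { intros x hx. eapply lt_trans; [apply HB; auto | apply val_lt]. }
    destruct (H B') as (h & h1 & h2 & h3). { intros x hx. apply HB, in_val; auto. }
    destruct (fun_up h) as [k Hk]. exists k.
    assert (A : forall x, In x (map val B') -> exists u, x = val u /\ In u B').
    { intros x hx. apply in_map_iff in hx. destruct hx as (u & <- & hu). eauto. }
    split; [| split].
    + intros x hx. destruct (A x hx) as (u & -> & hu). rewrite Hk. apply h1; auto.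
    + intros x hx hxa. destruct (A x hx) as (u & -> & hu). rewrite Hk. f_equal. apply h2; auto.
    + intros x y z hx hy hz. destruct (A x hx) as (u & -> & hu), (A y hy) as (v & -> & hv),
        (A z hz) as (w & -> & hw).
      rewrite !Hk, !add_iff. destruct (h3 u v w) as (k1 & k2 & k3); auto.
Qed.

Lemma Rup_unfold a b : Rup a b <->
  a < b /\ forall B, (forall x, In x B -> x < b) -> exists h, emb B a h /\ emb_exp B h.
Proof.
  unfold Rup, lt1up. split; intros (hab & H); split; auto; intros B HB.
  - destruct (H (map val B)) as (h & h1 & h2 & h3).
    { intros x hx. apply in_map_iff in hx. destruct hx as (u & <- & hu). apply HB; auto. }
    destruct (fun_down h B) as [k Hk].
    { intros x hx. apply in_val in hx. eapply lt_trans; [apply h1; auto | apply val_lt]. }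
    exists k. split; [split; [| split] |].
    + intros x hx. unfold ult. rewrite <- Hk; auto. apply h1, in_val; auto.
    + intros x hx hxa. apply val_inj. rewrite <- Hk; auto. apply h2; [apply in_val |]; auto.
    + intros x y z hx hy hz. destruct (h3 x y z) as (k1 & k2 & k3 & k4); try (apply in_val; auto).
      rewrite (Hk x hx), (Hk y hy) in k1, k2, k3. rewrite (Hk z hz) in k3. rewrite !add_iff in k3. auto.
    + intros x y hx hy. destruct (h3 x y y) as (k1 & k2 & k3 & k4); try (apply in_val; auto).
      rewrite (Hk x hx), (Hk y hy), !omexp_iff in k4. auto.
  - destruct (list_lift B) as [B' ->].
    { intros x hx. eapply lt_trans; [apply HB; auto | apply val_lt]. }
    destruct (H B') as (h & (h1 & h2 & h3) & h4). { intros x hx. apply HB, in_val; auto. }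
    destruct (fun_up h) as [k Hk]. exists k.
    assert (A : forall x, In x (map val B') -> exists u, x = val u /\ In u B').
    { intros x hx. apply in_map_iff in hx. destruct hx as (u & <- & hu). eauto. }
    split; [| split].
    + intros x hx. destruct (A x hx) as (u & -> & hu). rewrite Hk. apply h1; auto.
    + intros x hx hxa. destruct (A x hx) as (u & -> & hu). rewrite Hk. f_equal. apply h2; auto.
    + intros x y z hx hy hz. destruct (A x hx) as (u & -> & hu), (A y hy) as (v & -> & hv),
        (A z hz) as (w & -> & hw).
      rewrite !Hk, !add_iff, !omexp_iff. destruct (h3 u v w) as (k1 & k2 & k3); auto.
Qed.

Lemma R1_lt a b : R1 a b -> a < b.
Proof. intros h. apply R1_unfold in h. tauto. Qed.

Lemma Rup_R1 a b : Rup a b -> R1 a b.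
Proof.
  rewrite Rup_unfold, R1_unfold. intros (h & H). split; auto. intros B HB.
  destruct (H B HB) as (k & hk & _). eauto.
Qed.

Lemma R1_down a b c : R1 a c -> a < b -> b <= c -> R1 a b.
Proof.
  rewrite !R1_unfold. intros (h & H) hab hbc. split; auto. intros B HB. apply H.
  intros x hx. specialize (HB x hx). ord.
Qed.

Lemma R1_trans a b c : R1 a b -> R1 b c -> R1 a c.
Proof.
  rewrite !R1_unfold. intros (hab & H1) (hbc & H2). split; [ord |]. intros B HB.
  destruct (H2 B HB) as (h & h1 & h2 & h3).
  destruct (H1 (map h B)) as (k & k1 & k2 & k3).
  { intros x hx. apply in_map_iff in hx. destruct hx as (y & <- & hy). auto. }
  exists (fun x => k (h x)). split; [| split].
  - intros x hx. apply k1, in_map; auto.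
  - intros x hx hxa. assert (e : h x = x) by (apply h2; auto; ord).
    rewrite (k2 (h x)); auto; [apply in_map; auto | rewrite e; auto].
  - intros x y z hx hy hz.
    destruct (h3 x y z hx hy hz) as (p1 & p2 & p3).
    destruct (k3 (h x) (h y) (h z)) as (q1 & q2 & q3); try (apply in_map; auto).
    rewrite p1, p2, p3. auto.
Qed.

Definition R1eq (a b : U) : Prop := a = b \/ R1 a b.

Lemma R1eq_R1 a b : R1eq a b -> a < b -> R1 a b.
Proof. intros [-> | h] h'; auto. ord. Qed.

Lemma R1eq_down a b c : R1eq a c -> a <= b -> b <= c -> R1eq a b.
Proof.
  intros [<- | h] hab hbc. { left. ord. }
  destruct hab as [hab | ->]; [right | left; auto]. eapply R1_down; eauto.
Qed.
Lemma R1eq_lt a b c : R1eq a c -> a < b -> b <= c -> R1 a b.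
Proof.
  intros h hab hbc. destruct (R1eq_down a b c h (ult_ule _ _ hab) hbc) as [-> | ]; auto. ord.
Qed.
Lemma R1eq_trans a b c : R1eq a b -> R1eq b c -> R1eq a c.
Proof.
  intros [-> | h] [-> | h']; unfold R1eq; auto. right. eapply R1_trans; eauto.
Qed.

(** If [x, y < a] but [a <= x + y], then [a = x + d] with [d < a]. A map for [[x; d; x + d]] fixes
    [x] and [d], hence their sum, yet has to move that sum, which is [a], below [a]. *)
Lemma R1_prin a b : R1 a b -> prin a.
Proof.
  rewrite R1_unfold. intros (hab & H). split.
  - destruct (H [0]) as (h & h1 & _).
    { intros x [<- | []]. destruct (zero_or_pos b) as [-> |]; auto. elim (not_lt_zero _ hab). }
    exists (h 0). apply h1. simpl; auto.
  - intros x y hx hy. apply NNPP. intros n. apply not_ult in n.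
    destruct (sub_ex x a) as [d ->]; [left; auto |].
    apply add_le_cancel in n. assert (hd : d < x + d) by ord.
    destruct (H [x; d; x + d]) as (h & h1 & h2 & h3).
    { intros z [<- | [<- | [<- | []]]]; ord. }
    destruct (h3 x d (x + d)) as (_ & _ & [q _]); simpl; auto. specialize (q eq_refl).
    rewrite (h2 x), (h2 d) in q; simpl; auto.
    specialize (h1 (x + d)). rewrite <- q in h1. simpl in h1. specialize (h1 ltac:(auto)). ord.
Qed.

(* The set of [y] with [R1 u y] is closed. *)
Lemma R1_bound u b : lim b -> u < b -> ~ R1 u b -> exists g, g < b /\ forall y, g < y -> y < b -> ~ R1 u y.
Proof.
  intros lb hu n. apply NNPP. intros m. apply n. apply R1_unfold. split; auto. intros B HB.
  assert (exists g, g < b /\ forall x, In x B -> x <= g) as (g & hg & Hg).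
  { clear m. induction B as [| x B IH]. { exists u. split; auto. intros ? []. }
    destruct IH as (g & hg & Hg). { intros; apply HB; simpl; auto. }
    assert (x < b) by (apply HB; simpl; auto).
    destruct (ule_case x g) as [h | h].
    - exists g. split; auto. intros y [<- | hy]; auto. left; auto.
    - exists x. split; auto. intros y [<- | hy]; [apply ule_refl |]. specialize (Hg y hy). ord. }
  destruct (classic (exists y, g < y /\ y < b /\ R1 u y)) as [(y & h1 & h2 & h3) | k].
  - apply R1_unfold in h3. apply h3. intros x hx. specialize (Hg x hx). ord.
  - elim m. exists g. split; auto. intros y h1 h2 h3. apply k; eauto.
Qed.

Lemma list_bound (B : list U) (b : U) (P : U -> U -> Prop) :
  0 < b ->
  (forall x g g', P x g -> g <= g' -> g' < b -> P x g') ->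
  (forall x, In x B -> exists g, g < b /\ P x g) ->
  exists g, g < b /\ forall x, In x B -> P x g.
Proof.
  intros hb mono. induction B as [| x B IH]; intros H. { exists 0. split; auto. intros ? []. }
  destruct IH as (g & hg & Hg). { intros; apply H; simpl; auto. }
  destruct (H x) as (g' & hg' & Hg'); [simpl; auto |].
  destruct (ule_case g g') as [h | h].
  - exists g'. split; auto. intros y [<- | hy]; auto. eapply mono; eauto. left; auto.
  - exists g. split; auto. intros y [<- | hy]; auto. eapply mono; eauto.
Qed.

(** One bound [g] for the whole list: a listed [x < b] that is related to some point strictly
    between [g] and [b] is already related to [b]. So moving [b] down to a point above [g] creates
    no new relations from below. *)
Lemma list_R1_bound B b : lim b -> exists g, g < b /\
  forall x, In x B -> x < b -> x <= g /\ (~ R1 x b -> forall y, g < y -> y < b -> ~ R1 x y).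
Proof.
  intros lb. apply list_bound; [apply lb | |].
  { intros x c c' h h1 h2 hx. destruct (h hx) as (k1 & k2). split; [ord |].
    intros n y hy. apply k2; auto. ord. }
  intros x _. destruct (ule_case x b) as [hx | hx].
  - destruct (classic (R1 x b)) as [r | n].
    + exists x. split; auto. intros _. split; [apply ule_refl | tauto].
    + destruct (R1_bound x b lb hx n) as (c & h1 & h2).
      destruct (ule_case x c) as [k | k].
      * exists c. split; auto. intros _. split; [left |]; auto.
      * exists x. split; auto. intros _. split; [apply ule_refl |]. intros _ y hy. apply h2. ord.
  - exists 0. split; [apply lb |]. intros; ord.
Qed.

Lemma max_below b x y : x < b -> y < b -> exists m, m < b /\ x <= m /\ y <= m.
Proof.
  intros h h'. destruct (ule_case x y); [exists y | exists x]; repeat split; auto;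
    try apply ule_refl. left; auto.
Qed.

(** * The relation [<_1] at additively principal numbers *)

Lemma add_eq_iff x y y' : x + y = x + y' <-> y = y'.
Proof. split; [apply add_cancel | congruence]. Qed.
Lemma add_lt_iff x y y' : x + y < x + y' <-> y < y'.
Proof. split; [apply add_lt_cancel | apply add_lt_r]. Qed.

Lemma pos_of_lt_add x y : x < x + y -> 0 < y.
Proof.
  intros h. destruct (zero_or_pos y) as [-> |]; auto. rewrite add_0_r in h. ord.
Qed.

(** Induction on [xi]. A finite set below [g + xi] is bounded by [g + zeta] for some [zeta < xi].
    The induction hypothesis gives [d <_1 d + zeta] for every principal [d] whose exponent ends in
    [exp zeta] with [zeta] positive, so the block from [g] to [g + zeta] can be shifted down to such
    a [d < g]. *)
Lemma R1_exp_last xi : 0 < xi -> forall l q, xi <= q -> R1 (exp (l + exp q)) (exp (l + exp q) + xi).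
Proof.
  induction (ult_wf xi) as [xi _ IH]. intros hxi l q hq.
  remember (exp (l + exp q)) as g eqn:Eg.
  apply R1_unfold. split; [apply lt_add_pos; auto |]. intros B HB.
  assert (qg : q <= g).
  { pose proof (last_le l q). pose proof (exp_ge (l + exp q)). ord. }
  assert (q0 : 0 < q) by ord.
  assert (ll : lim (l + exp q)) by (apply lim_add, lim_exp; auto).
  assert (pg : prin g) by (subst g; apply prin_exp).
  assert (lg : lim g) by (subst g; apply lim_exp, ll).
  destruct (list_bound B xi (fun x z => x <= g + z)) as (zeta & hz & Hz); auto.
  { intros x c c' h1 h2 _. pose proof (add_le_r g c c' h2). ord. }
  { intros x hx. specialize (HB x hx). apply lt_add in HB. destruct HB as [h | (c & h & ->)].
    - exists 0. split; auto. rewrite add_0_r. left; auto.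
    - exists c. split; auto. apply ule_refl. }
  destruct (list_R1_bound B g lg) as (g0 & hg0 & Hg0).
  assert (exists g1, g1 < g /\ g0 <= g1 /\ zeta <= g1) as (g1 & hg1 & hg01 & hzg1).
  { destruct (ule_case g0 zeta) as [h | h].
    - exists zeta. split; [ord |]. split; [left; auto | apply ule_refl].
    - exists g0. split; [ord |]. split; [apply ule_refl | auto]. }
  assert (exists v, v < exp q /\ g1 < exp (l + v)) as (v & hv & Hv).
  { rewrite Eg in hg1. destruct (exp_cont _ _ ll hg1) as (K & h1 & h2). apply lt_add in h1.
    destruct h1 as [h1 | (v & h1 & ->)]; [| eauto].
    exists 0. split; [apply exp_pos |]. rewrite add_0_r. apply exp_lt in h1. ord. }
  assert (hzq : zeta < q) by ord.
  (* [v] lifts [exp (l + v)] above all relevant points below [g]. As [v] and [exp zeta] are both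
     below [exp q], appending [exp zeta] to the exponent keeps [d] below [g]. *)
  remember (exp (l + (v + exp zeta))) as d eqn:Ed.
  assert (hd : d < g).
  { subst. apply exp_lt, add_lt_r, exp_closed; auto. apply exp_lt; auto. }
  assert (hd1 : g1 < d).
  { rewrite Ed. eapply ult_ule_trans; [exact Hv |]. apply exp_le, add_le_r, le_add_l. }
  assert (pd : prin d) by (subst d; apply prin_exp).
  assert (Rg : R1eq g (g + zeta)).
  { destruct (zero_or_pos zeta) as [-> | hz0]; [left; rewrite add_0_r; auto |].
    right. rewrite Eg. apply IH; auto. left; auto. }
  assert (Rd : R1eq d (d + zeta)).
  { destruct (zero_or_pos zeta) as [-> | hz0]; [left; rewrite add_0_r; auto |].
    right. rewrite Ed, <- add_assoc. apply IH; auto. apply ule_refl. }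
  clear Eg Ed Hv hv.
  destruct (fun_choice _ _ (fun x y => (x < g /\ y = x) \/ exists c, x = g + c /\ y = d + c)) as [h Hh].
  { intros x. destruct (ule_case x g) as [hx | hx]; eauto.
    destruct (sub_ex _ _ hx) as [c ->]. eauto 6. }
  assert (A : forall x, In x B -> (x < g /\ h x = x /\ x < d /\ x <= g0) \/
    exists c, x = g + c /\ h x = d + c /\ c <= zeta /\ c < d).
  { intros x hx. destruct (Hh x) as [(h1 & h2) | (c & h1 & h2)].
    - left. destruct (Hg0 x hx h1) as (h3 & _). repeat split; auto. ord.
    - right. exists c. specialize (Hz x hx). rewrite h1 in Hz. apply add_le_cancel in Hz.
      repeat split; auto. ord. }
  assert (lgd : forall x, g <= g + x /\ d <= d + x) by (intros; split; apply le_add_l).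
  exists h. split; [| split].
  - intros x hx. destruct (A x hx) as [(h1 & -> & _) | (c & _ & -> & _ & h3)]; auto.
    apply pg; auto. ord.
  - intros x hx hxd. destruct (A x hx) as [(h1 & -> & _) | (c & -> & _)]; auto.
    destruct (lgd c). ord.
  - intros x y z hx hy hz'. split; [| split].
    + destruct (A x hx) as [(h1 & -> & h2 & _) | (c & -> & -> & h1 & h2)],
        (A y hy) as [(k1 & -> & k2 & _) | (c' & -> & -> & k1 & k2)].
      * tauto.
      * destruct (lgd c'). split; intros; ord.
      * destruct (lgd c). split; intros; ord.
      * rewrite !add_lt_iff. tauto.
    (* Only the first point of each block is principal, so [<_1] issues from no other point of
       it. *)
    + assert (nonprin : forall c y, 0 < c -> c <= zeta -> ~ R1 (g + c) y /\ ~ R1 (d + c) y).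
      { intros c u hc hc'. split; intros r; apply R1_prin in r; destruct r as (_ & r).
        - specialize (r g c). pose proof (lt_add_pos g c hc).
          assert (g + c < g + c) by (apply r; [ord |]; pose proof (le_add_l g c); ord). ord.
        - specialize (r d c). pose proof (lt_add_pos d c hc).
          assert (d + c < d + c) by (apply r; [ord |]; pose proof (le_add_l d c); ord). ord. }
      destruct (A x hx) as [(h1 & -> & h2 & h3) | (c & -> & -> & h1 & h2)],
        (A y hy) as [(k1 & -> & k2 & k3) | (c' & -> & -> & k1 & k2)].
      * tauto.
      * destruct (lgd c'). split; intros r.
        -- eapply R1_down; [exact r | ord | apply add_le_l; left; auto].
        (* By the choice of [g0], a relation into the shifted block forces one to [g], which then
           extends along the upper block by transitivity. *)
        -- destruct (classic (R1 x g)) as [r' | n].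
           ++ apply R1eq_R1; [| ord].
              eapply R1eq_trans; [right; exact r' |]. eapply R1eq_down; [exact Rg | ord |].
              apply add_le_r; auto.
           ++ exfalso. destruct (Hg0 x hx h1) as (_ & h4). apply (h4 n (d + c')); auto; [ord |].
              apply pg; auto; ord.
      * destruct (lgd c). split; intros r; apply R1_lt in r; exfalso; ord.
      * destruct (zero_or_pos c) as [-> | hc].
        -- rewrite !add_0_r. split; intros r; apply R1_lt in r.
           ++ eapply R1eq_lt; [exact Rd | | apply add_le_r; exact k1].
              apply lt_add_pos, (pos_of_lt_add g); auto.
           ++ eapply R1eq_lt; [exact Rg | | apply add_le_r; exact k1].
              apply lt_add_pos, (pos_of_lt_add d); auto.
        -- split; intros r; exfalso.
           ++ apply (proj1 (nonprin c (g + c') hc h1)); auto.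
           ++ apply (proj2 (nonprin c (d + c') hc h1)); auto.
    + destruct (A x hx) as [(h1 & -> & h2 & _) | (c & -> & -> & h1 & h2)],
        (A y hy) as [(k1 & -> & k2 & _) | (c' & -> & -> & k1 & k2)],
        (A z hz') as [(m1 & -> & m2 & _) | (c'' & -> & -> & m1 & m2)].
      * tauto.
      * destruct (lgd c''). assert (x + y < g) by (apply pg; auto).
        assert (x + y < d) by (apply pd; auto). split; intros; ord.
      * rewrite <- !add_assoc, (prin_absorb g x), (prin_absorb d x); auto.
        destruct (lgd c'). split; intros; ord.
      * rewrite <- !add_assoc, (prin_absorb g x), (prin_absorb d x); auto.
        rewrite !add_eq_iff. tauto.
      * rewrite !add_assoc. destruct (lgd (c + y)). split; intros; ord.
      * rewrite !add_assoc, !add_eq_iff. tauto.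
      * rewrite !add_assoc. destruct (lgd (c + (g + c'))), (lgd (c + (d + c'))). split; intros; ord.
      * rewrite !add_assoc, !add_eq_iff. pose proof (le_add_r c (g + c')). pose proof (le_add_r c (d + c')).
        destruct (lgd c'). split; intros; exfalso; ord.
Qed.

(** Induction on [g]. Reflecting [[x; exp l; q; g; g + q]] gives [d < g] with [d <_1 d + q] for
    positive [q]. As [exp l] is still absorbed by [d], the exponent of [d] extends [l] by some
    positive [v < exp q]. The last exponent [q'] of [v] is below [q], hence [d <_1 d + (q' + 1)],
    against the induction hypothesis. *)
Lemma not_R1_exp_last l q : l + exp q < exp (l + exp q) ->
  ~ R1 (exp (l + exp q)) (exp (l + exp q) + (q + 1)).
Proof.
  remember (exp (l + exp q)) as g eqn:Eg. revert l q Eg.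
  induction (ult_wf g) as [g _ IH]. intros l q Eg hg r.
  remember (l + exp q) as x eqn:Ex.
  assert (hlx : l < x) by (subst x; apply lt_add_pos, exp_pos).
  assert (hl : exp l < g) by (subst g; apply exp_lt; auto).
  assert (hq : q < g). { pose proof (last_le l q). rewrite <- Ex in H. ord. }
  assert (hgq : g <= g + q) by apply le_add_l.
  assert (hgq1 : g + q < g + (q + 1)) by apply add_lt_r, succ_lt.
  pose proof r as r0. apply R1_unfold in r0. destruct r0 as (_ & H).
  destruct (H [x; exp l; q; g; g + q]) as (h & h1 & h2 & h3).
  { intros z [<- | [<- | [<- | [<- | [<- | []]]]]]; ord. }
  assert (fx : h x = x) by (apply h2; simpl; auto).
  assert (fl : h (exp l) = exp l) by (apply h2; simpl; auto).
  assert (fq : h q = q) by (apply h2; simpl; auto).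
  assert (dg : h g < g) by (apply h1; simpl; auto).
  remember (h g) as d eqn:Ed.
  (* The exponent [x] belongs to the set so that [d] stays above [x], and thus above its own smaller
     exponent: [d] is not an epsilon number. *)
  assert (xd : x < d).
  { destruct (h3 x g g) as ((k & _) & _); simpl; auto 6. specialize (k hg). rewrite fx in k. ord. }
  assert (ld : exp l + d = d).
  { destruct (h3 (exp l) g g) as (_ & _ & (k & _)); simpl; auto 6.
    rewrite fl, <- Ed in k. apply k. rewrite Eg. apply exp_absorb. apply exp_lt; auto. }
  apply exp_absorb_ge in ld.
  destruct (zero_or_pos q) as [-> | q0]. { rewrite <- Ex, <- Eg in ld. ord. }
  assert (rd : R1 d (d + q)).
  { destruct (h3 g (g + q) (g + q)) as (_ & (k & _) & _); simpl; auto 6.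
    destruct (h3 g q (g + q)) as (_ & _ & (k' & _)); simpl; auto 6.
    rewrite fq, <- Ed in k'. specialize (k' eq_refl). rewrite k', Ed. apply k.
    eapply R1_down; [exact r | apply lt_add_pos; auto | left; auto]. }
  destruct (prin_is_exp d (R1_prin _ _ rd)) as [y hy].
  rewrite hy in ld. apply exp_le_cancel in ld. apply le_succ in ld.
  rewrite hy, Eg in dg. apply exp_lt_cancel in dg.
  rewrite Ex in dg. apply lt_add in dg. destruct dg as [dg | (v & hv & ev)]; [ord |].
  assert (v0 : 0 < v). { destruct (zero_or_pos v) as [-> |]; auto. rewrite add_0_r in ev. ord. }
  destruct (last_ex v v0) as (v' & q' & ->). rewrite <- add_assoc in ev.
  assert (hqq : q' < q).
  { apply exp_lt_cancel. pose proof (le_add_r v' (exp q')). ord. }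
  apply (IH d ltac:(rewrite hy, Eg; apply exp_lt; rewrite ev, Ex, add_assoc; apply add_lt_r; auto)
           (l + v') q').
  - rewrite <- ev. auto.
  - rewrite <- ev. eapply ult_trans; [| exact xd]. rewrite ev, Ex, add_assoc. apply add_lt_r; auto.
  - eapply R1_down; [exact rd | apply lt_add_pos |].
    + pose proof (succ_lt q'). pose proof (zero_le q'). ord.
    + apply add_le_r. apply le_succ in hqq. auto.
Qed.

Lemma R1_exp_iff l q y : l + exp q < exp (l + exp q) ->
  (R1 (exp (l + exp q)) y <-> exp (l + exp q) < y /\ y <= exp (l + exp q) + q).
Proof.
  intros h. split.
  - intros r. split; [apply R1_lt; auto |]. apply not_ult. intros n.
    apply (not_R1_exp_last l q h). eapply R1_down; [exact r | |].
    + apply lt_add_pos. pose proof (succ_lt q). pose proof (zero_le q). ord.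
    + rewrite <- add_assoc. apply le_succ in n. auto.
  - intros (h1 & h2). destruct (sub_pos_ex _ _ h1) as (xi & k & ->).
    apply add_le_cancel in h2. apply R1_exp_last; auto.
Qed.

(** An epsilon number is [exp (0 + exp e)], with [e] itself as last exponent. *)
Lemma R1_E_double e : E e -> R1 e (e + e).
Proof.
  intros h. pose proof (R1_exp_last e (E_pos e h) 0 e (ule_refl e)) as r.
  rewrite add_0_l in r. unfold E in h. rewrite !h in r. auto.
Qed.

(** * Substitution as a relation *)

(* [N a b x x'] says that x and x' have a common Cantor normal form built from ordinals below both
   a and b and from one further symbol, read as a in x and as b in x'; thus x' = x[a := b]. *)
Inductive N (a b : U) : U -> U -> Prop :=
| N_par p : p < a -> p < b -> N a b p p
| N_base : N a b a b
| N_lead L L' r r' : N a b L L' -> N a b r r' -> r < exp (L + 1) -> r' < exp (L' + 1) ->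
    N a b (exp L + r) (exp L' + r').

(** A joint trichotomy gives preservation and reflection of both [<] and [=] from one induction, and
    makes [N] a partial injection. *)
Definition same_order (x x' y y' : U) : Prop :=
  (x < y /\ x' < y') \/ (x = y /\ x' = y') \/ (y < x /\ y' < x').

Lemma same_order_sym x x' y y' : same_order x x' y y' -> same_order y y' x x'.
Proof. unfold same_order. intuition auto. Qed.

Lemma same_order_lead K K' s s' L L' r r' : same_order K K' L L' -> same_order s s' r r' ->
  s < exp (K + 1) -> s' < exp (K' + 1) -> r < exp (L + 1) -> r' < exp (L' + 1) ->
  same_order (exp K + s) (exp K' + s') (exp L + r) (exp L' + r').
Proof.
  intros [(h1 & h2) | [(-> & ->) | (h1 & h2)]] H; intros.
  - left. split; apply lead_lt; auto.
  - destruct H as [(h1 & h2) | [(-> & ->) | (h1 & h2)]]; [left | right; left | right; right];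
      split; auto; apply add_lt_r; auto.
  - right; right. split; apply lead_lt; auto.
Qed.

Lemma N_sym a b x x' : N a b x x' -> N b a x' x.
Proof. induction 1; constructor; auto. Qed.

Section Comparison.
Variables a b : U.
Hypotheses (Ea : E a) (Eb : E b).

Lemma N_tri_par y y' : N a b y y' -> forall p, p < a -> p < b -> same_order p p y y'.
Proof.
  induction 1 as [q h1 h2 | | L L' r r' _ IHL _ IHr hr hr']; intros p pa pb.
  - destruct (ult_total p q) as [h | [-> | h]]; [left | right; left | right; right]; auto.
  - left; auto.
  - destruct (zero_or_pos p) as [-> | p0].
    { left. pose proof (exp_pos L). pose proof (exp_pos L').
      pose proof (le_add_l (exp L) r). pose proof (le_add_l (exp L') r'). split; ord. }
    destruct (lead_ex p p0) as (K & s & e & h1 & h2 & h3). rewrite e.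
    apply same_order_lead; auto; [apply IHL | apply IHr]; ord.
Qed.

Lemma N_tri_base y y' : N a b y y' -> same_order a b y y'.
Proof.
  induction 1 as [q h1 h2 | | L L' r r' HL IHL Hr IHr hr hr'].
  - right; right; auto.
  - right; left; auto.
  - assert (H : same_order (exp a + 0) (exp b + 0) (exp L + r) (exp L' + r')).
    { apply same_order_lead; auto; try apply exp_pos. apply N_tri_par; auto; apply E_pos; auto. }
    rewrite !add_0_r, (Ea : exp a = a), (Eb : exp b = b) in H. auto.
Qed.

Lemma N_tri x x' y y' : N a b x x' -> N a b y y' -> same_order x x' y y'.
Proof.
  intros Hx. revert y y'. induction Hx as [p h1 h2 | | K K' s s' HK IHK Hs IHs hs hs']; intros y y' Hy.
  - apply N_tri_par; auto.
  - apply N_tri_base; auto.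
  - destruct Hy as [q k1 k2 | | L L' r r' HL Hr hr hr'].
    + apply same_order_sym, N_tri_par; auto. constructor; auto.
    + apply same_order_sym, N_tri_base. constructor; auto.
    + apply same_order_lead; auto.
Qed.

Lemma N_lt_iff x x' y y' : N a b x x' -> N a b y y' -> (x < y <-> x' < y').
Proof.
  intros H H'. destruct (N_tri _ _ _ _ H H') as [(h1 & h2) | [(-> & ->) | (h1 & h2)]]; split; intros; ord.
Qed.
Lemma N_le_iff x x' y y' : N a b x x' -> N a b y y' -> (x <= y <-> x' <= y').
Proof.
  intros H H'. destruct (N_tri _ _ _ _ H H') as [(h1 & h2) | [(-> & ->) | (h1 & h2)]]; split; intros; ord.
Qed.
Lemma N_eq_iff x x' y y' : N a b x x' -> N a b y y' -> (x = y <-> x' = y').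
Proof.
  intros H H'. destruct (N_tri _ _ _ _ H H') as [(h1 & h2) | [(-> & ->) | (h1 & h2)]]; split; intros; auto; ord.
Qed.
Lemma N_fun x x' x'' : N a b x x' -> N a b x x'' -> x' = x''.
Proof. intros H H'. apply (N_eq_iff _ _ _ _ H H'); auto. Qed.

Lemma N_zero : N a b 0 0.
Proof. constructor; apply E_pos; auto. Qed.
Lemma N_one : N a b 1 1.
Proof. constructor; apply E_one; auto. Qed.

Lemma N_exp L L' : N a b L L' -> N a b (exp L) (exp L').
Proof.
  intros H. rewrite <- (add_0_r (exp L)), <- (add_0_r (exp L')). constructor; auto; try apply exp_pos.
  apply N_zero.
Qed.

Lemma N_small x x' : N a b x x' -> x < a -> x' = x.
Proof.
  induction 1 as [p h1 h2 | | L L' r r' HL IHL Hr IHr hr hr']; intros h; auto; [ord |].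
  pose proof (le_add_l (exp L) r). pose proof (le_add_r (exp L) r). pose proof (exp_ge L).
  rewrite IHL, IHr; auto; ord.
Qed.
Lemma N_small_lt x x' : N a b x x' -> x < a -> x < b.
Proof.
  intros H h. pose proof (N_small _ _ H h). subst. apply (N_lt_iff _ _ _ _ H (N_base a b)); auto.
Qed.

(** The pair of [a] and [b] fits the pattern too, as [exp a + 0] and [exp b + 0]. *)
Lemma N_view x x' : N a b x x' -> (x = 0 /\ x' = 0) \/
  exists L L' r r', x = exp L + r /\ x' = exp L' + r' /\ N a b L L' /\ N a b r r' /\
    r < exp (L + 1) /\ r' < exp (L' + 1).
Proof.
  intros H. destruct H as [p h1 h2 | | L L' r r' HL Hr hr hr'].
  - destruct (zero_or_pos p) as [-> | p0]; auto. right.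
    destruct (lead_ex p p0) as (L & r & e & h3 & h4 & h5).
    exists L, L, r, r. repeat split; auto; constructor; ord.
  - right. exists a, b, 0, 0. rewrite !add_0_r, (Ea : exp a = a), (Eb : exp b = b). repeat split; auto using exp_pos, N_base, N_zero.
  - right. exists L, L', r, r'. auto 8.
Qed.

(** Whether [exp L] is absorbed by [w] depends on comparing [L] with the leading exponent of [w],
    and by [N_tri] the comparison has the same outcome on both sides. *)
Lemma N_lead_add L L' w w' : N a b L L' -> N a b w w' -> N a b (exp L + w) (exp L' + w').
Proof.
  intros HL Hw. destruct (N_view _ _ Hw) as [(-> & ->) | (K & K' & r & r' & -> & -> & HK & Hr & hr & hr')].
  { rewrite !add_0_r. apply N_exp; auto. }
  destruct (N_tri _ _ _ _ HL HK) as [(h1 & h2) | [(-> & ->) | (h1 & h2)]].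
  - rewrite <- !add_assoc, !exp_absorb; auto; apply exp_lt; auto.
  - constructor; auto; apply exp_closed; auto; apply exp_lt, succ_lt.
  - constructor; auto; (eapply ult_trans; [apply lead_below; eauto | apply exp_lt, succ_lt]).
Qed.

Lemma N_add x x' y y' : N a b x x' -> N a b y y' -> N a b (x + y) (x' + y').
Proof.
  intros Hx Hy. induction Hx as [p h1 h2 | | K K' s s' HK IHK Hs IHs hs hs'].
  - induction (ult_wf p) as [p _ IH]. destruct (zero_or_pos p) as [-> | p0]. { rewrite !add_0_l; auto. }
    destruct (lead_ex p p0) as (K & s & e & k1 & k2 & k3).
    specialize (IH s k2 ltac:(ord) ltac:(ord)). rewrite e, !add_assoc.
    apply N_lead_add; auto. constructor; ord.
  - pose proof (N_lead_add a b y y' (N_base a b) Hy) as H.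
    rewrite (Ea : exp a = a), (Eb : exp b = b) in H. auto.
  - rewrite !add_assoc. apply N_lead_add; auto.
Qed.

Lemma N_mul x x' n : N a b x x' -> N a b (mul x n) (mul x' n).
Proof. intros H. induction n; simpl; [apply N_zero | apply N_add; auto]. Qed.

Lemma N_lead_inv K s x' : s < exp (K + 1) -> N a b (exp K + s) x' ->
  exists K' s', x' = exp K' + s' /\ N a b K K' /\ N a b s s' /\ s' < exp (K' + 1).
Proof.
  intros hs H. destruct (N_view _ _ H) as [(e & _) | (L & L' & r & r' & e & -> & HL & Hr & hr & hr')].
  - apply add_zero_inv in e. destruct e. pose proof (exp_pos K). ord.
  - apply lead_uniq in e; auto. destruct e as (-> & ->). eauto 6.
Qed.

Lemma N_exp_inv L x' : N a b (exp L) x' -> exists L', x' = exp L' /\ N a b L L'.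
Proof.
  rewrite <- (add_0_r (exp L)). intros H. apply N_lead_inv in H; [| apply exp_pos].
  destruct H as (K' & s' & -> & h1 & h2 & _). exists K'. split; auto.
  rewrite (N_fun _ _ _ h2 N_zero), add_0_r. auto.
Qed.

Lemma N_last_inv x x' : N a b x x' -> 0 < x ->
  exists l l' q q', x = l + exp q /\ x' = l' + exp q' /\ N a b l l' /\ N a b q q'.
Proof.
  induction 1 as [p h1 h2 | | K K' s s' HK IHK Hs IHs hs hs']; intros h.
  - destruct (last_ex p h) as (l & q & e). exists l, l, q, q.
    pose proof (last_le l q). pose proof (le_add_l l (exp q)). rewrite <- e in *.
    repeat split; auto; constructor; ord.
  - exists 0, 0, a, b. rewrite !add_0_l, (Ea : exp a = a), (Eb : exp b = b). repeat split; auto using N_zero, N_base.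
  - destruct (zero_or_pos s) as [-> | s0].
    + rewrite (N_fun _ _ _ Hs N_zero), !add_0_r. exists 0, 0, K, K'. rewrite !add_0_l.
      auto using N_zero.
    + destruct (IHs s0) as (l & l' & q & q' & -> & -> & h3 & h4).
      exists (exp K + l), (exp K' + l'), q, q'. rewrite !add_assoc.
      repeat split; auto. apply N_lead_add; auto.
Qed.

Lemma N_below_eps x x' c : N a b x x' -> E c -> b < c -> x' < c.
Proof.
  intros H hc hb. induction H as [p h1 h2 | | K K' s s' HK IHK Hs IHs hs hs']; auto; [ord |].
  apply E_add; auto. apply E_exp; auto.
Qed.

Lemma N_E x x' : N a b x x' -> E x -> x <= a.
Proof.
  induction 1 as [p h1 h2 | | K K' s s' HK IHK Hs IHs hs hs']; intros h; [left; auto | right; auto |].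
  destruct (zero_or_pos s) as [-> | s0].
  - rewrite add_0_r in *. apply E_of_exp in h. pose proof (exp_le _ _ (IHK h)) as k.
    unfold E in Ea. rewrite Ea in k. auto.
  - exfalso. apply E_prin in h. destruct h as (_ & h). pose proof (tail_lt K s hs).
    pose proof (lt_add_pos (exp K) s s0). specialize (h _ _ H0 H). ord.
Qed.

Lemma N_prin x x' : N a b x x' -> prin x -> exists L L', x = exp L /\ x' = exp L' /\ N a b L L'.
Proof.
  intros H h. destruct (prin_is_exp x h) as [L ->]. destruct (N_exp_inv _ _ H) as (L' & -> & h'). eauto.
Qed.

End Comparison.

(** * Varying the substituted epsilon number *)

Lemma N_shrink a b x x' : E a -> E b -> N a b x x' ->
  exists g, g < b /\ forall e, E e -> g < e -> exists x'', N a e x x''.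
Proof.
  intros Ea Eb. induction 1 as [p h1 h2 | | K K' s s' HK IHK Hs IHs hs hs'].
  - exists p. split; auto. intros e _ he. exists p. constructor; auto.
  - exists 0. split; [apply E_pos; auto |]. intros e _ _. exists e. constructor.
  - destruct IHK as (g & hg & Hg), IHs as (g' & hg' & Hg').
    destruct (max_below b g g' hg hg') as (m & m1 & m2 & m3).
    exists m. split; auto. intros e he hm. destruct (Hg e he) as [K'' HK'']; [ord |].
    destruct (Hg' e he) as [s'' Hs'']; [ord |]. exists (exp K'' + s''). apply N_lead_add; auto.
Qed.

Lemma N_mono a e b x x' : E a -> E b -> N a e x x' -> e <= b -> exists x'', N a b x x''.
Proof.
  intros Ea Eb H hb. induction H as [p h1 h2 | | K K' s s' HK IHK Hs IHs hs hs'].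
  - exists p. constructor; ord.
  - exists b. constructor.
  - destruct IHK as (K'' & hK), IHs as (s'' & hs''). exists (exp K'' + s''). apply N_lead_add; auto.
Qed.

(** The parameters in the derivation for [z] lie below [e], hence below [b], so the same derivation
    relates [y] and [z]. *)
Lemma N_compose a b e x y z : E a -> E b -> E e -> e <= b -> b <= a ->
  N a b x y -> N a e x z -> N b e y z.
Proof.
  intros Ea Eb Ee eb ba H H'. revert y H.
  induction H' as [p h1 h2 | | K K' s s' HK IHK Hs IHs hs hs']; intros y H.
  - rewrite (N_small a b p y H h1). constructor; ord.
  - rewrite (N_fun a b Ea Eb a y b H (N_base a b)). constructor.
  - destruct (N_lead_inv a b Ea Eb K s y hs H) as (L & r & -> & hL & hr & _).
    apply N_lead_add; auto.
Qed.

(** For an epsilon number [b] this means that [s] is below the next epsilon number, expressed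
    without requiring that number to exist in [U]. *)
Definition no_eps (b s : U) : Prop := forall e, E e -> e <= s -> e <= b.

Lemma no_eps_down b s s' : no_eps b s -> s' <= s -> no_eps b s'.
Proof. intros H h e he hs. apply H; auto. ord. Qed.

(** An exponent equal to [x] would make [x] an epsilon number above [b]. The strict decrease allows
    inductions to descend into exponents. *)
Lemma lead_ex_no_eps b x : no_eps b x -> b < x ->
  exists K r, x = exp K + r /\ r < exp (K + 1) /\ r < x /\ K < x.
Proof.
  intros hx hb. destruct (lead_ex x) as (K & r & e & h1 & h2 & h3). { pose proof (zero_le b). ord. }
  exists K, r. repeat split; auto. destruct h3 as [| ->]; auto. exfalso.
  assert (E x).
  { pose proof (le_add_l (exp x) r). rewrite <- e in H. pose proof (exp_ge x). unfold E. ord. }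
  specialize (hx x H (ule_refl x)). ord.
Qed.

(** Only finitely many parameters below [b] occur in the normal form of [x]; [g] bounds them. *)
Lemma N_exists_near b x : E b -> no_eps b x ->
  exists g, g < b /\ forall e, E e -> g < e -> exists x', N b e x x'.
Proof.
  intros Eb. induction (ult_wf x) as [x _ IH]. intros hx.
  destruct (ule_case x b) as [hbx | hbx].
  { exists x. split; auto. intros e _ he. exists x. constructor; auto. }
  destruct hbx as [hbx | <-].
  2: { exists 0. split; [apply E_pos; auto |]. intros e _ _. exists e. constructor. }
  destruct (lead_ex_no_eps b x hx hbx) as (K & r & e & h1 & h2 & hK).
  destruct (IH K hK) as (g & hg & Hg). { intros e' h h'. apply hx; auto. ord. }
  destruct (IH r h2) as (g' & hg' & Hg'). { intros e' h h'. apply hx; auto. ord. }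
  destruct (max_below b g g' hg hg') as (m & m1 & m2 & m3).
  exists m. split; auto. intros e' he hm. destruct (Hg e' he) as [K'' HK'']; [ord |].
  destruct (Hg' e' he) as [s'' Hs'']; [ord |]. rewrite e. exists (exp K'' + s''). apply N_lead_add; auto.
Qed.

(* An epsilon number between g and b reflects s; [Rup b (s + 1)] amounts to this for all g below b. *)
Definition near (b s g : U) : Prop :=
  exists e s', g < e /\ e < b /\ E e /\ N b e s s' /\ R1eq e s'.

Lemma near_down b s s0 : E b -> no_eps b s -> b <= s0 -> s0 <= s ->
  (forall g, g < b -> near b s g) -> forall g, g < b -> near b s0 g.
Proof.
  intros Eb Hs h1 h2 H g hg.
  destruct (N_exists_near b s0 Eb (no_eps_down _ _ _ Hs h2)) as (g' & hg' & Hg').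
  destruct (max_below b g g' hg hg') as (m & m1 & m2 & m3).
  destruct (H m m1) as (e & s' & k1 & k2 & k3 & k4 & k5).
  destruct (Hg' e k3) as (s0' & k6); [ord |].
  exists e, s0'. repeat split; auto; [ord |]. apply (R1eq_down _ _ s'); auto.
  - apply (N_le_iff b e Eb k3 _ _ _ _ (N_base b e) k6); auto.
  - apply (N_le_iff b e Eb k3 _ _ _ _ k6 k4); auto.
Qed.

(** * Reflection at epsilon numbers *)

Lemma N_E_iff a b x x' : E a -> E b -> N a b x x' -> (E x <-> E x').
Proof. intros Ea Eb H. apply (N_eq_iff a b Ea Eb); auto. apply N_exp; auto. Qed.

(** For a principal [x] that is not an epsilon number, [R1_exp_iff] expresses [R1 x y] through
    order, sums and the last exponent of the exponent, all of which [N] carries over. *)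
Lemma N_R1 a b x x' y y' : E a -> E b -> N a b x x' -> N a b y y' -> a < x -> ~ E x ->
  R1 x y -> R1 x' y'.
Proof.
  intros Ea Eb Hx Hy hx nx r.
  destruct (N_prin a b Ea Eb x x' Hx (R1_prin _ _ r)) as (L & L' & -> & -> & HL).
  assert (nL : L < exp L).
  { apply not_E_lt. intros h. apply nx. unfold E in *. congruence. }
  assert (L0 : 0 < L). { destruct (zero_or_pos L) as [-> |]; auto. pose proof (E_one a Ea). ord. }
  destruct (N_last_inv a b Ea Eb L L' HL L0) as (l & l' & q & q' & -> & -> & hl & hq).
  apply R1_exp_iff in r; auto. destruct r as (r1 & r2). apply R1_exp_iff.
  - apply (N_lt_iff a b Ea Eb _ _ _ _ HL Hx); auto.
  - split.
    + apply (N_lt_iff a b Ea Eb _ _ _ _ Hx Hy); auto.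
    + apply (N_le_iff a b Ea Eb _ _ _ _ Hy (N_add a b Ea Eb _ _ _ _ Hx hq)); auto.
Qed.

(** The embedding is the substitution of a suitable [e] for [b]. The work lies in [<_1], where
    [N_R1] covers only relations from points above [b]. *)
Lemma Rup_of_near b s : E b -> no_eps b s -> b <= s -> R1eq b s ->
  (forall g, g < b -> near b s g) -> Rup b (s + 1).
Proof.
  intros Eb Hs hbs R H. apply Rup_unfold. split; [apply lt_succ; auto |]. intros B HB.
  assert (HB' : forall x, In x B -> x <= s) by (intros; apply lt_succ; auto).
  destruct (list_bound B b (fun x g => forall e, E e -> g < e -> exists x', N b e x x')) as (g0 & hg0 & Hg0).
  { apply E_pos; auto. }
  { intros x g g' h h1 h2 e he h3. apply h; auto. ord. }
  { intros x hx. apply N_exists_near; auto. apply (no_eps_down b s); auto. }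
  destruct (list_R1_bound B b (E_lim b Eb)) as (g1 & hg1 & Hg1).
  destruct (max_below b g0 g1 hg0 hg1) as (m & m1 & m2 & m3).
  destruct (H m m1) as (e & s' & hme & heb & Ee & HNs & Rs).
  destruct (fun_choice _ _ (fun x y => In x B -> N b e x y)) as [h Hh].
  { intros x. destruct (classic (In x B)) as [hx | n]; [| exists x; tauto].
    destruct (Hg0 x hx e Ee) as [x' hx']; [ord |]. eauto. }
  pose proof (N_base b e) as Nb.
  exists h. split; [split; [| split] |].
  - intros x hx. apply (N_below_eps b e x); auto.
  - intros x hx hxb. apply (N_small b e); auto.
  - intros x y z hx hy hz. split; [| split].
    + apply (N_lt_iff b e); auto.
    (* For [x] below [b], the choice of [g1] turns a relation to a point near [b] into one to [b],
       which extends up to [s]. For [x] above [b], [x] is not an epsilon number. For [x = b], both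
       [b] and [e] are related to everything up to [s] and [s']. *)
    + destruct (ule_case x b) as [hxb | [hxb | <-]].
      * assert (ex : h x = x) by (apply (N_small b e); auto). rewrite ex.
        destruct (ule_case y b) as [hyb | hyb].
        { replace (h y) with y; [tauto |]. symmetry. apply (N_small b e); auto. }
        assert (h y < b) by (apply (N_below_eps b e y); auto).
        assert (e <= h y) by (apply (N_le_iff b e Eb Ee _ _ _ _ Nb (Hh y hy)); auto).
        split; intros r.
        -- eapply R1_down; [exact r | | ord]. rewrite <- ex. apply (N_lt_iff b e Eb Ee x _ y); auto.
           apply R1_lt; auto.
        -- assert (R1 x b).
           { apply NNPP. intros n. destruct (Hg1 x hx hxb) as (_ & k). apply (k n (h y)); auto. ord. }
           apply R1eq_R1; [| ord]. eapply R1eq_trans; [right; exact H2 |].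
           eapply R1eq_down; [exact R | auto | auto].
      * assert (nx : ~ E x). { intros k. specialize (Hs x k (HB' x hx)). ord. }
        split; intros r.
        -- apply (N_R1 b e x _ y); auto.
        -- apply (N_R1 e b (h x) _ (h y)); auto using N_sym.
           ++ apply (N_lt_iff b e Eb Ee _ _ _ _ Nb (Hh x hx)); auto.
           ++ rewrite <- (N_E_iff b e x); auto.
      * rewrite (N_fun b e Eb Ee _ _ _ (Hh b hx) Nb). split; intros r; apply R1_lt in r.
        -- apply (R1eq_lt e (h y) s'); auto.
           ++ apply (N_lt_iff b e Eb Ee _ _ _ _ Nb (Hh y hy)); auto.
           ++ apply (N_le_iff b e Eb Ee _ _ _ _ (Hh y hy) HNs); auto.
        -- apply (R1eq_lt b y s); auto.
           apply (N_lt_iff b e Eb Ee _ _ _ _ Nb (Hh y hy)); auto.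
    + apply (N_eq_iff b e); auto. apply N_add; auto.
  - intros x y hx hy. apply (N_eq_iff b e); auto. apply N_exp; auto.
Qed.

(** Induction on [s] supplies the premise [R1eq] of [Rup_of_near]: a finite set below [s] is bounded
    by some [m < s], where [R1eq b m] is known inductively, and [Rup_of_near] at [m] provides the
    embedding. *)
Lemma R1eq_of_near b s : E b -> no_eps b s -> b <= s ->
  (forall g, g < b -> near b s g) -> R1eq b s.
Proof.
  intros Eb. induction (ult_wf s) as [s _ IH]. intros Hs hbs H.
  destruct hbs as [hbs | <-]; [right | left; auto].
  apply R1_unfold. split; auto. intros B HB.
  destruct (list_bound B s (fun x g => x <= g)) as (g & hg & Hg).
  { pose proof (zero_le b). ord. }
  { intros; ord. }
  { intros x hx. exists x. split; auto. apply ule_refl. }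
  destruct (max_below s b g hbs hg) as (m & m1 & m2 & m3).
  assert (hms : m <= s) by (left; auto).
  assert (Hm : no_eps b m) by (apply (no_eps_down b s); auto).
  assert (nm : forall g, g < b -> near b m g) by (apply (near_down b s m); auto).
  assert (r : Rup b (m + 1)) by (apply Rup_of_near; auto).
  apply Rup_unfold in r. destruct r as (_ & r). destruct (r B) as (h & h1 & _); [| eauto].
  intros x hx. apply lt_succ. specialize (Hg x hx). ord.
Qed.

(** If [b = exp x] with [x < b], a map that fixes [x] and preserves powers fixes [b], although it
    has to move [b] below itself. *)
Lemma Rup_E b c : Rup b c -> E b.
Proof.
  intros r. destruct (prin_is_exp b (R1_prin _ _ (Rup_R1 _ _ r))) as [x ->].
  apply Rup_unfold in r. destruct r as (hbc & H).
  destruct (exp_ge x) as [h | h]; [| unfold E; congruence]. exfalso.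
  destruct (H [x; exp x]) as (k & (k1 & k2 & _) & k3). { intros y [<- | [<- | []]]; ord. }
  specialize (k3 x (exp x)). rewrite (k2 x) in k3; simpl; auto.
  specialize (k1 (exp x)). rewrite <- (proj1 (k3 ltac:(simpl; auto) ltac:(simpl; auto)) eq_refl) in k1.
  specialize (k1 ltac:(simpl; auto)). ord.
Qed.

(** * Embeddings on sets of subterms *)

(** On the iterated leading powers, exponents and remainders of [x], an embedding that preserves
    sums and powers is forced, subterm by subterm, to substitute [h b] for [b]. *)
Lemma subterms_exp b x : E b -> no_eps b x ->
  exists Bx, (forall y, In y Bx -> y <= x) /\
  forall B h, incl Bx B -> In b B -> emb B b h -> emb_exp B h -> E (h b) -> N b (h b) x (h x).
Proof.
  intros Eb. induction (ult_wf x) as [x _ IH]. intros hx.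
  destruct (ule_case x b) as [hxb | [hxb | <-]].
  - exists [x]. split. { intros y [<- | []]. apply ule_refl. }
    intros B h hB hb (h1 & h2 & h3) _ _. assert (i : In x B) by (apply hB; simpl; auto).
    destruct (h3 x b b i hb hb) as (k & _). apply k in hxb as k'. rewrite (h2 x i hxb) in *.
    constructor; auto.
  - destruct (lead_ex_no_eps b x hx) as (K & r & e & k1 & k2 & hK); [auto |].
    destruct (IH K hK) as (BK & p1 & p2). { apply (no_eps_down b x); [| left]; auto. }
    destruct (IH r k2) as (Br & p3 & p4). { apply (no_eps_down b x); [| left]; auto. }
    exists (x :: exp K :: K :: r :: BK ++ Br). split.
    { pose proof (le_add_l (exp K) r). rewrite <- e in H.
      intros y [<- | [<- | [<- | [<- | hy]]]]; auto; try (left; auto; fail).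
      - apply ule_refl.
      - apply in_app_iff in hy. destruct hy as [hy | hy]; [specialize (p1 y hy) | specialize (p3 y hy)]; ord. }
    intros B h hB hb H1 H2 he.
    assert (N b (h b) K (h K)).
    { apply (p2 B); auto. intros y hy. apply hB. simpl. rewrite in_app_iff. auto 6. }
    assert (N b (h b) r (h r)).
    { apply (p4 B); auto. intros y hy. apply hB. simpl. rewrite in_app_iff. auto 6. }
    assert (ix : In x B) by (apply hB; simpl; auto).
    assert (ie : In (exp K) B) by (apply hB; simpl; auto).
    assert (ik : In K B) by (apply hB; simpl; auto).
    assert (ir : In r B) by (apply hB; simpl; auto 6).
    destruct H1 as (_ & _ & h3). destruct (h3 (exp K) r x ie ir ix) as (_ & _ & (q & _)).
    rewrite <- q by auto. rewrite <- (proj1 (H2 K (exp K) ik ie) eq_refl), e.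
    apply N_lead_add; auto.
  - exists []. split. { intros y []. } intros. constructor.
Qed.

(** Since [exp b = b] is preserved, the image of [b] is an epsilon number; putting [g] into the test
    set keeps this image above [g]. *)
Lemma near_of_Rup b s : no_eps b s -> b <= s -> Rup b (s + 1) -> forall g, g < b -> near b s g.
Proof.
  intros hs hbs r g hg. pose proof (Rup_E _ _ r) as Eb.
  destruct (subterms_exp b s Eb hs) as (Bs & hBs & HBs).
  pose proof (Rup_R1 _ _ r) as r1.
  apply Rup_unfold in r. destruct r as (_ & H).
  destruct (H (g :: b :: s :: Bs)) as (h & h1 & h2).
  { intros x [<- | [<- | [<- | hx]]]; apply lt_succ; auto; [ord | apply ule_refl]. }
  assert (ig : In g (g :: b :: s :: Bs)) by (simpl; auto).
  assert (ib : In b (g :: b :: s :: Bs)) by (simpl; auto).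
  assert (is : In s (g :: b :: s :: Bs)) by (simpl; auto).
  assert (Eh : E (h b)) by (apply (h2 b b ib ib); exact Eb).
  exists (h b), (h s).
  assert (nn : N b (h b) s (h s)).
  { apply (HBs (g :: b :: s :: Bs)); auto. intros x hx. simpl; auto. }
  destruct h1 as (k1 & k2 & k3).
  repeat split; auto.
  - rewrite <- (k2 g) at 1; auto. apply (k3 g b b); auto.
  - destruct hbs as [hbs | <-]; [right | left; auto].
    apply (k3 b s s); auto. eapply R1_down; [exact r1 | auto |]. left; apply succ_lt.
Qed.

(** A principal [exp y] with [y < exp y] reaches at most [exp y + q] with [q <= y]. The condition
    [1 < e] excludes [exp 0], whose exponent has no last term. *)
Lemma R1_double_E e : 1 < e -> R1 e (e + e) -> E e.
Proof.
  intros h1 r. destruct (prin_is_exp e (R1_prin _ _ r)) as [y ->].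
  destruct (exp_ge y) as [h | h]; [exfalso | unfold E; congruence].
  destruct (zero_or_pos y) as [-> | y0]; [ord |].
  destruct (last_ex y y0) as (l & q & ->). apply R1_exp_iff in r; auto. destruct r as (_ & r).
  apply add_le_cancel in r. pose proof (last_le l q). ord.
Qed.

(* Without preservation of [exp], an embedding can still only increase subterms: [R1 x (x + q)] bounds
   the last exponent of the image of [x = exp (l + exp q)] from below. *)
Lemma subterms_add e s x : E e -> no_eps e x -> x <= s ->
  (forall l q, exp (l + exp q) <= x -> e < exp (l + exp q) -> exp (l + exp q) + q <= s) ->
  exists Bx, (forall y, In y Bx -> y <= s) /\
  forall B h, incl Bx B -> In e B -> emb B e h -> E (h e) ->
    exists x', N e (h e) x x' /\ x' <= h x.
Proof.
  intros Ee. induction (ult_wf x) as [x _ IH]. intros hx hxs Hc.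
  assert (IH' : forall y, y < x -> exists Bx, (forall y, In y Bx -> y <= s) /\
    forall B h, incl Bx B -> In e B -> emb B e h -> E (h e) ->
    exists x', N e (h e) y x' /\ x' <= h y).
  { intros y hy. apply IH; auto.
    - apply (no_eps_down e x); [| left]; auto.
    - ord.
    - intros l q h. apply Hc. ord. }
  clear IH. destruct (ule_case x e) as [hxe | [hxe | <-]].
  - exists [x]. split. { intros y [<- | []]. auto. }
    intros B h hB hb (h1 & h2 & h3) _. assert (i : In x B) by (apply hB; simpl; auto).
    destruct (h3 x e e i hb hb) as (k & _). apply k in hxe as k'. rewrite (h2 x i hxe) in *.
    exists x. split; [constructor; auto | apply ule_refl].
  - destruct (lead_ex_no_eps e x hx) as (K & r & ex & k1 & k2 & hK); [auto |].
    destruct (zero_or_pos r) as [-> | r0].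
    + rewrite add_0_r in ex. subst x.
      destruct (zero_or_pos K) as [-> | K0]. { pose proof (E_one e Ee). ord. }
      destruct (last_ex K K0) as (l & q & eK).
      assert (lK : l < K) by (rewrite eK; apply lt_add_pos, exp_pos).
      assert (qK : q <= K) by (rewrite eK; apply last_le).
      (* [Hc] admits the point [exp K + q] into the test set; the relation from [exp K] to it is
         what forces the image of [exp K] upwards. *)
      assert (hs : exp K + q <= s). { rewrite eK. apply Hc; rewrite <- eK; auto. apply ule_refl. }
      pose proof (exp_lt _ _ lK) as elK.
      destruct (IH' K hK) as (B1 & p1 & P1).
      destruct (IH' l ltac:(ord)) as (B2 & p2 & P2).
      destruct (IH' (exp l) elK) as (B3 & p3 & P3).
      destruct (IH' q ltac:(ord)) as (B4 & p4 & P4).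
      exists (exp K :: K :: l :: exp l :: q :: (exp K + q) :: B1 ++ B2 ++ B3 ++ B4). split.
      { intros y [<- | [<- | [<- | [<- | [<- | [<- | hy]]]]]]; auto; try ord.
        rewrite !in_app_iff in hy. destruct hy as [hy | [hy | [hy | hy]]]; auto. }
      intros B h hB hb H2 he.
      destruct (P1 B h) as (K' & NK & hK'); auto.
      { intros y hy. apply hB. simpl. rewrite !in_app_iff. tauto. }
      destruct (P2 B h) as (l' & Nl & hl'); auto.
      { intros y hy. apply hB. simpl. rewrite !in_app_iff. tauto. }
      destruct (P3 B h) as (w & Nw & hw); auto.
      { intros y hy. apply hB. simpl. rewrite !in_app_iff. tauto. }
      destruct (P4 B h) as (q' & Nq & hq'); auto.
      { intros y hy. apply hB. simpl. rewrite !in_app_iff. tauto. }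
      rewrite (N_fun e (h e) Ee he _ _ _ Nw (N_exp e (h e) Ee he _ _ Nl)) in hw.
      exists (exp K'). split; [apply N_exp; auto |].
      rewrite eK in NK. pose proof (N_fun e (h e) Ee he _ _ _ NK
        (N_add e (h e) Ee he _ _ _ _ Nl (N_exp e (h e) Ee he _ _ Nq))) as eK'.
      assert (i1 : In (exp K) B) by (apply hB; simpl; tauto).
      assert (i2 : In (exp l) B) by (apply hB; simpl; tauto).
      assert (i3 : In q B) by (apply hB; simpl; tauto).
      assert (i4 : In (exp K + q) B) by (apply hB; simpl; tauto).
      assert (i5 : In K B) by (apply hB; simpl; tauto).
      destruct H2 as (_ & _ & h3).
      (* [exp K] absorbs [exp l], so its image absorbs [h (exp l)] and with it [exp l']. *)
      assert (big : exp (l' + 1) <= h (exp K)).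
      { apply exp_absorb_ge. apply ule_antisym; [| apply le_add_r].
        destruct (h3 (exp l) (exp K) (exp K) i2 i1 i1) as (_ & _ & (k & _)).
        rewrite <- k at 2 by (apply exp_absorb; auto). apply add_le_l; auto. }
      (* For [q = 0] the exponent is [l + 1], and [big] is already the claim. *)
      destruct (zero_or_pos q) as [-> | q0].
      { rewrite (N_fun e (h e) Ee he _ _ _ Nq (N_zero e (h e) Ee he)) in eK'. rewrite eK'. auto. }
      assert (q0' : 0 < q') by (apply (N_lt_iff e (h e) Ee he _ _ _ _ (N_zero e (h e) Ee he) Nq); auto).
      assert (r : R1 (h (exp K)) (h (exp K) + q')).
      { eapply R1_down; [| apply lt_add_pos; auto | apply add_le_r; exact hq'].
        destruct (h3 (exp K) q (exp K + q) i1 i3 i4) as (_ & _ & (k & _)).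
        rewrite k by auto. apply (h3 (exp K) (exp K + q) (exp K + q)); auto.
        rewrite eK. apply R1_exp_last; auto. apply ule_refl. }
      destruct (prin_is_exp _ (R1_prin _ _ r)) as [y ey]. rewrite ey in *.
      (* If the image [exp y] is not an epsilon number, the last exponent [q1] of [y] is at least
         [q'], so [y] is at least [l' + exp q']. Otherwise [y = exp y] lies above the image of [K],
         and so above [K']. *)
      destruct (exp_ge y) as [hy | hy].
      * apply exp_le. apply exp_le_cancel, le_succ in big.
        destruct (sub_pos_ex _ _ big) as (v & v0 & ->).
        destruct (last_ex v v0) as (v1 & q1 & ->). rewrite <- add_assoc in r, hy.
        apply R1_exp_iff in r; auto. destruct r as (_ & r). apply add_le_cancel in r.
        rewrite eK'. apply add_le_r. apply exp_le in r.
        pose proof (le_add_r v1 (exp q1)). ord.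
      * apply exp_le. rewrite hy, <- ey. eapply ule_trans; [exact hK' |]. left.
        apply (h3 K (exp K) K); auto.
    + assert (ekx : exp K < x). { rewrite ex. apply lt_add_pos; auto. }
      destruct (IH' (exp K) ekx) as (B1 & p1 & P1). destruct (IH' r k2) as (B2 & p2 & P2).
      exists (x :: exp K :: r :: B1 ++ B2). split.
      { intros y [<- | [<- | [<- | hy]]]; auto; try ord.
        rewrite in_app_iff in hy. destruct hy as [hy | hy]; auto. }
      intros B h hB hb H2 he.
      destruct (P1 B h) as (x1 & N1 & h1); auto.
      { intros y hy. apply hB. simpl. rewrite !in_app_iff. tauto. }
      destruct (P2 B h) as (x2 & N2 & h2); auto.
      { intros y hy. apply hB. simpl. rewrite !in_app_iff. tauto. }
      exists (x1 + x2). split. { rewrite ex. apply N_add; auto. }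
      destruct H2 as (_ & _ & h3). destruct (h3 (exp K) r x) as (_ & _ & (k & _)); try (apply hB; simpl; tauto).
      rewrite <- k by auto. apply add_le_mono; auto.
  - exists []. split. { intros y []. } intros B h _ _ _ _. exists (h e). split; [constructor | apply ule_refl].
Qed.

(* y dominates [p + d p], where p is the leading principal part of y, in the notation of the paper *)
Definition full (y : U) : Prop :=
  exists l q r, y = exp (l + exp q) + r /\ r < exp (l + exp q + 1) /\ exp (l + exp q) + q <= y.

(** When the leading power of [s] is [e], its exponent [e = exp e] has last exponent [e], and
    fullness gives [e + e]. A larger leading power exceeds [e + e] because it is principal. *)
Lemma full_double e s : E e -> full s -> e <= s -> e + e <= s.
Proof.
  intros Ee (l & q & r & es & hr & hq) hes.
  destruct (ult_total (l + exp q) e) as [h | [h | h]].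
  - pose proof (lead_below _ _ _ hr h) as k. unfold E in Ee. rewrite Ee in k. ord.
  - assert (q = e). { apply (last_uniq l q 0 e). rewrite h, add_0_l. auto. }
    subst q. rewrite h in hq. unfold E in Ee. rewrite Ee in hq. auto.
  - apply exp_lt in h. unfold E in Ee. rewrite Ee in h.
    assert (e + e < exp (l + exp q)) by (apply exp_closed; auto).
    pose proof (le_add_l (exp (l + exp q)) q). ord.
Qed.

(** The inequality [s' <= h s] from [subterms_add] suffices, since [h e <_1 h s] restricts downwards
    to [s']. *)
Lemma near_of_R1 e s : E e -> no_eps e s -> e <= s -> full s -> R1 e (s + 1) ->
  forall g, g < e -> near e s g.
Proof.
  intros Ee hs hes hf r g hg. pose proof (full_double e s Ee hf hes) as hee.
  destruct (subterms_add e s s Ee hs (ule_refl s)) as (Bs & hBs & HBs).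
  (* At the leading power the required room is fullness itself; for a smaller power the sum stays
     below the leading power. *)
  { intros l q h1 _. destruct hf as (l0 & q0 & r0 & es & hr & hq).
    destruct (ult_total (l + exp q) (l0 + exp q0)) as [h | [h | h]].
    - pose proof (last_le l q) as k1. pose proof (exp_ge (l + exp q)) as k2.
      pose proof (exp_lt _ _ h) as k3.
      assert (exp (l + exp q) + q < exp (l0 + exp q0)) by (apply exp_closed; [auto | ord]).
      pose proof (le_add_l (exp (l0 + exp q0)) q0). ord.
    - rewrite h. replace q with q0; auto. symmetry. eapply last_uniq; eauto.
    - pose proof (lead_below _ _ _ hr h). ord. }
  pose proof r as r1. apply R1_unfold in r. destruct r as (_ & H).
  pose proof (E_one e Ee) as e1.
  (* The points [1] and [e + e] are included so that [R1_double_E] shows the image of [e] to be an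
     epsilon number. *)
  destruct (H (g :: 1 :: e :: (e + e) :: s :: Bs)) as (h & h1).
  { intros x [<- | [<- | [<- | [<- | [<- | hx]]]]]; apply lt_succ; auto; ord. }
  pose proof h1 as (k1 & k2 & k3).
  remember (g :: 1 :: e :: (e + e) :: s :: Bs) as B eqn:EB.
  assert (ig : In g B) by (subst B; simpl; tauto).
  assert (i1 : In 1 B) by (subst B; simpl; tauto).
  assert (ie : In e B) by (subst B; simpl; tauto).
  assert (iee : In (e + e) B) by (subst B; simpl; tauto).
  assert (is : In s B) by (subst B; simpl; tauto).
  assert (Eh : E (h e)).
  { apply R1_double_E.
    - rewrite <- (k2 1) at 1; auto. apply (k3 1 e e); auto.
    - destruct (k3 e e (e + e)) as (_ & _ & (k & _)); auto. rewrite k by auto.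
      apply (k3 e (e + e) e); auto. apply R1_E_double; auto. }
  destruct (HBs B h) as (s' & Ns & hs'); auto.
  { intros x hx. subst B. simpl; tauto. }
  exists (h e), s'. repeat split; auto.
  - rewrite <- (k2 g) at 1; auto. apply (k3 g e e); auto.
  - apply (R1eq_down _ _ (h s)); auto.
    + right. apply (k3 e s e); auto. eapply R1_down; [exact r1 | | left; apply succ_lt].
      pose proof (lt_add_pos e e (E_pos e Ee)). ord.
    + apply (N_le_iff e (h e) Ee Eh _ _ _ _ (N_base e (h e)) Ns); auto.
Qed.

(** * Normal forms and the relational definitions *)

Lemma le_iff (x y : U) : le O lt x y <-> x <= y.
Proof.
  unfold le, ule. split; (intros [h | h]; [left; exact h | right]); [apply val_inj; auto | congruence].
Qed.
Lemma lift_lt (x : O) (y : U) : lt x y -> exists u : U, x = u.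
Proof. intros h. apply lift. eapply lt_trans; [exact h | apply val_lt]. Qed.
Lemma lift_le (x : O) (y : U) : le O lt x y -> exists u : U, x = u.
Proof. intros [h | ->]; [eapply lift_lt; eauto | eauto]. Qed.
Lemma zero_iff (x : U) : zero O lt x <-> x = 0.
Proof.
  split.
  - intros h. destruct (zero_or_pos x) as [| p]; auto. elim (h _ p).
  - intros -> z hz. destruct (lift_lt z _ hz) as [u ->]. elim (not_lt_zero _ hz).
Qed.
Lemma zero_val (x : O) : zero O lt x -> x = val 0.
Proof.
  intros h. destruct (lt_total x (val 0)) as [k | [k | k]]; auto.
  - destruct (lift_lt x _ k) as [u ->]. elim (not_lt_zero _ k).
  - elim (h _ k).
Qed.
Lemma pos_iff (x : U) : pos O lt x <-> 0 < x.
Proof.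
  split.
  - intros (w & hw). destruct (lift_lt w _ hw) as [u ->]. pose proof (zero_le u). change (u < x) in hw. ord.
  - intros h. exists (val 0). exact h.
Qed.
Lemma Eps_iff (x : U) : Eps O lt x <-> E x.
Proof. apply omexp_iff. Qed.
Lemma succ_val (x : U) y : succ O lt x y <-> y = val (x + 1).
Proof.
  split.
  - intros (h1 & h2). assert (k : le O lt y (x + 1)) by (apply h2, succ_lt).
    destruct (lift_le _ _ k) as [u ->]. f_equal. apply ule_antisym; [apply le_iff; auto |].
    apply le_succ. exact h1.
  - intros ->. split; [apply succ_lt |]. intros z hz.
    destruct (lt_total (val (x + 1)) z) as [h | [h | h]]; unfold le; auto.
    destruct (lift_lt _ _ h) as [u ->]. exfalso. change (x < u) in hz. change (u < x + 1) in h.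
    apply le_succ in hz. ord.
Qed.
Lemma islim_iff (x : U) : islim O lt x <-> lim x.
Proof.
  unfold islim, lim. rewrite pos_iff. split; intros (h & H); split; auto; intros z hz.
  - destruct (H z hz) as (w & h1 & h2). destruct (lift_lt _ _ h2) as [u ->].
    change (z < u) in h1. change (u < x) in h2. apply le_succ in h1. ord.
  - destruct (lift_lt _ _ hz) as [u ->]. exists (u + 1). split; [apply succ_lt | apply H; auto].
Qed.
Lemma LimP_iff (X : O -> Prop) (r : U) : LimP O lt X r <-> Lim (fun x => X (val x)) r.
Proof.
  unfold LimP, Lim. rewrite pos_iff. split; intros (h & H); split; auto; intros g hg.
  - destruct (H g hg) as (x & h1 & h2 & h3). destruct (lift_lt _ _ h3) as [u ->]. eauto.
  - destruct (lift_lt _ _ hg) as [u ->]. destruct (H u hg) as (x & h1 & h2 & h3). eauto.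
Qed.

Lemma nmul_val (y : U) n a : nmul O lt y n a <-> a = val (mul y n).
Proof.
  revert a. induction n; simpl; intros a.
  - split; [apply zero_val | intros ->; apply zero_iff; auto].
  - split.
    + intros (b & h1 & h2). apply IHn in h1. subst b. apply uadd_val; auto.
    + intros ->. exists (val (mul y n)). split; [apply IHn; auto | apply uadd_val; auto].
Qed.

Fixpoint usum (s : list (U * nat)) : U :=
  match s with [] => 0 | (y, l) :: s => mul y l + usum s end.

Definition upcast (s : list (U * nat)) : list (O * nat) := map (fun p => (val (fst p), snd p)) s.

Lemma lsum_val s z : lsum O lt (upcast s) z <-> z = val (usum s).
Proof.
  revert z. induction s as [| (y, l) s IH]; simpl; intros z.
  - split; [apply zero_val | intros ->; apply zero_iff; auto].
  - split.
    + intros (a & b & h1 & h2 & h3). apply nmul_val in h1. apply IH in h2. subst a b.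
      apply uadd_val; auto.
    + intros ->. exists (val (mul y l)), (val (usum s)). split; [apply nmul_val; auto |].
      split; [apply IH; auto | apply uadd_val; auto].
Qed.

Lemma usum_app s s' : usum (s ++ s') = usum s + usum s'.
Proof.
  induction s as [| (y, l) s IH]; simpl. { rewrite add_0_l; auto. } rewrite IH, add_assoc; auto.
Qed.

(** For principal bases with positive coefficients, bounding the tail sum by the base amounts to
    [decr]; this form hands the bound on the remainder directly to inductions. *)
Fixpoint normal (s : list (U * nat)) : Prop :=
  match s with [] => True | (y, l) :: s => prin y /\ (0 < l)%nat /\ usum s < y /\ normal s end.

Lemma mul_lt_prin p y n : prin p -> y < p -> mul y n < p.
Proof.
  intros hp h. induction n; simpl; [apply prin_pos; auto |]. apply hp; auto.
Qed.

Lemma le_mul y n : (0 < n)%nat -> y <= mul y n.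
Proof. intros h. destruct n; [lia |]. apply le_add_r. Qed.

Lemma cnf_val (x : U) s : cnf O lt x (upcast s) <-> x = usum s /\ normal s.
Proof.
  unfold cnf. rewrite lsum_val.
  assert (A : (forall p, In p (upcast s) -> addPrin O lt (fst p) /\ (0 < snd p)%nat) /\ decr O lt (upcast s) <-> normal s).
  { induction s as [| (y, l) s IH]; simpl. { split; auto. intros; split; auto. intros p []. }
    split.
    - intros (h1 & h2).
      assert (hs : normal s).
      { apply IH. split; auto. destruct s as [| (z, k) s]; simpl in *; auto. apply h2. }
      destruct (h1 (val y, l)) as (h3 & h4); auto. simpl in h3, h4. apply prin_val in h3.
      split; [auto | split; [auto | split; [| auto]]].
      destruct s as [| (z, k) s]; simpl in *; [apply prin_pos; auto |].
      destruct h2 as (h2 & _), hs as (k1 & k2 & k3 & k4). change (z < y) in h2.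
      apply h3; [apply mul_lt_prin; auto | ord].
    - intros (h1 & h2 & h3 & h4). apply IH in h4 as h5. destruct h5 as (h5 & h6). split.
      + intros p [<- | hp]; auto. simpl. split; auto. apply prin_val; auto.
      + destruct s as [| (z, k) s]; simpl in *; auto. split; auto.
        destruct h4 as (_ & h4 & _). pose proof (le_mul z k h4).
        pose proof (le_add_l (mul z k) (usum s)). change (z < y). ord. }
  rewrite <- A. split.
  - intros (h1 & h2 & h3). apply val_inj in h3. auto.
  - intros (-> & h1 & h2). auto.
Qed.

(** Coefficients must be positive: a base with coefficient zero leaves no trace in the sum and could
    lie outside [U]. *)
Lemma lsum_lift s (z : U) : (forall p, In p s -> (0 < snd p)%nat) -> lsum O lt s z -> exists s', s = upcast s'.
Proof.
  revert z. induction s as [| (y, l) s IH]; intros z hs H. { exists []; auto. }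
  destruct H as (a & b & h1 & h2 & h3). destruct (add_val _ _ _ h3) as (a' & b' & -> & -> & _).
  destruct (IH b') as (s' & ->); auto. { intros; apply hs; simpl; auto. }
  specialize (hs (y, l) (or_introl eq_refl)). simpl in hs. destruct l; [lia |].
  destruct h1 as (c & _ & h4). destruct (add_val _ _ _ h4) as (_ & y' & _ & -> & _).
  exists ((y', S l) :: s'). auto.
Qed.

Lemma cnf_lift (x : U) s : cnf O lt x s -> exists s', s = upcast s' /\ x = usum s' /\ normal s'.
Proof.
  intros H. destruct (lsum_lift s x) as (s' & ->); [intros p hp; apply H; auto | apply H |].
  apply cnf_val in H. eauto.
Qed.

Lemma cnf_ex x : exists s, x = usum s /\ normal s.
Proof.
  induction (ult_wf x) as [x _ IH]. destruct (zero_or_pos x) as [-> | x0]. { exists []. simpl; auto. }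
  destruct (lead_ex x x0) as (K & r & e & h1 & h2 & _).
  destruct (IH r h2) as (s & -> & hs). destruct s as [| (y, l) s].
  - exists [(exp K, 1%nat)]. simpl in *. rewrite add_0_l. repeat split; auto using exp_pos.
    + apply prin_exp.
    + apply prin_exp.
  - simpl in hs. destruct hs as (k1 & k2 & k3 & k4). destruct (prin_is_exp y k1) as [L ->].
    assert (hL : L < K + 1).
    { apply exp_lt_cancel. pose proof (le_mul (exp L) l k2). simpl in h1.
      pose proof (le_add_l (mul (exp L) l) (usum s)). ord. }
    apply lt_succ in hL. destruct hL as [hL | ->].
    + exists ((exp K, 1%nat) :: (exp L, l) :: s). apply exp_lt in hL as hL'. split.
      { change (x = mul (exp K) 1%nat + usum ((exp L, l) :: s)). rewrite mul_1; auto. }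
      split; [apply prin_exp | split; [lia | split; [| simpl; auto]]].
      simpl. apply exp_closed; [apply mul_lt_prin; auto; apply prin_exp | ord].
    + exists ((exp K, S l) :: s). split.
      { rewrite e. cbn [usum]. rewrite mul_S_l, add_assoc. auto. }
      simpl. split; [auto | split; [lia | auto]].
Qed.

Lemma cnf_last s : normal s -> s <> [] -> exists s' q n, s = s' ++ [(exp q, S n)] /\
  usum s = usum (s' ++ [(exp q, n)]) + exp q.
Proof.
  intros h n. destruct (exists_last n) as (s' & (y, l) & ->).
  assert (hy : prin y /\ (0 < l)%nat).
  { clear n. induction s' as [| (z, k) s' IH]; simpl in h; [tauto |]. apply IH, h. }
  destruct hy as (h1 & h2). destruct (prin_is_exp y h1) as [q ->]. destruct l as [| l]; [lia |].
  exists s', q, l. split; auto. rewrite !usum_app. simpl. rewrite !add_0_r, !add_assoc. auto.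
Qed.

Lemma cnf_head y l s : normal ((y, l) :: s) -> exists K r, y = exp K /\ usum ((y, l) :: s) = exp K + r /\ r < exp (K + 1).
Proof.
  intros (h1 & h2 & h3 & h4). destruct (prin_is_exp y h1) as [K ->]. destruct l as [| l]; [lia |].
  exists K, (mul (exp K) l + usum s). split; auto. split.
  - cbn [usum]. rewrite mul_S_l, add_assoc; auto.
  - apply exp_closed; [apply mul_lt_exp |]. pose proof (exp_lt _ _ (succ_lt K)). ord.
Qed.

Lemma nontriv_iff (s : list (U * nat)) : normal s -> s <> [] -> nontriv O (upcast s) \/ exists K, s = [(exp K, 1%nat)].
Proof.
  intros h n. destruct s as [| (y, l) [| p s]]; [tauto | | left; left; simpl; lia].
  destruct h as (h1 & h2 & _). destruct (prin_is_exp y h1) as [K ->].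
  destruct l as [| [| l]]; [lia | right; eauto |]. left. right. simpl. exists (val (exp K)), (S (S l)).
  split; auto. lia.
Qed.

(** This strict descent justifies recursion on components for [Ep] and for substitution; a single
    power with coefficient one is its own component. *)
Lemma nontriv_lt (s : list (U * nat)) y l : normal s -> nontriv O (upcast s) -> In (y, l) s -> y < usum s.
Proof.
  assert (A : forall s y l, normal s -> In (y, l) s -> y <= usum s).
  { clear s y l. induction s as [| (z, k) s IH]; intros y l h []; simpl in h.
    - inversion H; subst. simpl. pose proof (le_mul y l ltac:(tauto)).
      pose proof (le_add_l (mul y l) (usum s)). ord.
    - assert (y <= usum s) by (eapply IH; [apply h | eauto]). simpl.
      pose proof (le_add_r (mul z k) (usum s)). ord. }
  intros h hn hy. destruct s as [| (z, k) s]; [destruct hy |].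
  destruct h as (h1 & h2 & h3 & h4). simpl. destruct hy as [e | hy].
  - inversion e; subst. pose proof (le_mul y l h2). destruct s as [| (z, k) s].
    + destruct hn as [hn | (L & n & hn & hn2)]; [simpl in hn; lia |].
      simpl in hn. inversion hn; subst. simpl. rewrite add_0_r. destruct n as [| n]; [lia |].
      simpl. pose proof (le_mul y n ltac:(lia)). pose proof (lt_add_pos (mul y n) y (prin_pos y h1)). ord.
    + apply prin_pos in h1. assert (0 < usum ((z, k) :: s)).
      { destruct h4 as (k1 & k2 & k3 & k4). simpl. apply prin_pos in k1. pose proof (le_mul z k k2).
        pose proof (le_add_l (mul z k) (usum s)). ord. }
      pose proof (lt_add_pos (mul y l) _ H0). ord.
  - pose proof (A s y l h4 hy). pose proof (le_mul z k h2). pose proof (le_add_l (mul z k) (usum s)). ord.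
Qed.

Lemma in_upcast (s : list (U * nat)) L l : In (L, l) (upcast s) -> exists y, L = val y /\ In (y, l) s.
Proof.
  intros h. apply in_map_iff in h. destruct h as ((y, k) & e & h). inversion e; subst. eauto.
Qed.

Lemma upcast_app s s' : upcast (s ++ s') = upcast s ++ upcast s'.
Proof. apply map_app. Qed.

(** * [Ep] and substitution in terms of [N] *)

Lemma N_mul_inv a b K n r x' : E a -> E b -> r < exp K -> N a b (mul (exp K) n + r) x' ->
  ((0 < n)%nat -> exists K', N a b (exp K) K') /\ exists r', N a b r r'.
Proof.
  intros Ea Eb hr. revert x'. induction n as [| n IH]; intros x' H.
  - simpl in H. rewrite add_0_l in H. split; [lia | eauto].
  - rewrite mul_S_l, add_assoc in H. apply N_lead_inv in H; auto.
    + destruct H as (K' & s' & _ & h1 & h2 & _). destruct (IH _ h2) as (_ & h3). split; auto.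
      intros _. exists (exp K'). apply N_exp; auto.
    + apply exp_closed; [apply mul_lt_exp |]. pose proof (exp_lt _ _ (succ_lt K)). ord.
Qed.

Lemma N_component a b s x' y l : E a -> E b -> normal s -> N a b (usum s) x' -> In (y, l) s ->
  exists y', N a b y y'.
Proof.
  intros Ea Eb. revert x'. induction s as [| (z, k) s IH]; intros x' h H hy; [destruct hy |].
  destruct h as (h1 & h2 & h3 & h4). destruct (prin_is_exp z h1) as [K ->].
  destruct (N_mul_inv a b K k _ x' Ea Eb h3 H) as (k1 & r' & k2).
  destruct hy as [e | hy]; [inversion e; subst; auto | eauto].
Qed.

Lemma N_usum a b s : E a -> E b -> (forall y l, In (y, l) s -> exists y', N a b y y') ->
  exists x', N a b (usum s) x'.
Proof.
  intros Ea Eb. induction s as [| (y, l) s IH]; intros H; simpl. { exists 0. apply N_zero; auto. }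
  destruct IH as [x' hx]. { intros z k h. eapply H. simpl; eauto. }
  destruct (H y l) as [y' hy]; [simpl; auto |]. exists (mul y' l + x').
  apply N_add; auto. apply N_mul; auto.
Qed.

(** Together with [N_of_InEp]: for [x] below the next epsilon number after [a], the elements of
    [Ep(x)] below [a] all lie below [b] iff [N a b x x'] for some [x']. *)
Lemma InEp_N a b (x : U) x' e : E a -> E b -> InEp O lt e x -> N a b x x' ->
  exists u : U, e = val u /\ E u /\ u <= x /\ (u < a -> u < b).
Proof.
  intros Ea Eb. remember (val x) as x0 eqn:Ex. intros H. revert x x' Ex.
  induction H as [he | x0 s L l hn hs hnt hin H IH | x0 L hn hL H IH]; intros x x' -> Hx.
  - exists x. split; auto. split; [apply Eps_iff; auto |]. split; [apply ule_refl |]. apply (N_small_lt a b Ea Eb x x'); auto.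
  - destruct (cnf_lift _ _ hs) as (s' & -> & -> & hok). destruct (in_upcast _ _ _ hin) as (y & -> & hy).
    destruct (N_component a b s' x' y l Ea Eb hok Hx hy) as [y' hy'].
    destruct (IH y y' eq_refl hy') as (u & h1 & h2 & h3 & h4). exists u. repeat split; auto.
    pose proof (nontriv_lt s' y l hok hnt hy). ord.
  - destruct (omexp_val _ _ hL) as (y & -> & ->). destruct (N_exp_inv a b Ea Eb y x' Hx) as (y' & _ & hy).
    destruct (IH y y' eq_refl hy) as (u & h1 & h2 & h3 & h4). exists u. repeat split; auto.
    pose proof (exp_ge y). ord.
Qed.

Lemma cnf_cases x : x = 0 \/ E x \/ (~ E x /\ exists K, x = exp K /\ K < x) \/
  (~ E x /\ exists s, x = usum s /\ normal s /\ nontriv O (upcast s)).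
Proof.
  destruct (zero_or_pos x) as [| x0]; auto. right. destruct (classic (E x)) as [| n]; auto. right.
  destruct (cnf_ex x) as (s & e & hs). destruct (nontriv_iff s hs) as [h | (K & ->)].
  - intros ->. simpl in e. ord.
  - right. eauto 6.
  - left. split; auto. simpl in e. rewrite add_0_l, add_0_r in e. exists K. split; auto.
    rewrite e. apply not_E_lt. intros h. apply n. unfold E in *. congruence.
Qed.

Lemma N_of_InEp a b x : E a -> E b -> no_eps a x ->
  (forall e : U, InEp O lt e x -> e < a -> e < b) -> exists x', N a b x x'.
Proof.
  intros Ea Eb. induction (ult_wf x) as [x _ IH]. intros hx H.
  destruct (cnf_cases x) as [-> | [h | [(n & K & e & h) | (n & s & e & h1 & h2)]]].
  - exists 0. apply N_zero; auto.
  - destruct (hx x h (ule_refl x)) as [h' | ->]; [| exists b; constructor].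
    exists x. constructor; auto. apply H; auto. apply ep_self. apply Eps_iff; auto.
  - destruct (IH K h) as [K' hK].
    + apply (no_eps_down a x); [| left]; auto.
    + intros e' h1 h2. apply H; auto. apply ep_pow with (val K); auto; [rewrite Eps_iff; auto |].
      apply omexp_iff; auto.
    + subst x. exists (exp K'). apply N_exp; auto.
  - subst x. apply N_usum; auto. intros y l hy. pose proof (nontriv_lt s y l h1 h2 hy) as hl.
    apply IH; auto.
    + eapply no_eps_down; [exact hx | left; auto].
    + intros e' h3 h4. apply H; auto. apply ep_sum with (upcast s) (val y) l; auto; [rewrite Eps_iff; auto | |].
      * apply cnf_val; auto.
      * apply in_map_iff. exists (y, l). auto.
Qed.

Lemma N_combine a b (s : list (U * nat)) (ys : list O) (d : U) : E a -> E b ->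
  length ys = length s ->
  (forall i, (i < length s)%nat -> exists y', N a b (fst (nth i s (d, 0%nat))) y' /\ nth i ys (val d) = val y') ->
  exists s', combine ys (map snd s) = upcast s' /\ N a b (usum s) (usum s').
Proof.
  intros Ea Eb. revert ys. induction s as [| (y, l) s IH]; intros [| y0 ys] hl H; simpl in hl; try discriminate.
  - exists []. split; auto. apply N_zero; auto.
  - injection hl as hl. destruct (IH ys hl) as (s' & h1 & h2).
    { intros i hi. apply (H (S i)). simpl. lia. }
    destruct (H 0%nat) as (y' & h3 & h4). { simpl; lia. } simpl in h3, h4. subst y0.
    exists ((y', l) :: s'). simpl. split; [f_equal; auto |]. apply N_add; auto. apply N_mul; auto.
Qed.

Lemma map_snd_upcast s : map snd (upcast s) = map snd s.
Proof. unfold upcast. rewrite map_map. auto. Qed.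

Lemma nth_upcast i s (d : U) : nth i (upcast s) (val d, 0%nat) = (val (fst (nth i s (d, 0%nat))), snd (nth i s (d, 0%nat))).
Proof. apply (map_nth (fun p => (val (fst p), snd p)) s (d, 0%nat) i). Qed.

Lemma length_upcast s : length (upcast s) = length s.
Proof. apply length_map. Qed.

(** Wherever [N] has a value, the relation [subst] can take no other; [subst_of_N] shows that it
    takes this one. *)
Lemma subst_N (a b x : U) x' y : E a -> E b -> subst O lt a b x y -> N a b x x' -> y = val x'.
Proof.
  intros Ea Eb. remember (val x) as x0 eqn:Ex. intros H. revert x x' Ex.
  induction H as [x0 hz | x0 he hne | | x0 s ys y hn hs hnt hlen Hi IH hy | x0 L L' y hn hL H IH hy];
    intros x x' ex Hx.
  - subst x0. apply zero_iff in hz. subst x. rewrite (N_fun a b Ea Eb 0 x' 0); auto. apply N_zero; auto.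
  - subst x0. apply Eps_iff in he. pose proof (N_E a b Ea x x' Hx he) as [h | ->]; [| tauto].
    rewrite (N_small a b x x'); auto.
  - apply val_inj in ex. subst x. rewrite (N_fun a b Ea Eb a x' b); auto. constructor.
  - subst x0. destruct (cnf_lift _ _ hs) as (s' & -> & -> & hok).
    rewrite length_upcast in *. destruct (N_combine a b s' ys (usum s')) as (s'' & h1 & h2); auto.
    { intros i hi. destruct (nth i s' (usum s', 0%nat)) as (z, k) eqn:ez.
      assert (hin : In (z, k) s') by (rewrite <- ez; apply nth_In; auto).
      destruct (N_component a b s' x' z k Ea Eb hok Hx hin) as [z' hz]. exists z'. split; auto.
      specialize (IH i hi). rewrite nth_upcast, ez in IH. simpl in IH. eapply IH; auto. }
    rewrite map_snd_upcast, h1, lsum_val in hy. subst y. f_equal. apply (N_fun a b Ea Eb (usum s')); auto.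
  - subst x0. destruct (omexp_val _ _ hL) as (K & -> & ->).
    destruct (N_exp_inv a b Ea Eb K x' Hx) as (K' & -> & hK). specialize (IH K K' eq_refl hK). subst L'.
    apply uexp_val; auto.
Qed.

Lemma subst_of_N (a b x : U) x' : E a -> E b -> N a b x x' -> subst O lt a b x x'.
Proof.
  intros Ea Eb. revert x'. induction (ult_wf x) as [x _ IH]. intros x' Hx.
  destruct (cnf_cases x) as [-> | [h | [(n & K & e & h) | (n & s & e & h1 & h2)]]].
  - rewrite (N_fun a b Ea Eb 0 x' 0); auto. { apply sb_zero. apply zero_iff; auto. } apply N_zero; auto.
  - destruct (N_E a b Ea x x' Hx h) as [h' | ->].
    + rewrite (N_small a b x x'); auto. apply sb_eps; [apply Eps_iff; auto |].
      intros e. apply val_inj in e. ord.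
    + rewrite (N_fun a b Ea Eb a x' b); auto; constructor.
  - subst x. destruct (N_exp_inv a b Ea Eb K x' Hx) as (K' & -> & hK).
    apply sb_pow with (val K) (val K'); try (apply omexp_iff; auto); [rewrite Eps_iff; auto |].
    apply IH; auto.
  - subst x.
    (* A total choice of [N]-images, with arbitrary values outside the domain of [N]. *)
    destruct (fun_choice _ _ (fun (y y' : U) => (exists z, N a b y z) -> N a b y y')) as [f Hf].
    { intros y. destruct (classic (exists z, N a b y z)) as [[z hz] | k]; [eauto | exists y; tauto]. }
    assert (Hc : forall i, (i < length s)%nat -> In (nth i s (usum s, 0%nat)) s) by (intros; apply nth_In; auto).
    assert (HN : forall i, (i < length s)%nat -> N a b (fst (nth i s (usum s, 0%nat))) (f (fst (nth i s (usum s, 0%nat))))).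
    { intros i hi. apply Hf. specialize (Hc i hi). destruct (nth i s (usum s, 0%nat)) as (z, k).
      apply (N_component a b s x' z k); auto. }
    set (ys := map (fun p => val (f (fst p))) s).
    assert (Hys : forall i d, (i < length s)%nat -> nth i ys (val d) = val (f (fst (nth i s (usum s, 0%nat))))).
    { intros i d hi. rewrite (nth_indep ys _ (val (f (fst (usum s, 0%nat))))).
      - apply (map_nth (fun p => val (f (fst p))) s (usum s, 0%nat)).
      - unfold ys. rewrite length_map. auto. }
    destruct (N_combine a b s ys (usum s)) as (s'' & h3 & h4); auto.
    { unfold ys. apply length_map. }
    { intros i hi. eexists. split; [apply HN; auto |]. apply Hys; auto. }
    apply sb_sum with (upcast s) ys; auto.
    + rewrite Eps_iff; auto.
    + apply cnf_val; auto.
    + unfold ys. rewrite length_map, length_upcast; auto.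
    + intros i hi. rewrite length_upcast in hi. rewrite nth_upcast, Hys; auto. simpl. apply IH; auto.
      specialize (Hc i hi). destruct (nth i s (usum s, 0%nat)) as (z, k) eqn:ez. simpl.
      apply (nontriv_lt s z k); auto.
    + rewrite map_snd_upcast, h3, lsum_val. f_equal. apply (N_fun a b Ea Eb (usum s)); auto.
Qed.

(** For use before [b] is known to be an epsilon number, when [N] is not yet available. The value of
    [x] dominates the value of its leading component or of its exponent, which is again at least
    [a]. *)
Lemma subst_ge (a b x : U) y : E a -> no_eps a x -> a <= x -> subst O lt a b x y -> ~ lt y b.
Proof.
  intros Ea. remember (val x) as x0 eqn:Ex. intros hx hax H. revert x Ex hx hax.
  induction H as [x0 hz | x0 he hne | | x0 s ys y hn hs hnt hlen Hi IH hy | x0 L L' y hn hL H IH hy];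
    intros x ex hx hax hlt.
  - subst x0. apply zero_iff in hz. pose proof (E_pos a Ea). ord.
  - subst x0. apply Eps_iff in he. specialize (hx x he (ule_refl x)). apply hne. f_equal. ord.
  - elim (ult_irrefl b). exact hlt.
  - subst x0. destruct (cnf_lift _ _ hs) as (s' & -> & -> & hok). clear hs.
    destruct s' as [| (z, k) s']; [destruct hnt as [h | (? & ? & h & _)]; [simpl in h; lia | discriminate] |].
    destruct ys as [| z0 ys]; [discriminate |].
    pose proof (nontriv_lt _ z k hok hnt (or_introl eq_refl)) as hzx.
    assert (haz : a <= z).
    { apply not_ult. intros h. destruct hok as (h1 & h2 & h3 & h4). simpl in hax.
      assert (mul z k + usum s' < a) by (apply E_add; auto; [apply mul_lt_prin; auto; apply E_prin; auto | ord]). ord. }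
    destruct (lift_lt _ _ hlt) as [w ->]. destruct hok as (h1 & h2 & h3 & h4).
    simpl in hy. destruct hy as (p & q & hp & _ & hadd).
    destruct (add_val _ _ _ hadd) as (p' & q' & -> & _ & ew).
    destruct k as [| k]; [lia |]. destruct hp as (c & _ & hc).
    destruct (add_val _ _ _ hc) as (c' & z' & _ & -> & ep).
    apply (IH 0%nat ltac:(simpl; lia) z eq_refl); auto.
    + eapply no_eps_down; [exact hx | left; auto].
    + simpl. change (z' < b). change (w < b) in hlt.
      pose proof (le_add_l p' q'). pose proof (le_add_r c' z'). ord.
  - subst x0. destruct (omexp_val _ _ hL) as (K & -> & ->).
    destruct (lift_lt _ _ hlt) as [w ->]. destruct (omexp_val _ _ hy) as (K' & -> & ->).
    pose proof (exp_ge K).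
    apply (IH K eq_refl); auto.
    + eapply no_eps_down; [exact hx | auto].
    + apply not_ult. intros h. apply E_exp in h; auto. ord.
    + change (K' < b). change (exp K' < b) in hlt. pose proof (exp_ge K'). ord.
Qed.

(** * The functions pi, d and eta *)

(** Here [exp (l + exp q)] is [pi t] and [q] is [d (pi t)]. *)
Definition Lead (t l q r : U) : Prop := t = exp (l + exp q) + r /\ r < exp (l + exp q + 1).

Lemma Lead_uniq t l q r l' q' r' : Lead t l q r -> Lead t l' q' r' ->
  l + exp q = l' + exp q' /\ q = q' /\ r = r'.
Proof.
  intros (e & h) (e' & h'). rewrite e in e'. destruct (lead_uniq _ _ _ _ h h' e') as (h1 & h2).
  repeat split; auto. eapply last_uniq; eauto.
Qed.

Lemma Lead_ex a t : E a -> a <= t -> exists l q r, Lead t l q r.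
Proof.
  intros Ea hat. destruct (lead_ex t) as (K & r & e & h & h1 & h2). { pose proof (E_pos a Ea). ord. }
  destruct (zero_or_pos K) as [-> | K0].
  - exfalso. assert (t < a); [| ord]. rewrite e. rewrite <- Ea. apply lead_below; auto. apply E_pos; auto.
  - destruct (last_ex K K0) as (l & q & ->). exists l, q, r. split; auto.
Qed.

Lemma pi_iff (t : U) p : pi O lt t p <-> exists K r, p = val (exp K) /\ t = exp K + r /\ r < exp (K + 1).
Proof.
  split.
  - intros (s & l & h1 & h2). destruct (cnf_lift _ _ h1) as (s' & -> & -> & hok).
    destruct s' as [| (y, k) s']; [discriminate |]. simpl in h2. injection h2 as <- <-.
    destruct (cnf_head y k s' hok) as (K & r & -> & e & h). exists K, r. auto.
  - intros (K & r & -> & e & h). destruct (cnf_ex t) as (s & -> & hok).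
    destruct s as [| (y, k) s].
    { simpl in e. pose proof (exp_pos K). pose proof (le_add_l (exp K) r). ord. }
    destruct (cnf_head y k s hok) as (L & r' & -> & e' & h'). rewrite e' in e.
    destruct (lead_uniq _ _ _ _ h' h e) as (-> & _).
    exists (upcast ((exp K, k) :: s)), k. split; [apply cnf_val; auto | auto].
Qed.

Lemma dd_iff l q D : dd O lt (val (exp (l + exp q))) D <-> D = val q.
Proof.
  split.
  - intros [(h & _) | (Q & s & Lm & qm & Dm & h1 & h2 & h3 & ->)].
    { elim h. apply prin_val, prin_exp. }
    destruct (omexp_val _ _ h1) as (Q' & -> & e). apply exp_inj in e. subst Q'.
    destruct (cnf_lift _ _ h2) as (s' & e & es & hok).
    destruct s' as [| p s']; [destruct s; discriminate |].
    destruct (cnf_last _ hok) as (s1 & q1 & n & e1 & e2); [discriminate |].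
    rewrite e1, upcast_app in e. apply app_inj_tail in e. destruct e as (_ & e). injection e as -> ->.
    rewrite e2 in es. apply last_uniq in es. subst q1.
    destruct (omexp_val _ _ h3) as (q' & -> & e). apply exp_inj in e. subst; auto.
  - intros ->. right. destruct (cnf_ex (l + exp q)) as (s & es & hok).
    destruct s as [| p s].
    { simpl in es. pose proof (exp_pos q). pose proof (le_add_r l (exp q)). ord. }
    destruct (cnf_last _ hok) as (s1 & q1 & n & e1 & e2); [discriminate |].
    rewrite e2 in es. apply last_uniq in es as e. subst q1.
    exists (val (l + exp q)), (upcast s1), (val (exp q)), (S n), (val q).
    split; [apply omexp_iff; auto |]. split; [| split; [apply omexp_iff; auto | auto]].
    change (upcast s1 ++ [(val (exp q), S n)]) with (upcast s1 ++ upcast [(exp q, S n)]).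
    rewrite <- upcast_app, <- e1. apply cnf_val. split; auto. rewrite e2. auto.
Qed.

Lemma pd_iff (t : U) l q r v : Lead t l q r -> (pd O lt t v <-> v = val (exp (l + exp q) + q)).
Proof.
  intros (e & h). split.
  - intros (p & D & h1 & h2 & h3). apply pi_iff in h1. destruct h1 as (K & r' & -> & e' & h').
    rewrite e in e'. destruct (lead_uniq _ _ _ _ h h' e') as (<- & _).
    apply dd_iff in h2. subst D. apply uadd_val; auto.
  - intros ->. exists (val (exp (l + exp q))), (val q). split; [apply pi_iff; eauto |].
    split; [apply dd_iff; auto | apply uadd_val; auto].
Qed.

Definition etaU (t y : U) : Prop := exists l q r, Lead t l q r /\
  ((exp (l + exp q) + q <= t /\ y = t) \/ (t < exp (l + exp q) + q /\ y = exp (l + exp q) + q)).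

Lemma etaU_fun t y y' : etaU t y -> etaU t y' -> y = y'.
Proof.
  intros (l & q & r & h & H) (l' & q' & r' & h' & H').
  destruct (Lead_uniq _ _ _ _ _ _ _ h h') as (e1 & e2 & _). rewrite <- e1, <- e2 in H'.
  destruct H as [(h1 & ->) | (h1 & ->)], H' as [(h2 & ->) | (h2 & ->)]; auto; ord.
Qed.

Lemma etaU_ex a t : E a -> a <= t -> exists y, etaU t y.
Proof.
  intros Ea h. destruct (Lead_ex a t Ea h) as (l & q & r & H).
  destruct (ule_case t (exp (l + exp q) + q)) as [k | k].
  - exists (exp (l + exp q) + q), l, q, r. auto.
  - exists t, l, q, r. auto.
Qed.

Lemma eta_iff a (t : U) y : E a -> a <= t -> (eta O lt t y <-> exists u, y = val u /\ etaU t u).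
Proof.
  intros Ea hat. destruct (Lead_ex a t Ea hat) as (l & q & r & H). split.
  - intros (v & h1 & h2). apply (pd_iff t l q r v H) in h1. subst v. rewrite le_iff in h2.
    destruct h2 as [(h2 & ->) | (h2 & ->)]; eexists; (split; [reflexivity |]); exists l, q, r; auto.
  - intros (u & -> & l' & q' & r' & h & H'). exists (val (exp (l' + exp q') + q')).
    split; [eapply pd_iff; eauto |]. rewrite le_iff. destruct H' as [(h1 & ->) | (h1 & ->)]; auto.
Qed.

Lemma last_le_exp l q : q <= exp (l + exp q).
Proof. pose proof (last_le l q). pose proof (exp_ge (l + exp q)). ord. Qed.

Lemma etaU_le t y : etaU t y -> t <= y.
Proof. intros (l & q & r & _ & [(_ & ->) | (h & ->)]); [apply ule_refl | left; auto]. Qed.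

Lemma etaU_full t y : etaU t y -> full y.
Proof.
  intros (l & q & r & (e & h) & [(h1 & ->) | (h1 & ->)]).
  - exists l, q, r. auto.
  - exists l, q, q. split; auto. split; [| apply ule_refl]. pose proof (last_le_exp l q).
    pose proof (exp_lt _ _ (succ_lt (l + exp q))). ord.
Qed.

(** An epsilon number above [t] is above [pi t] and [d (pi t)], hence above their sum. *)
Lemma etaU_no_eps a t y : etaU t y -> no_eps a t -> no_eps a y.
Proof.
  intros (l & q & r & (e & h) & [(h1 & ->) | (h1 & ->)]) H; auto. intros c hc hy.
  destruct (ule_case t c) as [k | k]; auto. exfalso.
  pose proof (last_le_exp l q). pose proof (le_add_l (exp (l + exp q)) r).
  assert (exp (l + exp q) + q < c) by (apply E_add; auto; ord). ord.
Qed.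

Lemma N_Lead a b t t' l q r : E a -> E b -> N a b t t' -> Lead t l q r ->
  exists l' q' r', Lead t' l' q' r' /\ N a b (l + exp q) (l' + exp q') /\ N a b q q'.
Proof.
  intros Ea Eb H (e & h). subst t. destruct (N_lead_inv a b Ea Eb _ _ _ h H) as (K' & r' & -> & h1 & h2 & h3).
  destruct (N_last_inv a b Ea Eb _ _ h1) as (l1 & l' & q1 & q' & e & -> & h4 & h5).
  { pose proof (exp_pos q). pose proof (le_add_r l (exp q)). ord. }
  apply last_uniq in e as e'. subst q1. exists l', q', r'. repeat split; auto.
Qed.

Lemma N_etaU a b t t' y : E a -> E b -> N a b t t' -> etaU t y -> exists y', N a b y y'.
Proof.
  intros Ea Eb H (l & q & r & h & [(h1 & ->) | (h1 & ->)]); eauto.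
  destruct (N_Lead a b t t' l q r Ea Eb H h) as (l' & q' & r' & _ & h2 & h3).
  exists (exp (l' + exp q') + q'). apply N_add; auto. apply N_exp; auto.
Qed.

(** * Largest epsilon numbers and the class [G] *)

Lemma largestEps_iff x (t : U) : largestEps O lt x t <-> exists a, x = val a /\ E a /\ a <= t /\ no_eps a t.
Proof.
  split.
  - intros (h1 & h2 & h3). destruct (lift_le _ _ h2) as [a ->]. exists a.
    split; auto. split; [apply Eps_iff; auto |]. split; [apply le_iff; auto |].
    intros e he het. apply le_iff, h3; [apply Eps_iff | apply le_iff]; auto.
  - intros (a & -> & h1 & h2 & h3). split; [apply Eps_iff; auto |]. split; [apply le_iff; auto |].
    intros e he het. destruct (lift_le _ _ het) as [u ->]. apply le_iff, h3; [apply Eps_iff | apply le_iff]; auto.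
Qed.

Lemma largest_eps_unique a a' t : E a -> a <= t -> no_eps a t -> E a' -> a' <= t -> no_eps a' t -> a = a'.
Proof. intros h1 h2 h3 h4 h5 h6. apply ule_antisym; auto. Qed.

(** The least bound [m] of the epsilon numbers up to [t] is one of them; otherwise it would be a
    limit of epsilon numbers, hence one by [Lim_E]. *)
Lemma largest_eps_ex e t : E e -> e <= t -> exists a, E a /\ a <= t /\ no_eps a t.
Proof.
  intros he het. destruct (least (fun m => no_eps m t)) as (m & hm & Hm). { exists t. intros c _ h; auto. }
  assert (hmt : m <= t). { apply Hm. intros c _ h; auto. }
  exists m. split; auto. destruct (classic (E m)) as [| n]; auto. apply Lim_E. split.
  - pose proof (E_pos e he). specialize (hm e he het). ord.
  - intros g hg. apply NNPP. intros k. assert (no_eps g t); [| apply Hm in H; ord].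
    intros c hc hct. apply not_ult. intros hgc. apply k. exists c. repeat split; auto.
    destruct (hm c hc hct) as [| ->]; auto. tauto.
Qed.

(* [G t] is the set of limit points of [Gd t a], where a is the largest epsilon number up to t. *)
Definition Gd (t a e : U) : Prop := E e /\ e <= a /\ (exists t', N a e t t') /\
  exists y y', etaU t y /\ N a e y y' /\ R1eq e y'.

Lemma N_no_eps a b x x' : E a -> E b -> N a b x x' -> no_eps b x'.
Proof.
  intros Ea Eb H c hc hx. apply not_ult. intros h. pose proof (N_below_eps a b x x' c H hc h). ord.
Qed.

(** Stated on [O], because the right-hand point occurring in [G] is located in [U] only after [b]
    has been shown to be an epsilon number. *)
Lemma lt1up_down b c d : lt1up O lt wf b d -> lt b c -> le O lt c d -> lt1up O lt wf b c.
Proof.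
  intros (_ & H) h1 h2. split; auto. intros Z hZ. apply H. intros x hx.
  destruct h2 as [h2 | <-]; eauto.
Qed.

Lemma Lim_Gd_E t a u : Lim (Gd t a) u -> Lim E u.
Proof.
  intros (h0 & hu). split; auto. intros g hg. destruct (hu g hg) as (x & (h1 & _) & h2 & h3). eauto.
Qed.

(** Above the parameters of [t] and of [eta t], the witnesses of [near] belong to [Gd t a], since
    putting [e] for [u] in [Y'] gives the same as putting [e] for [a] in [Y]. *)
Lemma Lim_Gd_of_near t a u t' Y Y' : E a -> E u -> u <= a -> N a u t t' -> etaU t Y -> N a u Y Y' ->
  (forall g, g < u -> near u Y' g) -> Lim (Gd t a) u.
Proof.
  intros Ea Eu hua ht' hY hY' nr. split; [apply E_pos; auto |]. intros g hg.
  destruct (N_shrink a u t t' Ea Eu ht') as (g1 & hg1 & Hg1).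
  destruct (N_shrink a u Y Y' Ea Eu hY') as (g2 & hg2 & Hg2).
  destruct (max_below u g g1 hg hg1) as (m & m1 & m2 & m3).
  destruct (max_below u m g2 m1 hg2) as (m' & m1' & m2' & m3').
  destruct (nr m' m1') as (e & s' & k1 & k2 & k3 & k4 & k5).
  exists e. split; [| split; ord]. split; auto. split; [ord |].
  split; [apply Hg1; auto; ord |].
  destruct (Hg2 e k3) as [z hz]; [ord |]. exists Y, z. split; auto. split; auto.
  assert (N u e Y' z) by (apply (N_compose a u e Y); auto; left; auto).
  rewrite (N_fun u e Eu k3 _ _ _ H k4). auto.
Qed.

(** Members of [Gd t a] below [u] witness [near], from which [R1eq_of_near] and then [Rup_of_near]
    recover [<^1]. *)
Lemma Rup_of_Lim_Gd t a u : E a -> a <= t -> Lim (Gd t a) u ->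
  E u /\ u <= a /\ exists t' Y Y', N a u t t' /\ etaU t Y /\ N a u Y Y' /\ Rup u (Y' + 1).
Proof.
  intros Ea hat hu. pose proof (Lim_E u (Lim_Gd_E t a u hu)) as Eu. destruct hu as (h0 & hu).
  assert (hua : u <= a).
  { apply not_ult. intros h. destruct (hu a h) as (x & (_ & h1 & _) & h2 & _). ord. }
  destruct (hu 0 h0) as (x & (k1 & k2 & (tx & k3) & Y & y' & k4 & k5 & k6) & _ & k7).
  destruct (N_mono a x u t tx Ea Eu k3) as [t' ht']; [left; auto |].
  destruct (N_mono a x u Y y' Ea Eu k5) as [Y' hY']; [left; auto |].
  split; auto. split; auto. exists t', Y, Y'. split; [auto | split; [auto | split; [auto |]]].
  assert (nY : no_eps u Y') by (apply (N_no_eps a u Y); auto).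
  assert (hY : u <= Y').
  { apply (N_le_iff a u Ea Eu _ _ _ _ (N_base a u) hY'). pose proof (etaU_le _ _ k4). ord. }
  assert (nr : forall g, g < u -> near u Y' g).
  { intros g hg. destruct (hu g hg) as (e & (p1 & p2 & _ & Y2 & z & p4 & p5 & p6) & p7 & p8).
    rewrite (etaU_fun _ _ _ p4 k4) in *. exists e, z. repeat split; auto.
    apply (N_compose a u e Y); auto. left; auto. }
  apply Rup_of_near; auto. apply R1eq_of_near; auto.
Qed.

Lemma G_iff (t a : U) b : E a -> a <= t -> no_eps a t ->
  (G O lt wf t b <-> exists u, b = val u /\ Lim (Gd t a) u).
Proof.
  intros Ea hat hne. split.
  - intros (a' & h1 & h2 & h3 & y & y' & y1 & h4 & h5 & h6 & h7).
    apply largestEps_iff in h1. destruct h1 as (a2 & -> & k1 & k2 & k3).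
    assert (a2 = a) by (apply (largest_eps_unique a2 a t); auto). subst a2. clear k1 k2 k3.
    destruct (lift_le _ _ h3) as [u ->]. apply le_iff in h3. exists u. split; auto.
    apply (eta_iff a) in h4; auto. destruct h4 as (Y & -> & hY).
    pose proof (etaU_le _ _ hY) as htY. pose proof (etaU_no_eps _ _ _ hY hne) as hYne.
    (* This gives [u < y1], hence [u <^1 u + 1], so [u] is an epsilon number; only then can [N]
       compute the substitution. *)
    assert (hy' : ~ lt y' u) by (eapply subst_ge; eauto; ord).
    assert (hu1 : lt u y1).
    { destruct h6 as (h6 & _). destruct (lt_total y' u) as [| [-> |]]; [tauto | auto | eauto]. }
    destruct h7 as [e | h7]; [elim (lt_irrefl u); rewrite e at 2; auto |].
    assert (Eu : E u).
    { apply Rup_E with (u + 1). apply (lt1up_down _ _ _ h7); [apply succ_lt |].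
      assert (k : succ O lt u (val (u + 1))) by (apply succ_val; auto). apply k; auto. }
    destruct (N_of_InEp a u t Ea Eu hne) as [t' ht']. { intros e k1 k2. apply h2; auto. }
    destruct (N_etaU a u t t' Y Ea Eu ht' hY) as [Y' hY'].
    pose proof (subst_N a u Y Y' y' Ea Eu h5 hY'). subst y'. apply succ_val in h6. subst y1.
    assert (nr : forall g, g < u -> near u Y' g).
    { apply near_of_Rup; auto.
      - apply (N_no_eps a u Y); auto.
      - apply (N_le_iff a u Ea Eu _ _ _ _ (N_base a u) hY'). ord. }
    apply (Lim_Gd_of_near t a u t' Y Y'); auto.
  - intros (u & -> & hu).
    destruct (Rup_of_Lim_Gd t a u Ea hat hu) as (Eu & hua & t' & Y & Y' & ht' & hY & hY' & r).
    exists (val a). split; [apply largestEps_iff; eauto |].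
    split. { intros e h1 h2. destruct (InEp_N a u t t' e Ea Eu h1 ht') as (v & -> & _ & _ & h4). exact (h4 h2). }
    split; [apply le_iff; auto |]. exists (val Y), (val Y'), (val (Y' + 1)).
    split; [apply (eta_iff a); eauto |]. split; [apply subst_of_N; auto |].
    split; [apply succ_val; auto |]. right. exact r.
Qed.

(** * Approximating sequences *)

(* [F] relates the indices below gam to a sequence cofinal in t, and this persists when a is
   replaced by a smaller epsilon number x and the indices are restricted to those below x. *)
Definition cofinal (a t gam : U) (F : U -> U -> Prop) : Prop :=
  lim gam /\ gam <= a /\
  forall x t', E x -> x <= a -> N a x t t' ->
    0 < t /\
    (forall j, 0 < j -> j < gam -> j < x -> exists u u', F j u /\ u < t /\ N a x u u') /\
    (forall z, z < t' -> exists j u u',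
       0 < j /\ j < gam /\ j < x /\ F j u /\ u < t /\ N a x u u' /\ z < u').

(** Substitution must be defined on both parts whenever it is defined on [t]. This is not automatic:
    terms of [R] absorbed by [L] leave no trace in [t]. *)
Definition splits (t R L : U) : Prop :=
  t = R + L /\ forall a b t', E a -> E b -> N a b t t' ->
    (exists R', N a b R R') /\ (exists L', N a b L L').

Lemma lim_one x : lim x -> 1 < x.
Proof. intros (h & H). specialize (H 0 h). rewrite add_0_l in H. auto. Qed.

(** Every clause of [sigma] arises from the identity, from finite multiples of a power, or from a
    recursively given sequence, by adding a fixed left part and by exponentiation. This lemma,
    [cofinal_exp], [cofinal_id] and [cofinal_mul] cover these constructions. *)
Lemma cofinal_add a t R L gam F F' : E a -> splits t R L -> cofinal a L gam F ->
  (forall j u, F j u -> F' j (R + u)) -> cofinal a t gam F'.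
Proof.
  intros Ea (-> & HS) (h1 & h2 & H) HF. split; auto. split; auto. intros x t' Ex hx Ht.
  destruct (HS a x t' Ea Ex Ht) as ((R' & hR) & (L' & hL)).
  rewrite (N_fun a x Ea Ex _ _ _ Ht (N_add a x Ea Ex _ _ _ _ hR hL)).
  destruct (H x L' Ex hx hL) as (L0 & H1 & H2). split; [| split].
  - pose proof (le_add_r R L). ord.
  - intros j k1 k2 k3. destruct (H1 j k1 k2 k3) as (u & u' & p1 & p2 & p3).
    exists (R + u), (R' + u'). split; auto. split; [apply add_lt_r; auto |]. apply N_add; auto.
  - intros z hz.
    assert (exists z', z' < L' /\ z <= R' + z') as (z' & hz' & hzz).
    { apply lt_add in hz. destruct hz as [hz | (v & hv & ->)].
      - exists 0. rewrite add_0_r. split; [| left; auto].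
        apply (N_lt_iff a x Ea Ex _ _ _ _ (N_zero a x Ea Ex) hL). auto.
      - exists v. split; auto. apply ule_refl. }
    destruct (H2 z' hz') as (j & u & u' & k1 & k2 & k3 & k4 & k5 & k6 & k7).
    exists j, (R + u), (R' + u'). repeat split; auto.
    { apply add_lt_r; auto. } { apply N_add; auto. }
    apply (add_lt_r R') in k7. ord.
Qed.

Lemma cofinal_exp a L gam F F' : E a -> cofinal a L gam F ->
  (forall j u, F j u -> F' j (exp u)) -> cofinal a (exp L) gam F'.
Proof.
  intros Ea (h1 & h2 & H) HF. split; auto. split; auto. intros x t' Ex hx Ht.
  destruct (N_exp_inv a x Ea Ex _ _ Ht) as (L' & -> & hL).
  destruct (H x L' Ex hx hL) as (L0 & H1 & H2). split; [apply exp_pos | split].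
  - intros j k1 k2 k3. destruct (H1 j k1 k2 k3) as (u & u' & p1 & p2 & p3).
    exists (exp u), (exp u'). split; auto. split; [apply exp_lt; auto |]. apply N_exp; auto.
  - intros z hz.
    (* The cofinal sequence makes [L'] a limit, so that continuity of [exp] applies. *)
    assert (lL : lim L').
    { split; [apply (N_lt_iff a x Ea Ex _ _ _ _ (N_zero a x Ea Ex) hL); auto |].
      intros w hw. destruct (H2 w hw) as (j & u & u' & k1 & k2 & k3 & k4 & k5 & k6 & k7).
      apply (N_lt_iff a x Ea Ex _ _ _ _ k6 hL) in k5. apply le_succ in k7. ord. }
    destruct (exp_cont L' z lL hz) as (K & k1 & k2).
    destruct (H2 K k1) as (j & u & u' & p1 & p2 & p3 & p4 & p5 & p6 & p7).
    exists j, (exp u), (exp u'). repeat split; auto.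
    { apply exp_lt; auto. } { apply N_exp; auto. }
    apply exp_lt in p7. ord.
Qed.

(** For [L = a] the image is [x], and the indices below [x] are cofinal in it; hence the truncation
    of the index set at [x]. *)
Lemma cofinal_id a L : E a -> lim L -> L <= a -> cofinal a L L (fun j u => u = j).
Proof.
  intros Ea lL hL. split; auto. split; auto. intros x L' Ex hx HL. split; [apply lL |].
  assert (lim L' /\ L' <= L /\ L' <= x) as (l' & h1 & h2).
  { destruct hL as [hL | ->].
    - rewrite (N_small a x L L'); auto. split; auto. split; [apply ule_refl |].
      left. apply (N_small_lt a x Ea Ex L L'); auto.
    - rewrite (N_fun a x Ea Ex _ _ _ HL (N_base a x)). split; [apply E_lim; auto |].
      split; auto. apply ule_refl. }
  split.
  - intros j k1 k2 k3. exists j, j. split; auto. split; auto. constructor; ord.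
  - intros z hz. exists (z + 1), (z + 1), (z + 1). apply l' in hz. pose proof (succ_lt z).
    pose proof (zero_le z). repeat split; auto; try ord. constructor; ord.
Qed.

Definition omega : U := exp 1.

Lemma lim_omega : lim omega.
Proof. apply lim_exp, exp_pos. Qed.

Lemma lt_omega j : j < omega <-> exists k, j = mul 1 k.
Proof.
  unfold omega. split.
  - intros h. rewrite <- (add_0_l 1) in h at 1. destruct (exp_succ_cont 0 j h) as [n hn].
    revert hn. induction n; simpl; intros hn; [elim (not_lt_zero _ hn) |].
    apply lt_succ in hn. destruct hn as [hn | ->]; eauto.
  - intros (k & ->). pose proof (mul_lt_exp 0 k) as h. rewrite add_0_l in h. auto.
Qed.

Lemma omega_ord_iff om : omega_ord O lt om <-> om = val omega.
Proof.
  split.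
  - intros (h1 & h2). destruct (lt_total om omega) as [h | [h | h]]; auto; exfalso.
    + destruct (lift_lt _ _ h) as [u ->]. apply islim_iff in h1. apply lt_omega in h.
      destruct h as (k & e). assert (A : forall k, mul 1 k < u).
      { intros n. induction n; simpl; [apply h1 |]. apply h1; auto. }
      specialize (A k). ord.
    + apply (h2 _ h). apply islim_iff, lim_omega.
  - intros ->. split; [apply islim_iff, lim_omega |]. intros x hx hl.
    destruct (lift_lt _ _ hx) as [u ->]. apply islim_iff in hl. apply lt_omega in hx.
    destruct hx as (k & e). assert (A : forall k, mul 1 k < u).
    { intros n. induction n; simpl; [apply hl |]. apply hl; auto. }
    specialize (A k). ord.
Qed.

Lemma ofnat_val k x : ofnat O lt k x <-> x = val (mul 1 k).
Proof.
  revert x. induction k; simpl; intros x.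
  - split; [apply zero_val | intros ->; apply zero_iff; auto].
  - split.
    + intros (y & h1 & h2). apply IHk in h1. subst y. apply succ_val in h2. auto.
    + intros ->. exists (val (mul 1 k)). split; [apply IHk; auto | apply succ_val; auto].
Qed.

Lemma mul_one_inj m n : mul 1 m = mul 1 n -> m = n.
Proof.
  assert (A : forall m n, (m < n)%nat -> mul 1 m < mul 1 n).
  { intros p q h. pose proof (mul_le 1 (S p) q h). simpl in H. pose proof (succ_lt (mul 1 p)). ord. }
  intros e. destruct (Nat.lt_trichotomy m n) as [h | [h | h]]; auto; exfalso; apply A in h; ord.
Qed.

Lemma omega_index j : 0 < j -> j < omega -> exists k, j = mul 1 (S k).
Proof.
  intros h h'. apply lt_omega in h'. destruct h' as ([| k] & ->); [simpl in h; ord | eauto].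
Qed.

Lemma omega_le_E x : E x -> omega < x.
Proof. intros h. apply E_exp, E_one; auto. Qed.

Lemma N_succ_inv a b l w : E a -> E b -> N a b (l + 1) w -> exists l', w = l' + 1 /\ N a b l l'.
Proof.
  intros Ea Eb hw. destruct (N_last_inv a b Ea Eb _ _ hw) as (l0 & l' & q & q' & e & -> & hl & _).
  { pose proof (succ_lt l). pose proof (zero_le l). ord. }
  apply last_uniq in e as e'. subst q.
  assert (l = l0).
  { apply ule_antisym; apply lt_succ; [rewrite <- e | rewrite e]; apply succ_lt. }
  subst l0. exists l'. split; auto.
  apply (N_fun a b Ea Eb _ _ _ hw). apply N_add; auto. apply N_one; auto.
Qed.

Lemma cofinal_mul a q : E a -> cofinal a (exp (q + 1)) omega
  (fun j u => exists k, j = mul 1 (S k) /\ u = mul (exp q) (S k)).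
Proof.
  intros Ea. split; [apply lim_omega |]. split; [left; apply omega_le_E; auto |].
  intros x t' Ex hx Ht. split; [apply exp_pos |].
  destruct (N_exp_inv a x Ea Ex _ _ Ht) as (w & -> & hw).
  destruct (N_succ_inv a x q w Ea Ex hw) as (l' & -> & hl).
  split.
  - intros j h1 h2 _. destruct (omega_index j h1 h2) as (k & ->).
    exists (mul (exp q) (S k)), (mul (exp l') (S k)). split; [eauto |].
    split; [apply mul_lt_exp |]. apply N_mul; auto. apply N_exp; auto.
  - intros z hz. destruct (exp_succ_cont l' z hz) as [n hn].
    assert (mul 1 (S n) < omega) by (apply lt_omega; eauto).
    pose proof (omega_le_E x Ex). pose proof (mul_le (exp l') n (S n) ltac:(lia)).
    exists (mul 1 (S n)), (mul (exp q) (S n)), (mul (exp l') (S n)). repeat split; auto; try ord.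
    + pose proof (le_mul 1 (S n) ltac:(lia)). pose proof (exp_pos 0). ord.
    + eauto.
    + apply mul_lt_exp.
    + apply N_mul; auto. apply N_exp; auto.
Qed.

(** One copy of the last power is split off. Both parts are built from components of the normal form
    of [T], so substitution is defined on them. *)
Lemma cnf_splits (T : U) sq Lm qm : cnf O lt T (sq ++ [(Lm, qm)]) ->
  exists s q k, sq = upcast s /\ Lm = val (exp q) /\ qm = S k /\
    splits T (usum s + mul (exp q) k) (exp q).
Proof.
  intros H. destruct (cnf_lift _ _ H) as (s' & e & -> & hok).
  destruct s' as [| p s']; [destruct sq; discriminate |].
  destruct (cnf_last _ hok) as (s & q & k & e1 & e2); [discriminate |].
  rewrite e1, upcast_app in e. apply app_inj_tail in e. destruct e as (-> & e). injection e as -> ->.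
  exists s, q, k. repeat split; auto.
  - rewrite e2, usum_app. simpl. rewrite add_0_r. auto.
  - assert (hs : forall y l, In (y, l) s -> exists y', N a b y y').
    { intros y l hy. apply (N_component a b _ t' y l H0 H1 hok H2). rewrite e1. apply in_app_iff; auto. }
    assert (hq : exists q', N a b (exp q) q').
    { apply (N_component a b _ t' _ (S k) H0 H1 hok H2). rewrite e1. apply in_app_iff. simpl; auto. }
    destruct (N_usum a b s H0 H1 hs) as [r hr]. destruct hq as [q' hq].
    exists (r + mul q' k). apply N_add; auto. apply N_mul; auto.
  - apply (N_component a b _ t' _ (S k) H0 H1 hok H2). rewrite e1. apply in_app_iff. simpl; auto.
Qed.

(** If [L] is at most [a], then [R] is at least [a], as otherwise [R + L] could not exceed [a]. *)
Lemma splits_ge a t R L u : E a -> splits t R L -> a < t -> (a < L -> a <= u) -> a <= R + u.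
Proof.
  intros Ea (-> & _) h H. destruct (ule_case a L) as [k | k].
  - specialize (H k). pose proof (le_add_r R u). ord.
  - apply not_ult. intros n. assert (hR : R < a). { pose proof (le_add_l R u). ord. }
    destruct k as [k | ->].
    + pose proof (E_add a R L Ea hR k). ord.
    + rewrite (E_absorb a R Ea hR) in h. ord.
Qed.

(** The lower bound [a] on the members ensures that [G] and [A] at a member refer to the same
    epsilon number as at [t]. *)
Definition approx (a t gam : U) (f : O -> O) : Prop :=
  cofinal a t gam (fun j u => f (val j) = val u) /\
  forall j, 0 < j -> j < gam -> exists u, f (val j) = val u /\ a <= u.

Lemma cofinal_weaken a t gam F F' : cofinal a t gam F ->
  (forall j u, 0 < j -> j < gam -> F j u -> F' j u) -> cofinal a t gam F'.
Proof.
  intros (h1 & h2 & H) HF. split; auto. split; auto. intros x t' Ex hx Ht.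
  destruct (H x t' Ex hx Ht) as (h0 & H1 & H2). split; auto. split.
  - intros j k1 k2 k3. destruct (H1 j k1 k2 k3) as (u & u' & p1 & p2 & p3). eauto 8.
  - intros z hz. destruct (H2 z hz) as (j & u & u' & k1 & k2 & k3 & k4 & k5 & k6 & k7).
    exists j, u, u'. auto 10.
Qed.

Lemma approx_of a t gam f G : cofinal a t gam G ->
  (forall j, 0 < j -> j < gam -> exists u, G j u /\ a <= u) ->
  (forall j u, 0 < j -> j < gam -> G j u -> f (val j) = val u) -> approx a t gam f.
Proof.
  intros h1 h2 h3. split.
  - eapply cofinal_weaken; [exact h1 | exact h3].
  - intros j k1 k2. destruct (h2 j k1 k2) as (u & h4 & h5). eauto.
Qed.

Lemma approx_add a t R L gam G f : E a -> a < t -> splits t R L -> cofinal a L gam G ->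
  (forall j, 0 < j -> j < gam -> exists u, G j u /\ (a < L -> a <= u)) ->
  (forall j u, 0 < j -> j < gam -> G j u -> f (val j) = val (R + u)) -> approx a t gam f.
Proof.
  intros Ea hat hs hc hge hf. apply approx_of with (fun j v => exists u, G j u /\ v = R + u).
  - eapply cofinal_add; eauto.
  - intros j h1 h2. destruct (hge j h1 h2) as (u & h3 & h4). exists (R + u). split; [eauto |].
    apply (splits_ge a t R L); auto.
  - intros j v h1 h2 (u & h3 & ->). auto.
Qed.

Lemma E_lt_exp a T : E a -> a < exp T -> a < T.
Proof. intros Ea h. apply exp_lt_cancel. unfold E in Ea. rewrite Ea. auto. Qed.

Lemma approx_exp_add a T R L gam G f : E a -> a < exp T -> splits T R L -> cofinal a L gam G ->
  (forall j, 0 < j -> j < gam -> exists u, G j u /\ (a < L -> a <= u)) ->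
  (forall j u, 0 < j -> j < gam -> G j u -> f (val j) = val (exp (R + u))) -> approx a (exp T) gam f.
Proof.
  intros Ea hat hs hc hge hf. apply (E_lt_exp a T Ea) in hat.
  apply approx_of with (fun j v => exists u, G j u /\ v = exp (R + u)).
  - apply cofinal_exp with (fun j v => exists u, G j u /\ v = R + u); auto.
    + eapply cofinal_add; eauto.
    + intros j v (u & h & ->). eauto.
  - intros j h1 h2. destruct (hge j h1 h2) as (u & h3 & h4). exists (exp (R + u)). split; [eauto |].
    pose proof (splits_ge a T R L u Ea hs hat h4). pose proof (exp_ge (R + u)). ord.
  - intros j v h1 h2 (u & h3 & ->). auto.
Qed.

Lemma S_sub_1 k : (S k - 1)%nat = k.
Proof. lia. Qed.

Lemma largestEps_E (a t : U) : largestEps O lt a t -> E a /\ a <= t /\ no_eps a t.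
Proof.
  intros h. apply largestEps_iff in h. destruct h as (b & e & h). apply val_inj in e. subst. auto.
Qed.

Lemma sigma_approx (a : U) t0 gam0 f : sigma O lt a t0 gam0 f ->
  forall t, t0 = val t -> exists gam, gam0 = val gam /\ approx a t gam f.
Proof.
  induction 1 as
    [ t0 T1 sq Mm qm Qm Pv om f hL hlt hlim hc1 hT1 hcT hQ hP hz hom hf
    | t0 T1 sq Mm qm Qm Qp Pv om f hL hlt hlim hc1 hT1 hcT hQ hP hpos hQa hsucc hom hf
    | t0 T1 sq Mm qm Qm Pv f hL hlt hlim hc1 hT1 hcT hQ hP hQl hQa hf
    | t0 T1 sq Mm qm Qm Pv gam g f hL hlt hlim hc1 hT1 hcT hQ hP hQa hsig IH hf
    | t0 L1 t1 T1 f hL hlt hlim hc ht1 hT1 hTa hf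
    | t0 L1 t1 T1 gam g f hL hlt hlim hc ht1 hT1 hTa hsig IH hf
    | t0 s' Ln tn Tn R f hL hlt hlim hc hne hTn hR hTa hf
    | t0 s' Ln tn Tn R f hL hlt hlim hc hne hTn hR hTa hf
    | t0 s' Ln tn Tn R gam g f hL hlt hlim hc hne hTn hR hTa hsig IH hf ];
  intros t ->; destruct (largestEps_E _ _ hL) as (Ea & hat & hno); clear hL; change (a < t) in hlt.
  - destruct (omexp_val _ _ hT1) as (T & -> & ->).
    destruct (cnf_splits _ _ _ _ hcT) as (s & q & k & -> & -> & -> & hs).
    destruct (omexp_val _ _ hQ) as (q' & -> & e). apply exp_inj in e. subst q'.
    apply zero_iff in hz. subst q. apply lsum_val in hP. subst Pv. apply omega_ord_iff in hom. subst om.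
    exists omega. split; auto. apply (E_lt_exp a T Ea) in hlt. destruct hs as (-> & _).
    (* Here [T = C + 1], and the index enters as a multiple of [exp C], outside the exponential. *)
    set (C := usum s + mul 1 k) in *.
    apply approx_of with (fun j u => exists k, j = mul 1 (S k) /\ u = mul (exp C) (S k)).
    + apply cofinal_mul; auto.
    + intros j h1 h2. destruct (omega_index j h1 h2) as (n & ->). eexists. split; [eauto |].
      apply lt_succ in hlt. pose proof (exp_ge C). pose proof (le_mul (exp C) (S n) ltac:(lia)). ord.
    + intros j u _ _ (n & -> & ->). destruct (hf (val (mul 1 (S n))) n) as (qo & Ev & w & k1 & k2 & k3 & k4).
      { apply ofnat_val; auto. }
      rewrite S_sub_1 in k1. apply ofnat_val in k1. subst qo. apply uadd_val in k2. subst Ev.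
      apply uexp_val in k3. subst w. apply nmul_val in k4. auto.
  - destruct (omexp_val _ _ hT1) as (T & -> & ->).
    destruct (cnf_splits _ _ _ _ hcT) as (s & q & k & -> & -> & -> & hs).
    destruct (omexp_val _ _ hQ) as (q' & -> & e). apply exp_inj in e. subst q'.
    destruct (lift_lt Qp q) as [p ->]; [apply hsucc |]. apply succ_val, val_inj in hsucc. subst q.
    apply lsum_val in hP. subst Pv. apply omega_ord_iff in hom. subst om.
    exists omega. split; auto.
    eapply approx_exp_add; [exact Ea | exact hlt | exact hs | apply cofinal_mul; auto | |].
    + intros j h1 h2. destruct (omega_index j h1 h2) as (n & ->). eexists. split; [eauto |].
      intros h. exfalso. apply (E_lt_exp a _ Ea) in h. change (p + 1 < a) in hQa. ord.
    + intros j u _ _ (n & -> & ->).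
      destruct (hf (val (mul 1 (S n))) n) as (x & E1 & w & y & Ev & k1 & k2 & k3 & k4 & k5 & k6).
      { apply ofnat_val; auto. }
      rewrite S_sub_1 in k1. apply nmul_val in k1. subst x. apply uadd_val in k2. subst E1.
      apply uexp_val in k3. subst w. apply nmul_val in k4. subst y. apply uadd_val in k5. subst Ev.
      apply uexp_val in k6. auto.
  - destruct (omexp_val _ _ hT1) as (T & -> & ->).
    destruct (cnf_splits _ _ _ _ hcT) as (s & q & k & -> & -> & -> & hs).
    destruct (omexp_val _ _ hQ) as (q' & -> & e). apply exp_inj in e. subst q'.
    apply lsum_val in hP. subst Pv. apply islim_iff in hQl. apply le_iff in hQa.
    exists q. split; auto.
    eapply approx_exp_add; [exact Ea | exact hlt | exact hs | | |].
    + apply (cofinal_exp a q q (fun j u => u = j) (fun j u => u = exp j)); auto.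
      * apply cofinal_id; auto.
      * intros j u ->; auto.
    + intros j h1 h2. eexists. split; [eauto |].
      intros h. exfalso. apply (E_lt_exp a _ Ea) in h. ord.
    + intros j u h1 h2 ->. destruct (hf (val j)) as (x & E1 & w & Ev & k1 & k2 & k3 & k4 & k5).
      { apply pos_iff; auto. } { exact h2. }
      rewrite S_sub_1 in k1. apply nmul_val in k1. subst x. apply uadd_val in k2. subst E1.
      apply uexp_val in k3. subst w. apply uadd_val in k4. subst Ev. apply uexp_val in k5. auto.
  - destruct (omexp_val _ _ hT1) as (T & -> & ->).
    destruct (cnf_splits _ _ _ _ hcT) as (s & q & k & -> & -> & -> & hs).
    destruct (IH (exp q) eq_refl) as (gam' & -> & hcof & hge). clear IH.
    apply lsum_val in hP. subst Pv. exists gam'. split; auto.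
    eapply approx_exp_add; [exact Ea | exact hlt | exact hs | exact hcof | |].
    + intros j h1 h2. destruct (hge j h1 h2) as (u & h3 & h4). eauto.
    + intros j u h1 h2 e. destruct (hf (val j)) as (x & E1 & Ev & k1 & k2 & k3 & k4).
      { apply pos_iff; auto. } { exact h2. }
      rewrite S_sub_1 in k1. apply nmul_val in k1. subst x. apply uadd_val in k2. subst E1.
      rewrite e in k3. apply uadd_val in k3. subst Ev. apply uexp_val in k4. auto.
  - destruct (cnf_splits _ [] _ _ hc) as (s & q & k & es & -> & -> & hs).
    destruct s; [| discriminate]. clear es. destruct (omexp_val _ _ hT1) as (q' & -> & e).
    apply exp_inj in e. subst q'. apply val_inj in hTa. subst q.
    exists a. split; auto.
    eapply approx_add; [exact Ea | exact hlt | exact hs | | |].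
    + rewrite Ea. apply (cofinal_id a a Ea (E_lim a Ea) (ule_refl a)).
    + intros j h1 h2. eexists. split; [eauto |]. rewrite Ea. intros h. ord.
    + intros j u h1 h2 ->. destruct (hf (val j)) as (x & k1 & k2).
      { apply pos_iff; auto. } { exact h2. }
      rewrite S_sub_1 in k1. apply nmul_val in k1. subst x. apply uadd_val in k2.
      rewrite k2. simpl. rewrite add_0_l. auto.
  - destruct (cnf_splits _ [] _ _ hc) as (s & q & k & es & -> & -> & hs).
    destruct s; [| discriminate]. clear es.
    destruct (IH (exp q) eq_refl) as (gam' & -> & hcof & hge). clear IH.
    exists gam'. split; auto.
    eapply approx_add; [exact Ea | exact hlt | exact hs | exact hcof | |].
    + intros j h1 h2. destruct (hge j h1 h2) as (u & h3 & h4). eauto.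
    + intros j u h1 h2 e. destruct (hf (val j)) as (x & k1 & k2).
      { apply pos_iff; auto. } { exact h2. }
      rewrite S_sub_1 in k1. apply nmul_val in k1. subst x. rewrite e in k2. apply uadd_val in k2.
      rewrite k2. simpl. rewrite add_0_l. auto.
  - destruct (cnf_splits _ _ _ _ hc) as (s & q & k & -> & -> & -> & hs).
    destruct (omexp_val _ _ hTn) as (q' & -> & e). apply exp_inj in e. subst q'.
    change (q < a) in hTa. rewrite S_sub_1 in hR.
    change (upcast s ++ [(val (exp q), k)]) with (upcast s ++ upcast [(exp q, k)]) in hR. rewrite <- upcast_app, lsum_val, usum_app in hR.
    simpl in hR. rewrite add_0_r in hR. subst R.
    exists (exp q). split; auto. apply (E_exp a q Ea) in hTa.
    eapply approx_add; [exact Ea | exact hlt | exact hs | | |].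
    (* The last exponent is positive, since otherwise [t] would be a successor. *)
    + apply cofinal_id; auto; [| left; auto]. apply lim_exp.
      destruct (zero_or_pos q) as [-> |]; auto. exfalso. destruct hs as (-> & _).
      apply islim_iff in hlim. destruct hlim as (_ & hlim).
      specialize (hlim _ (succ_lt (usum s + mul 1 k))). ord.
    + intros j h1 h2. eexists. split; [eauto |]. intros h. ord.
    + intros j u h1 h2 ->. apply uadd_val. apply hf; [apply pos_iff; auto | exact h2].
  - destruct (cnf_splits _ _ _ _ hc) as (s & q & k & -> & -> & -> & hs).
    destruct (omexp_val _ _ hTn) as (q' & -> & e). apply exp_inj in e. subst q'.
    apply val_inj in hTa. subst q. rewrite S_sub_1 in hR.
    change (upcast s ++ [(val (exp a), k)]) with (upcast s ++ upcast [(exp a, k)]) in hR. rewrite <- upcast_app, lsum_val, usum_app in hR.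
    simpl in hR. rewrite add_0_r in hR. subst R.
    exists a. split; auto.
    eapply approx_add; [exact Ea | exact hlt | exact hs | | |].
    + rewrite Ea. apply (cofinal_id a a Ea (E_lim a Ea) (ule_refl a)).
    + intros j h1 h2. eexists. split; [eauto |]. rewrite Ea. intros h. ord.
    + intros j u h1 h2 ->. apply uadd_val. apply hf; [apply pos_iff; auto | exact h2].
  - destruct (cnf_splits _ _ _ _ hc) as (s & q & k & -> & -> & -> & hs).
    destruct (IH (exp q) eq_refl) as (gam' & -> & hcof & hge). clear IH. rewrite S_sub_1 in hR.
    change (upcast s ++ [(val (exp q), k)]) with (upcast s ++ upcast [(exp q, k)]) in hR. rewrite <- upcast_app, lsum_val, usum_app in hR.
    simpl in hR. rewrite add_0_r in hR. subst R.
    exists gam'. split; auto.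
    eapply approx_add; [exact Ea | exact hlt | exact hs | exact hcof | |].
    + intros j h1 h2. destruct (hge j h1 h2) as (u & h3 & h4). eauto.
    + intros j u h1 h2 e. apply uadd_val. rewrite <- e. apply hf; [apply pos_iff; auto | exact h2].
Qed.

(** * Existence of approximating sequences *)

Lemma omega_fun (H : nat -> U) : exists f : O -> O, forall k, f (val (mul 1 (S k))) = val (H k).
Proof.
  destruct (fun_choice _ _ (fun (j y : U) => forall k, j = mul 1 (S k) -> y = H k)) as [F HF].
  { intros j. destruct (classic (exists k, j = mul 1 (S k))) as [[k e] | n].
    - exists (H k). intros k' e'. rewrite e in e'. apply mul_one_inj in e'. congruence.
    - exists j. intros k e. elim n; eauto. }
  destruct (fun_up F) as [f hf]. exists f. intros k. rewrite hf. f_equal. apply HF; auto.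
Qed.

Lemma fun_down_all (g : O -> O) : exists H : U -> U, forall j u, g (val j) = val u -> H j = u.
Proof.
  apply (fun_choice _ _ (fun (j y : U) => forall u, g (val j) = val u -> y = u)).
  intros j. destruct (classic (exists u, g (val j) = val u)) as [[u e] | n].
  - exists u. intros v e'. apply val_inj. congruence.
  - exists j. intros u e. elim n; eauto.
Qed.

Lemma cnf_last_upcast s q n (T : U) : normal (s ++ [(exp q, n)]) -> T = usum (s ++ [(exp q, n)]) ->
  cnf O lt T (upcast s ++ [(val (exp q), n)]).
Proof.
  intros h ->. change [(val (exp q), n)] with (upcast [(exp q, n)]). rewrite <- upcast_app. apply cnf_val; auto.
Qed.

Lemma nmul_pred q k : nmul O lt (val (exp q)) (S k - 1) (val (mul (exp q) k)).
Proof. rewrite S_sub_1. apply nmul_val; auto. Qed.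

Lemma lsum_pred s q k : lsum O lt (upcast s ++ [(val (exp q), (S k - 1)%nat)]) (val (usum (s ++ [(exp q, k)]))).
Proof.
  rewrite S_sub_1. change [(val (exp q), k)] with (upcast [(exp q, k)]). rewrite <- upcast_app. apply lsum_val; auto.
Qed.

Lemma sigma_ex_exp a T : E a -> a < exp T -> no_eps a (exp T) -> lim (exp T) ->
  (forall L, L < exp T -> a < L -> lim L -> exists gam f, sigma O lt (val a) (val L) gam f) ->
  exists gam f, sigma O lt (val a) (val (exp T)) gam f.
Proof.
  intros Ea hat hne hl IH.
  assert (A1 : largestEps O lt (val a) (val (exp T))).
  { apply largestEps_iff. exists a. repeat split; auto. left; auto. }
  assert (A2 : islim O lt (val (exp T))) by (apply islim_iff; auto).
  assert (A3 : cnf O lt (val (exp T)) [(val (exp T), 1%nat)]).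
  { apply (cnf_val _ [(exp T, 1%nat)]). simpl. rewrite add_0_l, add_0_r. split; auto.
    split; [apply prin_exp |]. split; [lia | split; auto]. apply exp_pos. }
  assert (A4 : omexp O lt (val T) (val (exp T))) by (apply omexp_iff; auto).
  pose proof (E_lt_exp a T Ea hat) as haT.
  destruct (cnf_ex T) as (s0 & eT & hok).
  destruct s0 as [| p s0]. { simpl in eT. pose proof (zero_le a). ord. }
  destruct (cnf_last _ hok) as (s & q & k & e1 & e2); [discriminate |].
  rewrite e1 in hok, eT, e2. clear p s0 e1.
  pose proof (cnf_last_upcast _ _ _ _ hok eT) as A5.
  assert (A6 : omexp O lt (val q) (val (exp q))) by (apply omexp_iff; auto).
  assert (A7 : lsum O lt (upcast s) (val (usum s))) by (apply lsum_val; auto).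
  assert (hqT : exp q <= T). { rewrite eT, e2. apply le_add_r. }
  assert (hT : T < exp T).
  { apply not_E_lt. intros h. assert (T <= a); [| ord]. apply hne; auto. apply exp_ge. }
  destruct (ule_case a q) as [haq | haq].
  - destruct (IH (exp q)) as (gam & g & hg).
    { ord. } { pose proof (exp_ge q). ord. } { apply lim_exp. pose proof (zero_le a). ord. }
    destruct (sigma_approx a _ _ _ hg (exp q) eq_refl) as (gam' & -> & _ & hge).
    destruct (fun_down_all g) as [H HH].
    destruct (fun_up (fun j => exp (usum s + mul (exp q) k + H j))) as [f hf].
    exists (val gam'), f. eapply sg_i_big; eauto.
    intros j h1 h2. destruct (lift_lt _ _ h2) as [i ->]. apply pos_iff in h1.
    destruct (hge i h1 h2) as (u & e & _). rewrite e, hf, (HH i u e).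
    do 3 eexists. split; [apply nmul_pred |]. split; [apply uadd_val; reflexivity |].
    split; [apply uadd_val; reflexivity | apply uexp_val; reflexivity].
  - destruct (zero_succ_lim q) as [-> | [(p & ->) | hlq]].
    + destruct (omega_fun (fun n => mul (exp (usum s + mul 1 k)) (S n))) as [f hf].
      exists (val omega), f. eapply sg_i_zero; eauto.
      * apply zero_iff; auto.
      * apply omega_ord_iff; auto.
      * intros j n h. apply ofnat_val in h. subst j. rewrite hf. rewrite S_sub_1.
        do 3 eexists. split; [apply ofnat_val; reflexivity |]. split; [apply uadd_val; reflexivity |].
        split; [apply uexp_val; reflexivity | apply nmul_val; reflexivity].
    + destruct (omega_fun (fun n => exp (usum s + mul (exp (p + 1)) k + mul (exp p) (S n)))) as [f hf].
      exists (val omega), f. eapply sg_i_succ; eauto.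
      * apply pos_iff. pose proof (succ_lt p). pose proof (zero_le p). ord.
      * apply (E_lim a Ea). pose proof (succ_lt p). ord.
      * apply succ_val; auto.
      * apply omega_ord_iff; auto.
      * intros j n h. apply ofnat_val in h. subst j. rewrite hf.
        do 5 eexists. split; [apply nmul_pred |]. split; [apply uadd_val; reflexivity |].
        split; [apply uexp_val; reflexivity |]. split; [apply nmul_val; reflexivity |].
        split; [apply uadd_val; reflexivity | apply uexp_val; reflexivity].
    + destruct (fun_up (fun j => exp (usum s + mul (exp q) k + exp j))) as [f hf].
      exists (val q), f. eapply sg_i_lim; eauto.
      * apply islim_iff; auto.
      * apply le_iff; auto.
      * intros j _ h2. destruct (lift_lt _ _ h2) as [i ->]. rewrite hf.
        do 4 eexists. split; [apply nmul_pred |]. split; [apply uadd_val; reflexivity |].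
        split; [apply uexp_val; reflexivity |].
        split; [apply uadd_val; reflexivity | apply uexp_val; reflexivity].
Qed.

Lemma sigma_ex a t : E a -> a < t -> no_eps a t -> lim t ->
  exists gam f, sigma O lt (val a) (val t) gam f.
Proof.
  intros Ea. induction (ult_wf t) as [t _ IH]. intros hat hne hl.
  assert (IH' : forall L, L < t -> a < L -> lim L -> exists gam f, sigma O lt (val a) (val L) gam f).
  { intros L h1 h2 h3. apply IH; auto. eapply no_eps_down; [exact hne | left; auto]. }
  clear IH.
  assert (A1 : largestEps O lt (val a) (val t)).
  { apply largestEps_iff. exists a. repeat split; auto. left; auto. }
  assert (A2 : islim O lt (val t)) by (apply islim_iff; auto).
  destruct (cnf_ex t) as (s0 & et & hok).
  destruct s0 as [| p s0]. { simpl in et. pose proof (zero_le a). ord. }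
  destruct (cnf_last _ hok) as (s & q & k & e1 & e2); [discriminate |].
  rewrite e1 in hok, et, e2. clear p s0 e1.
  pose proof (cnf_last_upcast _ _ _ _ hok et) as A5.
  assert (A6 : omexp O lt (val q) (val (exp q))) by (apply omexp_iff; auto).
  destruct s as [| p s].
  - simpl in A5. destruct k as [| k].
    { simpl in et. rewrite add_0_l, add_0_r in et. subst t. apply sigma_ex_exp; auto. }
    assert (hnt : nontriv O (upcast [(exp q, S (S k))])).
    { right. simpl. exists (val (exp q)), (S (S k)). split; auto. lia. }
    assert (hqt : exp q < t).
    { rewrite et. apply (nontriv_lt _ (exp q) (S (S k))); simpl; auto. }
    destruct (ult_total a q) as [h | [<- | h]].
    + destruct (IH' (exp q) hqt) as (gam & g & hg).
      { pose proof (exp_ge q). ord. } { apply lim_exp. pose proof (zero_le a). ord. }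
      destruct (sigma_approx a _ _ _ hg (exp q) eq_refl) as (gam' & -> & _ & hge).
      destruct (fun_down_all g) as [H HH].
      destruct (fun_up (fun j => mul (exp q) (S k) + H j)) as [f hf].
      exists (val gam'), f. eapply sg_ii_big; eauto; [lia |].
      intros j h1 h2. destruct (lift_lt _ _ h2) as [i ->]. apply pos_iff in h1.
      destruct (hge i h1 h2) as (u & e & _). rewrite e, hf, (HH i u e).
      eexists. split; [apply nmul_pred | apply uadd_val; reflexivity].
    + destruct (fun_up (fun j => mul (exp a) (S k) + j)) as [f hf].
      exists (val a), f. eapply sg_ii_eq; eauto; [lia |].
      intros j _ h2. destruct (lift_lt _ _ h2) as [i ->]. rewrite hf.
      eexists. split; [apply nmul_pred | apply uadd_val; reflexivity].
    (* Finite multiples of a power below [a] stay below [a], against [a < t]. *)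
    + exfalso. simpl in et. rewrite add_0_r in et.
      apply (E_exp a q Ea) in h. pose proof (mul_lt_prin a (exp q) (S (S k)) (E_prin a Ea) h) as h'.
      simpl in h'. ord.
  - assert (hnt : nontriv O (upcast ((p :: s) ++ [(exp q, S k)]))).
    { left. rewrite upcast_app, length_app. simpl. lia. }
    assert (hqt : exp q < t).
    { rewrite et. apply (nontriv_lt _ (exp q) (S k)); auto. apply in_app_iff. simpl; auto. }
    assert (hn : upcast (p :: s) <> []) by discriminate.
    destruct (ult_total a q) as [h | [<- | h]].
    + destruct (IH' (exp q) hqt) as (gam & g & hg).
      { pose proof (exp_ge q). ord. } { apply lim_exp. pose proof (zero_le a). ord. }
      destruct (sigma_approx a _ _ _ hg (exp q) eq_refl) as (gam' & -> & _ & hge).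
      destruct (fun_down_all g) as [H HH].
      destruct (fun_up (fun j => usum ((p :: s) ++ [(exp q, k)]) + H j)) as [f hf].
      exists (val gam'), f. eapply sg_iii_big; eauto; [apply lsum_pred |].
      intros j h1 h2. destruct (lift_lt _ _ h2) as [i ->]. apply pos_iff in h1.
      destruct (hge i h1 h2) as (u & e & _). rewrite e, hf, (HH i u e). apply uadd_val; reflexivity.
    + destruct (fun_up (fun j => usum ((p :: s) ++ [(exp a, k)]) + j)) as [f hf].
      exists (val a), f. eapply sg_iii_eq; eauto; [apply lsum_pred |].
      intros j _ h2. destruct (lift_lt _ _ h2) as [i ->]. rewrite hf. apply uadd_val; reflexivity.
    + destruct (fun_up (fun j => usum ((p :: s) ++ [(exp q, k)]) + j)) as [f hf].
      exists (val (exp q)), f. eapply sg_iii_small; eauto; [apply lsum_pred |].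
      intros j _ h2. destruct (lift_lt _ _ h2) as [i ->]. rewrite hf. apply uadd_val; reflexivity.
Qed.

(** * The hierarchy [A] *)

(** The bound [M < r] in the definition of [A] thus says that [t[a := r]] is meaningful. *)
Lemma isM_N (t a x : U) m : E a -> E x -> no_eps a t -> isM O lt t a m ->
  (lt m x <-> exists t', N a x t t').
Proof.
  intros Ea Ex hne (h1 & h2). split.
  - intros hm. apply N_of_InEp; auto. intros e k1 k2.
    destruct h1 as (_ & _ & h1); [eauto |]. specialize (h1 e k1 k2).
    destruct h1 as [h1 | h1]; [apply (lt_trans _ _ _ h1 hm) | red; rewrite h1; auto].
  - intros (t' & ht'). destruct (classic (exists e, InEp O lt e t /\ lt e a)) as [k | k].
    + destruct (h1 k) as (k1 & k2 & _). destruct (InEp_N a x t t' m Ea Ex k1 ht') as (u & -> & _ & _ & k3).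
      exact (k3 k2).
    + apply zero_val in h2; auto. subst m. apply E_pos; auto.
Qed.

(** Without a maximum, the supremum [mu] of the part of [Ep(t)] below [a] would be an epsilon number
    at which substitution into [t] is defined. By [N_shrink] it would also be defined at some member
    [p] of that part close to [mu], and [InEp_N] would give [p < p]. *)
Lemma isM_ex a t : E a -> no_eps a t -> exists m, isM O lt (val t) (val a) m.
Proof.
  intros Ea hne. destruct (classic (exists e, InEp O lt e t /\ lt e a)) as [k | k].
  2: { exists (val 0). split; [tauto |]. intros _. apply zero_iff; auto. }
  destruct (classic (exists m, (InEp O lt m t /\ lt m a) /\ forall e, InEp O lt e t -> lt e a -> le O lt e m))
    as [(m & (k1 & k2) & k3) | n].
  { exists m. split; tauto. }
  exfalso.
  set (P := fun p : U => InEp O lt p t /\ p < a).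
  assert (nmax : forall p, P p -> exists p', P p' /\ p < p').
  { intros p hp. apply NNPP. intros k'. apply n. exists (val p). split; auto.
    intros e h1 h2. destruct (lift_lt _ _ h2) as [u ->]. apply le_iff. apply not_ult. intros h3.
    apply k'. exists u. split; [split |]; auto. }
  destruct (least (fun mu => forall p, P p -> p < mu)) as (mu & hmu & Hmu). { exists a. intros p hp. apply hp. }
  assert (Hna : forall p, InEp O lt (val p) t -> E p).
  { intros p hp. destruct (N_of_InEp a a t Ea Ea hne) as [t' ht']; auto.
    destruct (InEp_N a a t t' p Ea Ea hp ht') as (u & e & h & _). apply val_inj in e. subst; auto. }
  assert (big : forall g, g < mu -> exists p, P p /\ g < p /\ p < mu).
  { intros g hg. assert (exists p, P p /\ g <= p) as (p & hp & hgp).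
    { apply NNPP. intros k'. assert (mu <= g); [| ord]. apply Hmu. intros p hp.
      apply not_ule. intros h. apply k'. eauto. }
    destruct (nmax p hp) as (p' & hp' & h). exists p'. repeat split; try apply hp'; [ord | auto]. }
  assert (mua : mu <= a) by (apply Hmu; intros p hp; apply hp).
  assert (Emu : E mu).
  { apply Lim_E. split.
    - destruct k as (e & k1 & k2). destruct (lift_lt _ _ k2) as [u ->].
      assert (u < mu) by (apply hmu; split; auto). pose proof (zero_le u). ord.
    - intros g hg. destruct (big g hg) as (p & hp & h1 & h2). exists p. split; auto. apply Hna, hp. }
  destruct (N_of_InEp a mu t Ea Emu hne) as [t' ht']. { intros e h1 h2. apply hmu. split; auto. }
  destruct (N_shrink a mu t t' Ea Emu ht') as (g & hg & Hg).
  destruct (big g hg) as (p & hp & h1 & h2). assert (Ep : E p) by apply Hna, hp.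
  destruct (Hg p Ep h1) as [t'' ht'']. destruct hp as (hp1 & hp2).
  destruct (InEp_N a p t t'' p Ea Ep hp1 ht'') as (u & e & _ & _ & h3). apply val_inj in e. subst u.
  specialize (h3 hp2). ord.
Qed.

Lemma N_full a b y y' : E a -> E b -> N a b y y' -> full y -> full y'.
Proof.
  intros Ea Eb H (l & q & r & e & h & h1).
  destruct (N_Lead a b y y' l q r Ea Eb H (conj e h)) as (l' & q' & r' & (e' & h') & h2 & h3).
  exists l', q', r'. split; auto. split; auto.
  apply (N_le_iff a b Ea Eb _ _ _ _ (N_add a b Ea Eb _ _ _ _ (N_exp a b Ea Eb _ _ h2) h3) H). auto.
Qed.

(** A limit point exceeds [1], so points up to [1] do not matter. In [Gd_limit] this lets the index
    [1] be used, which has to lie below [x]. *)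
Lemma Lim_ext X Y r : (forall x, 1 < x -> (X x <-> Y x)) -> Lim X r -> Lim Y r.
Proof.
  intros H (h0 & h). assert (h1 : 1 < r).
  { destruct (ule_case 1 r) as [| k]; auto. exfalso. destruct (h 0 h0) as (x & _ & h1 & h2).
    assert (h3 : x < 1) by ord. apply lt_one in h3. subst. ord. }
  split; auto. intros g hg. destruct (max_below r g 1 hg h1) as (m & m1 & m2 & m3).
  destruct (h m m1) as (x & k1 & k2 & k3). exists x. repeat split; auto; [apply H; auto |]; ord.
Qed.

Lemma LimP_Gd t a X b : (forall x : U, 1 < x -> (X (val x) <-> Gd t a x)) -> (forall x, X x -> le O lt x a) ->
  (LimP O lt X b <-> exists u, b = val u /\ Lim (Gd t a) u).
Proof.
  intros H Hb. split.
  - intros h. assert (k : le O lt b a).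
    { destruct (lt_total b a) as [k | [k | k]]; unfold le; auto. exfalso.
      destruct h as (_ & h). destruct (h a k) as (x & h1 & h2 & _).
      destruct (Hb x h1) as [h3 | ->]; eapply lt_irrefl; eauto. }
    destruct (lift_le _ _ k) as [u ->]. exists u. split; auto. apply LimP_iff in h.
    eapply Lim_ext; [exact H | exact h].
  - intros (u & -> & h). apply LimP_iff. eapply Lim_ext; [| exact h]. intros x hx. symmetry. auto.
Qed.

(** * Successor and limit steps *)

(** Both [l] and [l + 1] are at most [pi l + d (pi l)], so [eta] has the same value at them. *)
Lemma Gd_succ_small t a l v x : E a -> E x -> a <= l -> t = l + 1 -> pd O lt l v -> lt l v ->
  (Gd l a x <-> Gd t a x).
Proof.
  intros Ea Ex hal -> hpd hlv. destruct (Lead_ex a l Ea hal) as (l0 & q & r & HL).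
  apply (pd_iff l l0 q r v HL) in hpd. subst v. change (l < exp (l0 + exp q) + q) in hlv.
  assert (e1 : etaU l (exp (l0 + exp q) + q)) by (exists l0, q, r; auto).
  assert (e2 : etaU (l + 1) (exp (l0 + exp q) + q)).
  { exists l0, q, (r + 1). destruct HL as (e & h). split.
    - split; [rewrite e, add_assoc; auto |]. apply lim_exp; auto.
      pose proof (succ_lt (l0 + exp q)). pose proof (zero_le (l0 + exp q)). ord.
    - apply le_succ in hlv. destruct hlv as [k | k]; [right; auto | left].
      split; [rewrite k; apply ule_refl | auto]. }
  split; intros (h1 & h2 & (t' & h3) & Y & y' & h4 & h5 & h6); (split; [auto | split; [auto | split]]).
  - exists (t' + 1). apply N_add; auto. apply N_one; auto.
  - exists Y, y'. rewrite (etaU_fun _ _ _ h4 e1) in *. auto.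
  - destruct (N_succ_inv a x l t' Ea Ex h3) as (l' & _ & h). eauto.
  - exists Y, y'. rewrite (etaU_fun _ _ _ h4 e2) in *. auto.
Qed.

Lemma etaU_succ_big a l v : E a -> a <= l -> pd O lt (val l) v -> ~ lt l v ->
  etaU l l /\ etaU (l + 1) (l + 1).
Proof.
  intros Ea hal hpd hlv. destruct (Lead_ex a l Ea hal) as (l0 & q & r & HL).
  apply (pd_iff l l0 q r v HL) in hpd. subst v. change (~ l < exp (l0 + exp q) + q) in hlv.
  apply not_ult in hlv. split.
  - exists l0, q, r. auto.
  - exists l0, q, (r + 1). destruct HL as (e & h). split.
    + split; [rewrite e, add_assoc; auto |]. apply lim_exp; auto.
      pose proof (succ_lt (l0 + exp q)). pose proof (zero_le (l0 + exp q)). ord.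
    + left. split; auto. pose proof (succ_lt l). ord.
Qed.

(** With [s = l[a := x]], the left side means [x <^1 s + 1] and the right side only [x <_1 s + 1].
    The way back is [near_of_R1], for which [s] has to be full. *)
Lemma Gd_succ_big a l x : E a -> a <= l -> etaU l l -> etaU (l + 1) (l + 1) ->
  (Lim (Gd l a) x <-> Gd (l + 1) a x).
Proof.
  intros Ea hal e1 e2. split.
  - intros h. destruct (Rup_of_Lim_Gd l a x Ea hal h) as (Ex & h1 & t' & Y & Y' & h2 & h3 & h4 & h5).
    rewrite (etaU_fun _ _ _ h3 e1) in *. pose proof (N_one a x Ea Ex) as N1.
    split; auto. split; auto. split; [exists (t' + 1); apply N_add; auto |].
    exists (l + 1), (Y' + 1). split; auto. split; [apply N_add; auto |]. right. apply Rup_R1; auto.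
  - intros (Ex & h1 & _ & Y & y' & h3 & h4 & h5). rewrite (etaU_fun _ _ _ h3 e2) in *.
    destruct (N_succ_inv a x l y' Ea Ex h4) as (l' & -> & h6).
    apply (Lim_Gd_of_near l a x l' l l'); auto.
    assert (hx : x <= l') by (apply (N_le_iff a x Ea Ex _ _ _ _ (N_base a x) h6); auto).
    apply near_of_R1; auto.
    + apply (N_no_eps a x l); auto.
    + apply (N_full a x l); auto. apply (etaU_full l); auto.
    + apply R1eq_R1; auto. apply lt_succ; auto.
Qed.

(** Here [eta t] is [a + a], and [x <_1 x + x] holds for every epsilon number, so only the condition
    on parameters remains. *)
Lemma Gd_low t a m x : E a -> no_eps a t -> a <= t -> t <= a + a -> isM O lt t a m ->
  (Gd t a x <-> E x /\ x <= a /\ lt m x).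
Proof.
  intros Ea hne hat htaa hm.
  assert (e : etaU t (a + a)).
  { destruct (sub_ex a t hat) as [r ->]. apply add_le_cancel in htaa.
    assert (ea : exp (0 + exp a) = a) by (rewrite add_0_l, !Ea; auto).
    exists 0, a, r. split.
    - split; [rewrite ea; auto |]. rewrite add_0_l, Ea. pose proof (exp_lt _ _ (succ_lt a)) as h.
      rewrite Ea in h. ord.
    - rewrite ea. apply (add_le_r a) in htaa. destruct htaa as [h | ->]; [right; auto | left].
      split; auto. apply ule_refl. }
  split.
  - intros (Ex & h1 & h2 & _). split; auto. split; auto. apply (isM_N t a x m); auto.
  - intros (Ex & h1 & h2). split; auto. split; auto. split; [apply (isM_N t a x m); auto |].
    exists (a + a), (x + x). split; auto. split; [apply N_add; auto; constructor |].
    right. apply R1_E_double; auto.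
Qed.

(** Membership of [x] in [G] at a member [l] of the sequence means [x <_1 s + 1], where [s] is the
    substitution instance of [eta l]. These instances are cofinal in that of [u], and finiteness of
    test sets makes [<_1] continuous on the right. *)
Lemma Gd_limit t a u gam f m x :
  E a -> a <= t -> no_eps a t -> isM O lt t a m -> u <= t -> a < u -> approx a u gam f ->
  (forall l y, l < u -> a <= l -> etaU l y -> y < u) ->
  (forall e t', E e -> e <= a -> N a e t t' -> exists Y y' u',
     etaU t Y /\ N a e Y y' /\ N a e u u' /\ (R1eq e y' <-> R1eq e u')) ->
  (forall l, l < t -> a <= l -> forall b, InA O lt (val l) b <-> G O lt wf (val l) b) ->
  1 < x ->
  ((le O lt (val x) a /\ lt m x /\
    forall j, pos O lt j -> lt j gam -> lt j x -> InA O lt (f j) x) <-> Gd t a x).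
Proof.
  intros Ea hat hne hm hut hau (hcof & hge) Heta Heq IH hx.
  assert (Hl : forall l b, l < u -> a <= l ->
    (InA O lt (val l) (val b) <-> Lim (Gd l a) b)).
  { intros l b h1 h2. rewrite IH; auto; [| ord]. rewrite (G_iff l a); auto.
    - split; [intros (v & e & h); apply val_inj in e; subst; auto | eauto].
    - eapply no_eps_down; [exact hne |]. ord. }
  pose proof hcof as (lgam & hgam & H).
  split.
  - intros (h1 & h2 & h3). apply le_iff in h1.
    (* The index [1] is admissible, and membership in [G] at the member with this index makes [x] an
       epsilon number. *)
    assert (Ex : E x).
    { destruct (N_of_InEp a a u Ea Ea) as [u' hu']; auto. { eapply no_eps_down; eauto. }
      destruct (H a u' Ea (ule_refl a) hu') as (_ & H1 & _).
      pose proof (exp_pos 0) as p1. pose proof (lim_one gam lgam) as g1.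
      destruct (H1 1 p1 g1 (E_one a Ea)) as (l & _ & k1 & k2 & _).
      destruct (hge 1 p1 g1) as (l2 & k3 & k4). rewrite k1 in k3. apply val_inj in k3. subst l2.
      apply (Lim_E x), (Lim_Gd_E l a x), Hl; auto. rewrite <- k1. apply h3; auto. apply pos_iff; auto. }
    destruct (proj1 (isM_N t a x m Ea Ex hne hm) h2) as [t' ht'].
    destruct (Heq x t' Ex h1 ht') as (Y & y' & u' & k1 & k2 & k3 & k4).
    split; auto. split; auto. split; eauto. exists Y, y'. split; auto. split; auto. apply k4.
    destruct (H x u' Ex h1 k3) as (_ & _ & H2).
    assert (xu : x < u') by (apply (N_lt_iff a x Ea Ex _ _ _ _ (N_base a x) k3); auto).
    right. apply R1_unfold. split; auto. intros B HB.
    (* A test set below [u'] lies below the instance [l'] of some member, where the relation given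
       by [G] already provides an embedding. *)
    destruct (list_bound B u' (fun x g => x <= g)) as (z & hz & Hz).
    { pose proof (zero_le x). ord. }
    { intros; ord. }
    { intros w hw. exists w. split; auto. apply ule_refl. }
    destruct (H2 z hz) as (j & l & l' & p1 & p2 & p3 & p4 & p5 & p6 & p7).
    destruct (hge j p1 p2) as (l2 & p8 & p9). rewrite p4 in p8. apply val_inj in p8. subst l2.
    assert (hG : Lim (Gd l a) x).
    { apply Hl; auto. rewrite <- p4. apply h3; auto. apply pos_iff; auto. }
    destruct (Rup_of_Lim_Gd l a x Ea p9 hG) as (_ & _ & l'' & Yl & Yl' & q1 & q2 & q3 & q4).
    apply Rup_R1, R1_unfold in q4. apply q4. intros w hw. apply lt_succ.
    assert (l' <= Yl').
    { apply (N_le_iff a x Ea Ex _ _ _ _ p6 q3). apply etaU_le; auto. }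
    specialize (Hz w hw). ord.
  - intros (Ex & h1 & (t' & ht') & Y & y' & h3 & h4 & h5).
    split; [apply le_iff; auto |]. split; [apply (isM_N t a x m); eauto |].
    destruct (Heq x t' Ex h1 ht') as (Y2 & y2 & u' & k1 & k2 & k3 & k4).
    rewrite (etaU_fun _ _ _ k1 h3) in *. rewrite (N_fun a x Ea Ex _ _ _ k2 h4) in *. apply k4 in h5.
    destruct (H x u' Ex h1 k3) as (_ & H1 & _).
    intros j p1 p2 p3. destruct (lift_lt _ _ p2) as [i ->]. apply pos_iff in p1.
    destruct (H1 i p1 p2 p3) as (l & l' & q1 & q2 & q3).
    destruct (hge i p1 p2) as (l2 & q4 & q5). rewrite q1 in q4. apply val_inj in q4. subst l2.
    rewrite q1. apply Hl; auto. destruct (etaU_ex a l Ea q5) as [Yl hYl].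
    destruct (N_etaU a x l l' Yl Ea Ex q3 hYl) as [Yl' hYl'].
    (* By [Heta], [eta l] is below [u], so [x] is related to the successor of [Yl']; [near_of_R1]
       turns this into a limit. *)
    apply (Lim_Gd_of_near l a x l' Yl Yl'); auto.
    assert (hxY : x <= Yl').
    { apply (N_le_iff a x Ea Ex _ _ _ _ (N_base a x) hYl'). pose proof (etaU_le _ _ hYl). ord. }
    apply near_of_R1; auto.
    + apply (N_no_eps a x Yl); auto.
    + apply (N_full a x Yl); auto. apply (etaU_full l); auto.
    + apply (R1eq_lt x (Yl' + 1) u'); auto; [apply lt_succ; auto |]. apply le_succ.
      apply (N_lt_iff a x Ea Ex _ _ _ _ hYl' k3). apply (Heta l); auto.
Qed.

(* The hypotheses of [Gd_limit] on u, for u = t in the case [v < t] and for u = pi t otherwise *)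
Lemma limit_high t l q r : Lead t l q r -> exp (l + exp q) + q < t ->
  forall k y, k < t -> etaU k y -> y < t.
Proof.
  intros (e & h) hv k y hk (l' & q' & r' & (e' & h') & [(h1 & ->) | (h1 & ->)]); auto.
  destruct (ult_total (l' + exp q') (l + exp q)) as [h2 | [h2 | h2]].
  - assert (exp (l' + exp q') + q' < exp (l + exp q)).
    { apply lead_below; auto. pose proof (last_le_exp l' q').
      pose proof (exp_lt _ _ (succ_lt (l' + exp q'))). ord. }
    pose proof (le_add_l (exp (l + exp q)) r). rewrite <- e in H0. ord.
  - rewrite h2. apply last_uniq in h2. subst q'. auto.
  - pose proof (lead_lt _ r _ r' h h2). rewrite <- e, <- e' in H. ord.
Qed.

Lemma limit_pi K k y : k < exp K -> etaU k y -> y < exp K.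
Proof.
  intros hk (l' & q' & r' & (e' & h') & [(h1 & ->) | (h1 & ->)]); auto.
  apply lead_below.
  - pose proof (last_le_exp l' q'). pose proof (exp_lt _ _ (succ_lt (l' + exp q'))). ord.
  - apply exp_lt_cancel. pose proof (le_add_l (exp (l' + exp q')) r'). rewrite <- e' in H. ord.
Qed.

Lemma geEw_eps (t : U) : geEw O lt t -> exists e, E e /\ e <= t /\ forall l : U, e <= l -> geEw O lt l.
Proof.
  intros (e0 & h1 & h2). destruct (lift_le _ _ h2) as [e ->]. exists e.
  split; [apply Eps_iff, h1 |]. split; [apply le_iff; auto |].
  intros l h. exists (val e). split; auto. apply le_iff; auto.
Qed.

(** If [pi t] were [a], then [d (pi t)] would be [a] as well and [t] at most [a + a]. *)
Lemma lt_leading a t l q r : E a -> Lead t l q r -> a + a < t -> a <= t ->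
  t <= exp (l + exp q) + q -> a < exp (l + exp q).
Proof.
  intros Ea (et & hr) h1 hat hv. destruct (ult_total a (l + exp q)) as [k | [k | k]].
  - pose proof (exp_ge (l + exp q)). ord.
  - exfalso. assert (H : a = q).
    { apply (last_uniq 0 a l q). rewrite add_0_l, Ea. auto. }
    rewrite <- k, Ea, <- H in hv. ord.
  - exfalso. pose proof (lead_below _ _ _ hr k) as k'. rewrite <- et, Ea in k'. ord.
Qed.

(** Each clause of [A] becomes an equivalence for arbitrary auxiliary data. Inversion supplies the
    data in one direction, [isM_ex] and [sigma_ex] in the other. *)
Lemma InA_iff_G (t : U) : geEw O lt t -> forall b, InA O lt t b <-> G O lt wf t b.
Proof.
  induction (ult_wf t) as [t _ IH0]. intros hg b.
  destruct (geEw_eps t hg) as (e & Ee & het & hge).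
  destruct (largest_eps_ex e t Ee het) as (a & Ea & hat & hne).
  assert (hea : e <= a) by (apply hne; auto).
  assert (IH : forall l, l < t -> a <= l -> forall b, InA O lt (val l) b <-> G O lt wf (val l) b).
  { intros l h1 h2. apply IH0; auto. apply hge. ord. }
  clear IH0. rewrite (G_iff t a b Ea hat hne).
  assert (hL : largestEps O lt (val a) t) by (apply largestEps_iff; eauto).
  assert (Leq : forall x, largestEps O lt x t -> x = val a).
  { intros x h. apply largestEps_iff in h. destruct h as (a' & -> & k1 & k2 & k3). f_equal.
    apply (largest_eps_unique a' a t); auto. }
  destruct (Lead_ex a t Ea hat) as (l0 & q & r & HL).
  pose proof (fun v => pd_iff t l0 q r v HL) as Hpd.
  (* In the first case [Gd] does not change from [l] to [t]; in the second, [Gd t a] is [G] at [l],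
     so that [G] at [t] takes limit points once more. *)
  assert (Csucc : forall l v, t = l + 1 -> pd O lt l v ->
    (lt l v -> (InA O lt l b <-> exists u, b = val u /\ Lim (Gd t a) u)) /\
    (~ lt l v -> (LimP O lt (InA O lt l) b <-> exists u, b = val u /\ Lim (Gd t a) u))).
  { intros l v et hpd.
    assert (hal : a <= l).
    { apply lt_succ. rewrite <- et. destruct hat as [| eat]; auto. exfalso.
      assert (l < a) by (rewrite eat, et; apply succ_lt). apply (E_lim a Ea) in H.
      rewrite <- et in H. ord. }
    assert (hlt : l < t) by (rewrite et; apply succ_lt).
    assert (hnl : no_eps a l) by (eapply no_eps_down; [exact hne | left; auto]).
    assert (HIl : forall b, InA O lt l b <-> exists u, b = val u /\ Lim (Gd l a) u).
    { intros c. rewrite IH, (G_iff l a); auto. tauto. }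
    split; intros hlv.
    - rewrite HIl.
      assert (A : forall x, 1 < x -> (Gd l a x <-> Gd t a x)).
      { intros x _. destruct (classic (E x)) as [Ex | n].
        - apply (Gd_succ_small t a l v); auto.
        - split; intros (h & _); tauto. }
      split; intros (u & -> & h); exists u; (split; [auto |]); eapply Lim_ext; [exact A | exact h | | exact h].
      intros x hx. symmetry. auto.
    - destruct (etaU_succ_big a l v Ea hal hpd hlv) as (e1 & e2). apply LimP_Gd.
      + intros x hx. rewrite HIl. rewrite et, <- (Gd_succ_big a l x); auto.
        split; [intros (u & k & h); apply val_inj in k; subst; auto | eauto].
      + intros x hx. apply HIl in hx. destruct hx as (u & -> & hu). apply le_iff.
        apply (Rup_of_Lim_Gd l a u Ea hal hu). }
  assert (Clow : forall m, t <= a + a -> isM O lt t a m ->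
    (LimEps O lt b /\ lt m b /\ le O lt b a <-> exists u, b = val u /\ Lim (Gd t a) u)).
  { intros m h1 hm. pose proof (fun x => Gd_low t a m x Ea hne hat h1 hm) as HG.
    split.
    - intros (h2 & h3 & h4). destruct (lift_le _ _ h4) as [u ->]. exists u. split; auto.
      apply LimP_iff in h2. destruct (lift_lt _ _ h3) as [m' ->]. apply le_iff in h4.
      split; [apply h2 |]. intros g hgu.
      (* The epsilon numbers approaching [u] can be taken above [m'], which moves the lower bound
         inside the limit. *)
      destruct (max_below u g m' hgu h3) as (n & n1 & n2 & n3). apply h2 in n1.
      destruct n1 as (x & k1 & k2 & k3). apply Eps_iff in k1. exists x. split; [| split; ord].
      apply HG. split; auto. split; [ord |]. change (m' < x). ord.
    - intros (u & -> & hu). destruct (Rup_of_Lim_Gd t a u Ea hat hu) as (Eu & k1 & t' & _ & _ & k2 & _).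
      split; [| split; [apply (isM_N t a u m); eauto | apply le_iff; auto]].
      apply LimP_iff. apply Lim_Gd_E in hu. destruct hu as (k & hu). split; auto.
      intros g hgu. destruct (hu g hgu) as (x & k3 & k4). exists x. split; auto. apply Eps_iff; auto. }
  set (X := fun gam m (f : O -> O) x => le O lt x a /\ lt m x /\
    forall j, pos O lt j -> lt j gam -> lt j x -> InA O lt (f j) x).
  assert (Chigh : forall m gam f, a + a < t -> isM O lt t a m -> exp (l0 + exp q) + q < t ->
    sigma O lt a t gam f -> (LimP O lt (X gam m f) b <-> exists u, b = val u /\ Lim (Gd t a) u)).
  { intros m gam0 f h1 hm hv hsig.
    destruct (sigma_approx a _ _ _ hsig t eq_refl) as (gam & -> & hap).
    apply LimP_Gd; [| intros x hx; apply hx].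
    intros x hx. apply (Gd_limit t a t gam f m x); auto.
    - apply ule_refl.
    - pose proof (le_add_l a a). ord.
    - intros l y k1 _. apply (limit_high t l0 q r HL hv l y k1).
    - intros c t' Ec hca ht'. exists t, t', t'. repeat split; auto. exists l0, q, r. split; auto. left.
      split; auto. left; auto. }
  assert (Cpi : forall m p gam f, a + a < t -> isM O lt t a m -> t <= exp (l0 + exp q) + q ->
    pi O lt t p -> sigma O lt a p gam f ->
    (LimP O lt (X gam m f) b <-> exists u, b = val u /\ Lim (Gd t a) u)).
  { intros m p gam0 f h1 hm hv hp hsig. destruct HL as (et & hr).
    apply pi_iff in hp. destruct hp as (K & r' & -> & et' & hr').
    destruct (lead_uniq (l0 + exp q) r K r') as (<- & _); auto; [congruence |].
    destruct (sigma_approx a _ _ _ hsig _ eq_refl) as (gam & -> & hap).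
    apply LimP_Gd; [| intros x hx; apply hx].
    pose proof (lt_leading a t l0 q r Ea (conj et hr) h1 hat hv) as hK.
    assert (hpt : exp (l0 + exp q) <= t) by (rewrite et; apply le_add_l).
    intros x hx. apply (Gd_limit t a (exp (l0 + exp q)) gam f m x); auto.
    - intros l y k1 _. apply limit_pi; auto.
    - intros c t' Ec hca ht'.
      destruct (N_Lead a c t t' l0 q r Ea Ec ht' (conj et hr)) as (l' & q' & r2 & _ & k1 & k2).
      pose proof (N_exp a c Ea Ec _ _ k1) as k3.
      exists (exp (l0 + exp q) + q), (exp (l' + exp q') + q'), (exp (l' + exp q')).
      split.
      { exists l0, q, r. split; [split; auto |]. destruct hv as [hv | hv]; [right; auto | left].
        rewrite hv. split; auto. apply ule_refl. }
      split; [apply N_add; auto |]. split; auto. split; intros R.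
      + eapply R1eq_down; [exact R | | apply le_add_l]. left.
        apply (N_lt_iff a c Ea Ec _ _ _ _ (N_base a c) k3); auto.
      (* Reaching the instance of [pi t] suffices: by [R1_exp_last] it is related to itself plus
         [q'], and transitivity leads on to the instance of [eta t]. *)
      + destruct (zero_or_pos q') as [-> | q0]; [rewrite add_0_r; auto |].
        eapply R1eq_trans; [exact R |]. right. apply R1_exp_last; auto. apply ule_refl. }
  split.
  - intros H. inversion H; subst.
    + destruct (lift_lt _ _ (proj1 H1)) as [l' ->]. apply succ_val, val_inj in H1.
      apply (proj1 (Csucc l' v H1 H2)); auto.
    + destruct (lift_lt _ _ (proj1 H1)) as [l' ->]. apply succ_val, val_inj in H1.
      apply (proj2 (Csucc l' v H1 H2)); auto. split; auto.
    + apply Leq in H2. subst a0. apply uadd_val in H4. subst a2. apply le_iff in H5.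
      apply (Clow m); auto.
    + apply Leq in H2. subst a0. apply uadd_val in H4. subst a2. apply Hpd in H6. subst v.
      apply (Chigh m gam f); auto. split; auto.
    + apply Leq in H2. subst a0. apply uadd_val in H4. subst a2. apply Hpd in H6. subst v.
      apply le_iff in H7. apply (Cpi m p gam f); auto. split; auto.
  - intros H. destruct (zero_succ_lim t) as [-> | [(l & et) | hl]].
    + exfalso. pose proof (E_pos a Ea). ord.
    + assert (hs : succ O lt l t) by (apply succ_val; congruence).
      assert (hal : a <= l).
      { apply lt_succ. rewrite <- et. destruct hat as [| eat]; auto. exfalso.
        assert (h : l < a) by (rewrite eat, et; apply succ_lt). apply (E_lim a Ea) in h.
        rewrite <- et in h. ord. }
      destruct (Lead_ex a l Ea hal) as (l1 & q1 & r1 & HL1).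
      pose proof (proj2 (pd_iff l l1 q1 r1 _ HL1) eq_refl) as hpd.
      destruct (Csucc l _ et hpd) as (C1 & C2).
      destruct (classic (lt l (val (exp (l1 + exp q1) + q1)))) as [k | k].
      * eapply A_succ_same; eauto. apply C1; auto.
      * apply C2 in H; auto. destruct H. eapply A_succ_lim; eauto.
    + apply islim_iff in hl as hl'. destruct (isM_ex a t Ea hne) as [m hm].
      assert (haa : add O lt a a (val (a + a))) by (apply uadd_val; auto).
      destruct (ule_case (a + a) t) as [k | k].
      2: { apply (Clow m) in H; auto. destruct H as (k1 & k2 & k3).
        eapply A_lim_low; eauto. apply le_iff; auto. }
      assert (hat' : a < t). { pose proof (le_add_l a a). ord. }
      pose proof (proj2 (Hpd _) eq_refl) as hpd.
      destruct (ule_case (exp (l0 + exp q) + q) t) as [kv | kv].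
      * destruct (sigma_ex a t Ea hat' hne hl) as (gam & f & hsig).
        apply (Chigh m gam f) in H; auto. destruct H as (k1 & k2).
        eapply A_lim_high; eauto.
      * destruct HL as (et & hr).
        assert (hpi : pi O lt t (val (exp (l0 + exp q)))) by (apply pi_iff; eauto).
        assert (hpt : exp (l0 + exp q) <= t) by (rewrite et; apply le_add_l).
        pose proof (lt_leading a t l0 q r Ea (conj et hr) k hat kv) as hK.
        destruct (sigma_ex a (exp (l0 + exp q)) Ea hK) as (gam & f & hsig).
        { eapply no_eps_down; eauto. }
        { apply lim_exp. apply (E_lt_exp a _ Ea) in hK. pose proof (zero_le a). ord. }
        apply (Cpi m (val (exp (l0 + exp q))) gam f) in H; auto. destruct H as (k1 & k2).
        eapply A_lim_pi; eauto. apply le_iff; auto.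
Qed.

Lemma G_LimEps (t : U) b : geEw O lt t -> G O lt wf t b -> LimEps O lt b.
Proof.
  intros hg h. destruct (geEw_eps t hg) as (e & Ee & het & _).
  destruct (largest_eps_ex e t Ee het) as (a & Ea & hat & hne).
  apply (G_iff t a b Ea hat hne) in h. destruct h as (u & -> & hu). apply LimP_iff.
  apply Lim_Gd_E in hu. destruct hu as (k & hu). split; auto.
  intros g hgu. destruct (hu g hgu) as (x & k3 & k4). exists x. split; auto. apply Eps_iff; auto.
Qed.

End Ordinals.

Theorem mainTheorem15 (O : Type) (lt : O -> O -> Prop) (wf : well_founded lt)
    (lt_trans : forall x y z, lt x y -> lt y z -> lt x z)
    (lt_total : forall x y, lt x y \/ x = y \/ lt y x)
    (t : O)
    (Ht : geEw O lt t)
    (Hbig : exists e, Eps O lt e /\ lt t e) :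
  (forall b, G O lt wf t b -> LimEps O lt b) /\
  (forall b, G O lt wf t b <-> InA O lt t b).
Proof.
  (* The epsilon number above [t] serves as the bound of the universe [U] in which [t] lies. *)
  destruct Hbig as (E0 & hE & htE).
  set (t' := exist (fun x => lt x E0) t htE : U O lt E0).
  split; intros b.
  - apply (G_LimEps O lt wf lt_trans lt_total E0 hE t' b Ht).
  - symmetry. apply (InA_iff_G O lt wf lt_trans lt_total E0 hE t' Ht b).
Qed.
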